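(* Let $B$ be a finite connected bipartite graph, and let $\Bbbk[B]$ be its toric edge ring. Then: (1) $\Bbbk[B]$ has a $2$-linear resolution if and only if $B$ is obtained by appending (possibly no) trees to the vertices of a complete bipartite graph $K_{2,m}$ for some integer $m\ge2$. (2) If $q\ge3$ and $\Bbbk[B]$ has a $q$-linear resolution, then $\Bbbk[B]$ is a hypersurface.
   Context: Let $\Bbbk$ be a field. For a finite simple graph $G$ with vertex set $V$ and edge set $E$, the toric edge ring $\Bbbk[G]$ is the $\Bbbk$-subalgebra of the polynomial ring $\Bbbk[V]$ generated by the monomials $uv$ with $\{u,v\}\in E$. The toric edge ideal $J_G$ is the kernel of the map $\Bbbk[E]\to\Bbbk[V]$ sending the variable of an edge $e=\{u,v\}$ to $uv$, so that $\Bbbk[G]\cong\Bbbk[E]/J_G$. $\Bbbk[G]$ has a $q$-linear resolution if its graded Betti numbers $\beta_{i,j}$ as a $\Bbbk[E]$-module (standard grading) satisfy $\beta_{i,j}=0$ for all $i\ge1$ and all $j\ne q+i-1$, where it is understood (as in the paper) that in this case $J_G$ is generated by homogeneous polynomials of degree $q$ and $\mathrm{reg}(\Bbbk[G])=q-1$; in particular $J_G\neq0$. $\Bbbk[G]$ is a hypersurface if $J_G$ is generated by a single polynomial. Appending a tree to a vertex $v$ means gluing a tree to the graph by identifying one of its vertices with $v$. *)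

(* Defs.v *)
From HB Require Import structures.
From mathcomp Require Import all_boot all_order all_algebra.
From mathcomp Require Import mpoly.

Set Implicit Arguments.
Unset Strict Implicit.
Unset Printing Implicit Defensive.

Import GRing.Theory.
Local Open Scope ring_scope.

Record sgraph := SGraph {
  vertex :> finType;
  adj : rel vertex;
  adj_sym : ssrbool.symmetric adj;
  adj_irrefl : irreflexive adj
}.

Definition connected (G : sgraph) : Prop :=
  (0 < #|G|)%N /\ forall x y : G, connect (@adj G) x y.

Definition bipartite (G : sgraph) : Prop :=
  exists side : G -> bool, forall x y : G, adj x y -> side x != side y.

(* For a symmetric relation [:: x; y] is a ucycle whenever x and y are
   adjacent, so graph cycles are the ucycles of length at least 3. *)
Definition acyclic (G : sgraph) : Prop :=
  forall c : seq G, ucycle (@adj G) c -> (size c < 3)%N.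

Definition is_tree (G : sgraph) : Prop := connected G /\ acyclic G.

Definition graph_iso (G H : sgraph) : Prop :=
  exists f : G -> H, bijective f /\ forall x y : G, adj (f x) (f y) = adj x y.

Section CompleteBipartite.
Variables a b : nat.

Definition Kab_adj : rel ('I_a + 'I_b)%type := fun x y =>
  match x, y with
  | inl _, inr _ | inr _, inl _ => true
  | _, _ => false
  end.

Lemma Kab_sym : ssrbool.symmetric Kab_adj. Proof. by case=> ? []. Qed.
Lemma Kab_irrefl : irreflexive Kab_adj. Proof. by case. Qed.

Definition complete_bipartite := SGraph Kab_sym Kab_irrefl.

End CompleteBipartite.

(* The graph obtained from G by gluing, for every vertex v of G, the graph T v
   to G along the identification of r v with v.  The vertex (v, r v) of the
   result is the vertex v of G.  When T v is a single vertex nothing is glued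
   at v, and gluing several trees at v amounts to gluing one tree, their union
   amalgamated at v. *)
Section Append.
Variables (G : sgraph) (T : G -> sgraph) (r : forall v : G, T v).

Definition append_adj : rel {v : G & T v} := fun p q =>
  ((tag p == tag q) && adj (tagged p) (tagged_as p q))
  || [&& tagged p == r (tag p), tagged q == r (tag q) & adj (tag p) (tag q)].

Lemma append_sym : ssrbool.symmetric append_adj.
Proof.
move=> [u x] [v y]; rewrite /append_adj /= [adj v u]adj_sym.
rewrite [_ && (_ && adj u v)]andbCA; congr (_ || _).
have [uv|//] := eqVneq u v.
by subst v; rewrite !tagged_asE adj_sym.
Qed.

Lemma append_irrefl : irreflexive append_adj.
Proof. by move=> [u x]; rewrite /append_adj /= tagged_asE !adj_irrefl !andbF. Qed.

Definition append_graphs := SGraph append_sym append_irrefl.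

End Append.

Definition obtained_by_appending_trees (G H : sgraph) : Prop :=
  exists (T : G -> sgraph) (r : forall v : G, T v),
    (forall v : G, is_tree (T v)) /\ graph_iso H (append_graphs r).

Definition edges (G : sgraph) : {set {set G}} :=
  [set e : {set G} |
    [exists x : G, [exists y : G, adj x y && (e == [set x; y])]]].

Section ToricEdgeIdeal.
Variables (k : fieldType) (G : sgraph).

(* k[V] is {mpoly k[#|G|]}, with the vertex v numbered enum_rank v, and k[E] is
   {mpoly k[#|edges G|]}, whose i-th variable is that of the edge enum_val i. *)
Definition edge_monomial (i : 'I_#|edges G|) : {mpoly k[#|G|]} :=
  \prod_(v in enum_val i) 'X_(enum_rank v).

Definition edge_map (p : {mpoly k[#|edges G|]}) : {mpoly k[#|G|]} :=
  p \mPo [tuple edge_monomial i | i < #|edges G|].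

Definition toric_edge_ideal : {pred {mpoly k[#|edges G|]}} :=
  fun p => edge_map p == 0.

End ToricEdgeIdeal.

Section Resolutions.
Variables (k : fieldType) (n : nat).
Local Notation S := {mpoly k[n]}.

(* A graded free resolution
     ... -> F_2 -> F_1 -> F_0 = S -> S/I -> 0
   over the standard graded polynomial ring S, with F_i = \bigoplus_c
   S(- res_shift i c) of finite rank.  Elements of F_i are row vectors and the
   differential F_(i+1) -> F_i is v |-> v *m res_diff i.  The field res_aug is
   exactness at F_0. *)
Record graded_resolution (I : {pred S}) := GradedResolution {
  res_rank : nat -> nat;
  res_shift : forall i, 'I_(res_rank i) -> nat;
  res_diff : forall i, 'M[S]_(res_rank i.+1, res_rank i);
  res_rank0 : res_rank 0 = 1%N;
  res_shift0 : forall c : 'I_(res_rank 0), res_shift c = 0%N;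
  res_homog : forall i (r : 'I_(res_rank i.+1)) (c : 'I_(res_rank i)) m,
    m \in msupp (res_diff i r c) -> (mdeg m + res_shift c = res_shift r)%N;
  res_aug : forall f : S,
    f \in I <-> exists w : 'rV_(res_rank 1), const_mx f = w *m res_diff 0;
  res_exact : forall i (v : 'rV_(res_rank i.+1)),
    v *m res_diff i = 0 <->
    exists w : 'rV_(res_rank i.+2), v = w *m res_diff i.+1
}.

Variable I : {pred S}.

(* The differentials have entries in the homogeneous maximal ideal of S. *)
Definition minimal_resolution (F : graded_resolution I) : Prop :=
  forall i (r : 'I_(res_rank F i.+1)) (c : 'I_(res_rank F i)),
    (res_diff F i r c)@_0%MM = 0.

Definition betti (F : graded_resolution I) (i j : nat) : nat :=
  #|[set c : 'I_(res_rank F i) | res_shift c == j]|.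

(* The graded Betti numbers of S/I are those of a minimal graded free
   resolution, which is unique up to isomorphism.  The condition on the Betti
   numbers alone would hold for I = 0 and every q, hence the first conjunct. *)
Definition linear_resolution (q : nat) : Prop :=
  (exists2 f : S, f \in I & f != 0) /\
  exists F : graded_resolution I, minimal_resolution F /\
    forall i j, (1 <= i)%N -> j != (q + (i - 1))%N -> betti F i j = 0%N.

Definition principal : Prop :=
  exists g : S, forall f : S, f \in I <-> exists h : S, f = h * g.

End Resolutions.

(* These concern k[G] through k[G] = k[E]/J_G. *)
Definition has_linear_resolution (k : fieldType) (G : sgraph) (q : nat) : Prop :=
  linear_resolution (@toric_edge_ideal k G) q.

Definition is_hypersurface (k : fieldType) (G : sgraph) : Prop :=
  principal (@toric_edge_ideal k G).

(* Main.v *)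
Require Import Defs.
From HB Require Import structures.
From mathcomp Require Import all_boot all_order all_algebra.
From mathcomp Require Import mpoly zify ring.
From Stdlib Require Import Classical ClassicalEpsilon.

Set Implicit Arguments.
Unset Strict Implicit.
Unset Printing Implicit Defensive.

Import GRing.Theory Num.Theory Order.TTheory.

(** The toric edge ideal is the kernel of a map sending monomials to monomials,
    so it is spanned by the binomials M - M' of two monomials of the same
    weight, the weight of M being the degree sequence of the multiset of edges
    that it represents.  Everything is read off the fibres of the weight.

    To prove that a resolution is linear, no resolution is written down.  The
    predicate linres says, coinductively, that a module is generated by rows of
    linear forms whose module of relations has the same property; it is stable
    under extensions (linres_extension, linres_quotient), and gives back a
    minimal resolution (linear_resolution_of_linres).  The 2-minors of a generic
    2 x m matrix are obtained by adding the columns one after another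
    (minors_linear_resolution).  When trees are appended to a complete bipartite
    graph K_(2,m), a cut argument (cut_exponent, tree_exponent) shows that the
    exponents of the tree edges are constant on each fibre; hence the toric
    ideal is the ideal of these minors, which is one direction of the
    equivalence (trees_linear_resolution).

    To exploit a linear resolution, refine it to the grading by weights.  Each
    of its steps sits in a single total degree, so there is no cancellation in
    the K-polynomial of the ring and the signs of its coefficients are known
    (euler_sign).  On weights supported by a set of vertices these coefficients
    only depend on the induced subgraph (local_euler_sign), which excludes a
    few small configurations by computation.  For q = 2 these are hexagons
    without restriction on the chords, and two squares that are disjoint or
    touch in a vertex, with few edges between them.  As the ideal is generated
    by quadrics, long cycles could be shortened to hexagons (no_long_cycle), so
    that all cycles are squares.  Choose a1 and a2 with the largest number of
    common neighbours: every square has them as opposite vertices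
    (square_base).  All cycles then lie in the complete bipartite graph formed
    by a1, a2 and their common neighbours, and the rest of the graph consists
    of trees attached to it (linear_resolution_decomposition).

    For q >= 3 every cycle has length at least 2 q, since it gives a binomial of
    half its length (girth), and a binomial of degree q is a cycle of length
    2 q cut into its two perfect matchings (fibre_cycle).  If the ideal is not
    principal, a nonzero linear syzygy yields two monomials of degree q, each
    one half of a binomial, that differ in one variable (nonprincipal_overlap).
    The two corresponding cycles then share a path, and comparing its ends gives
    a cycle of length 4 or 6.  By the girth bound q = 3, and the graph contains
    three paths of length 3 between two vertices; this last configuration has a
    nonlinear second syzygy (no_theta). *)

Local Open Scope ring_scope.

(** * Parts of a polynomial selected by its exponents *)

Section Restriction.
Variables (n : nat) (R : idomainType).
Local Notation S := {mpoly R[n]}.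
Implicit Types (p q w : S) (P Q : pred 'X_{1..n}).

Definition restr P p : S := \sum_(m <- msupp p | P m) p@_m *: 'X_[m].

Lemma mcoeff_restr P p m : (restr P p)@_m = if P m then p@_m else 0.
Proof.
rewrite /restr raddf_sum /=.
have [mp|mp] := boolP (m \in msupp p); last first.
  rewrite (memN_msupp_eq0 mp) if_same big_seq_cond big1 // => m' /andP[m'p _].
  rewrite mcoeffZ mcoeffX; have [e|] := eqVneq m' m; last by rewrite mulr0.
  by rewrite -e m'p in mp.
case: ifP => Pm.
  rewrite big_mkcond (bigD1_seq m) //= Pm mcoeffZ mcoeffX eqxx mulr1.
  rewrite big1 ?addr0 // => m' /negPf ne.
  by rewrite mcoeffZ mcoeffX ne mulr0 if_same.
rewrite big1 // => m' Pm'; rewrite mcoeffZ mcoeffX.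
by have [e|] := eqVneq m' m; rewrite ?mulr0 //; rewrite e Pm in Pm'.
Qed.

Lemma restr_is_additive P : additive (restr P).
Proof.
move=> p q; apply/mpolyP=> m; rewrite mcoeffB !mcoeff_restr mcoeffB.
by case: ifP; rewrite ?subr0.
Qed.

HB.instance Definition _ P := GRing.isAdditive.Build S S (restr P)
  (restr_is_additive P).

Lemma restrZ P c p : restr P (c *: p) = c *: restr P p.
Proof.
apply/mpolyP=> m; rewrite mcoeffZ !mcoeff_restr mcoeffZ.
by case: ifP; rewrite ?mulr0.
Qed.

Lemma restr_id P p : {in msupp p, forall m, P m} -> restr P p = p.
Proof.
move=> Pp; apply/mpolyP=> m; rewrite mcoeff_restr; case: ifP => // Pm.
by apply/esym/memN_msupp_eq0/negP => /Pp; rewrite Pm.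
Qed.

Lemma msupp_restr P p m : m \in msupp (restr P p) -> P m /\ m \in msupp p.
Proof.
by rewrite !mcoeff_msupp mcoeff_restr; case: ifP; rewrite ?eqxx.
Qed.

(** The compatibility of graded components with products, in a form that serves
    the grading by degree and the one by weight alike. *)
Lemma restrM P Q w p :
  (forall m1 m2, m2 \in msupp p -> P (m1 + m2)%MM = Q m1) ->
  restr P (w * p) = restr Q w * p.
Proof.
move=> PQ; rewrite [in LHS](mpolyE w) [in RHS](mpolyE w).
rewrite mulr_suml !raddf_sum mulr_suml; apply: eq_bigr => m1 _ /=.
rewrite -scalerAl !restrZ -scalerAl; congr (_ *: _).
apply/mpolyP=> m; rewrite mcoeff_restr.
have -> : restr Q 'X_[m1] = if Q m1 then 'X_[m1] else 0.
  apply/mpolyP=> m'; rewrite mcoeff_restr mcoeffX; have [<-|ne] := eqVneq m1 m'.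
    by case: ifP; rewrite ?mcoeffX ?eqxx ?mcoeff0.
  by rewrite if_same; case: ifP; rewrite ?mcoeffX ?(negPf ne) ?mcoeff0.
have [m1m|] := boolP (m1 <= m)%MM.
  rewrite -(submK m1m) addmC.
  have e1 : ('X_[m1] * p)@_(m1 + (m - m1)) = p@_(m - m1).
    by rewrite mulrC mcoeffMX.
  have [mp|mp] := boolP ((m - m1)%MM \in msupp p).
    by rewrite PQ //; case: ifP; rewrite ?mul0r ?mcoeff0.
  rewrite e1 (memN_msupp_eq0 mp) if_same; case: ifP => _.
    by rewrite e1 (memN_msupp_eq0 mp).
  by rewrite mul0r mcoeff0.
move=> nle; have z : ('X_[m1] * p)@_m = 0.
  apply/memN_msupp_eq0/negP => /msuppM_le; rewrite msuppX => /allpairsP[[a b]] /=.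
  by rewrite inE => -[/eqP-> _ e]; rewrite e lem_addr in nle.
by rewrite z if_same; case: ifP; rewrite ?z // mul0r mcoeff0.
Qed.

Lemma restr_sum P I (r : seq I) (F : I -> S) :
  restr P (\sum_(i <- r) F i) = \sum_(i <- r) restr P (F i).
Proof. exact: raddf_sum. Qed.

End Restriction.

(** * Monomial maps and their fibres *)

Section Weights.
Variables (n N : nat) (d : 'I_n -> 'X_{1..N}).
Implicit Types (m : 'X_{1..n}).

Definition weight m : 'X_{1..N} := (\sum_i d i *+ m i)%MM.

Lemma weightE m v : weight m v = (\sum_i d i v * m i)%N.
Proof. by rewrite mnm_sumE; apply: eq_bigr => i _; rewrite mulmnE. Qed.

Lemma weightD m1 m2 : weight (m1 + m2)%MM = (weight m1 + weight m2)%MM.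
Proof.
apply/mnmP=> v; rewrite mnmDE !weightE -big_split /=.
by apply: eq_bigr => i _; rewrite mnmDE mulnDr.
Qed.

Lemma weight0 : weight 0%MM = 0%MM.
Proof.
by apply/mnmP=> v; rewrite weightE mnm0E big1 // => i _; rewrite mnm0E muln0.
Qed.

Lemma weight1 i : weight U_(i)%MM = d i.
Proof.
apply/mnmP=> v; rewrite weightE (bigD1 i) //= mnm1E eqxx muln1 big1 ?addn0 //.
by move=> j /negPf ji; rewrite mnm1E eq_sym ji muln0.
Qed.

Variable k : fieldType.
Local Notation S := {mpoly k[n]}.

Definition monomial_map (p : S) : {mpoly k[N]} :=
  p \mPo [tuple 'X_[d i] | i < n].

HB.instance Definition _ := GRing.RMorphism.copy monomial_map
  (comp_mpoly [tuple 'X_[k, d i] | i < n]).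

Lemma monomial_mapX m : monomial_map 'X_[m] = 'X_[weight m].
Proof.
rewrite /monomial_map comp_mpolyX -mprodXnE; apply: eq_bigr => i _.
by rewrite tnth_mktuple.
Qed.

Lemma monomial_mapZ c p : monomial_map (c *: p) = c *: monomial_map p.
Proof. exact: comp_mpolyZ. Qed.

Lemma monomial_mapE p :
  monomial_map p = \sum_(m <- msupp p) p@_m *: 'X_[weight m].
Proof.
rewrite [in LHS](mpolyE p) raddf_sum; apply: eq_bigr => m _ /=.
by rewrite monomial_mapZ monomial_mapX.
Qed.

Lemma mcoeff_monomial_map p g :
  (monomial_map p)@_g = \sum_(m <- msupp p | weight m == g) p@_m.
Proof.
rewrite monomial_mapE raddf_sum [RHS]big_mkcond; apply: eq_bigr => m _ /=.
by rewrite mcoeffZ mcoeffX; case: eqP; rewrite (mulr1, mulr0).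
Qed.

(** The coefficients of p over a fibre of the weight add up to 0, so no
    monomial of p is alone in its fibre. *)
Lemma monomial_ker_partner p m : monomial_map p = 0 -> m \in msupp p ->
  exists m', [/\ m' \in msupp p, m' != m & weight m' = weight m].
Proof.
move=> p0 mp; apply: NNPP => none.
have := mcoeff_monomial_map p (weight m); rewrite p0 mcoeff0.
rewrite big_mkcond (bigD1_seq m) //= eqxx big_seq_cond big1.
  by move/esym/eqP; rewrite addr0; apply/negP; rewrite -mcoeff_msupp.
by move=> m' /andP[m'p ne]; case: eqP => // e; case: none; exists m'.
Qed.

(** Subtracting from p a multiple of the difference of two of its monomials
    with equal weights shortens its support. *)
Lemma monomial_ker_ind (P : S -> Prop) :
  P 0 -> (forall p q, P p -> P q -> P (p + q)) ->
  (forall c m m', weight m = weight m' -> P (c *: ('X_[m] - 'X_[m']))) ->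
  forall p, monomial_map p = 0 -> P p.
Proof.
move=> P0 PD PB p; have [s] := ubnP (size (msupp p)).
elim: s p => // s IH p sp p0.
have [->//|nz] := eqVneq p 0.
have [m mp] : exists m, m \in msupp p.
  by exists (mlead p); exact: mlead_supp.
have [m' [m'p ne ew]] := monomial_ker_partner p0 mp.
pose b : S := p@_m *: ('X_[m] - 'X_[m']).
rewrite -[p](subrK b); apply: PD; last exact/PB/esym.
apply: IH; last first.
  by rewrite raddfB /= p0 monomial_mapZ raddfB /= !monomial_mapX ew subrr scaler0 subrr.
have sub : {subset msupp (p - b) <= rem m (msupp p)}.
  move=> x; rewrite mem_rem_uniq // !inE !mcoeff_msupp mcoeffB mcoeffZ mcoeffB.
  rewrite !mcoeffX [m == x]eq_sym; have [->|xm] := eqVneq x m.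
    by rewrite (negPf ne) subr0 mulr1 subrr eqxx.
  rewrite sub0r; have [<- _|xm'] := eqVneq m' x; first by rewrite -mcoeff_msupp.
  by rewrite oppr0 mulr0 subr0.
apply: leq_ltn_trans (uniq_leq_size (msupp_uniq _) sub) _.
by rewrite size_rem //; case: (msupp p) mp sp.
Qed.

End Weights.

(** * Modules with a linear resolution *)

Section LinearResolutions.
Variables (k : fieldType) (n : nat).
Local Notation S := {mpoly k[n]}.

Definition homogmx d a b (R : 'M[S]_(a, b)) := forall i j, R i j \is d.-homog.

Definition linear_cover (Q : forall b, ('rV[S]_b -> Prop) -> Prop) b
    (Z : 'rV[S]_b -> Prop) :=
  exists a (R : 'M[S]_(a, b)), [/\ homogmx 1 R,
    forall v, Z v <-> exists w : 'rV_a, v = w *m R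
    & Q a (fun w => w *m R = 0)].

(** The greatest fixed point of linear_cover, encoded as the union of all its
    post-fixed points: Z is generated by rows of linear forms, so is the module
    of relations between these rows, and so on forever. *)
Definition linres b (Z : 'rV[S]_b -> Prop) :=
  exists2 Q : forall b, ('rV[S]_b -> Prop) -> Prop,
    forall b' Z', Q b' Z' -> linear_cover Q Z' & Q b Z.

(** A greatest fixed point is one of its own post-fixed points, and Linres
    below is the converse. *)
Lemma linresP b (Z : 'rV[S]_b -> Prop) : linres Z -> linear_cover linres Z.
Proof.
by case=> Q QP /QP[a [R [hR ZR kR]]]; exists a, R; split=> //; exists Q.
Qed.

Lemma Linres b (Z : 'rV[S]_b -> Prop) : linear_cover linres Z -> linres Z.
Proof.
move=> cZ; exists (fun b' Z' => linear_cover linres Z') => // b' Z'.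
by case=> a [R [hR ZR /linresP kR]]; exists a, R.
Qed.

Lemma linres_ext b (Z Z' : 'rV[S]_b -> Prop) :
  (forall v, Z v <-> Z' v) -> linres Z -> linres Z'.
Proof.
move=> ZZ' /linresP[a [R [hR ZR kR]]]; apply: Linres.
by exists a, R; split=> // v; rewrite -ZZ' ZR.
Qed.

Lemma linres_zero b (Z : 'rV[S]_b -> Prop) :
  (forall v, Z v <-> v = 0) -> linres Z.
Proof.
move=> Z0; exists (fun b' Z' => forall v : 'rV_b', Z' v <-> v = 0) => // {b Z Z0}b Z Z0.
exists 0%N, 0; split=> [i j|v|v]; first by rewrite mxE rpred0.
  by rewrite Z0; split=> [->|[w ->]]; [exists 0|]; rewrite mulmx0.
by rewrite mulmx0 thinmx0; split.
Qed.

Definition hcomp d : S -> S := restr (fun m => mdeg m == d).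

Lemma hcompM d e (w p : S) :
  p \is e.-homog -> hcomp (d + e) (w * p) = hcomp d w * p.
Proof.
move=> /dhomogP hp; apply: restrM => m1 m2 /hp <-.
by rewrite mdegD eqn_add2r.
Qed.

Lemma hcomp_homog d p : hcomp d p \is d.-homog.
Proof. by apply/dhomogP => m /msupp_restr[/eqP]. Qed.

Lemma hcomp_id d p : p \is d.-homog -> hcomp d p = p.
Proof. by move=> /dhomogP hp; apply: restr_id => m /hp /= ->. Qed.

Definition hcompmx d a b (v : 'M[S]_(a, b)) := map_mx (hcomp d) v.

Lemma hcompmxM d e a b c (w : 'M_(a, b)) (R : 'M_(b, c)) :
  homogmx e R -> hcompmx (d + e) (w *m R) = hcompmx d w *m R.
Proof.
move=> hR; apply/matrixP=> i j; rewrite !mxE /hcomp restr_sum.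
by apply: eq_bigr => l _; rewrite mxE; apply: hcompM.
Qed.

Lemma hcompmx_homog d a b (v : 'M_(a, b)) : homogmx d (hcompmx d v).
Proof. by move=> i j; rewrite mxE hcomp_homog. Qed.

Lemma hcompmx_id d a b (v : 'M_(a, b)) : homogmx d v -> hcompmx d v = v.
Proof. by move=> hv; apply/matrixP=> i j; rewrite mxE hcomp_id. Qed.

Lemma homogmxM d e a b c (w : 'M_(a, b)) (R : 'M_(b, c)) :
  homogmx d w -> homogmx e R -> homogmx (d + e) (w *m R).
Proof.
by move=> hw hR i j; rewrite mxE rpred_sum // => l _; apply: dhomogM.
Qed.

Lemma homogmx_col d a b c (A : 'M_(a, c)) (B : 'M_(b, c)) :
  homogmx d A -> homogmx d B -> homogmx d (col_mx A B).
Proof. by move=> hA hB i j; rewrite mxE; case: split. Qed.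

Lemma homogmx_row d a b c (A : 'M_(c, a)) (B : 'M_(c, b)) :
  homogmx d A -> homogmx d B -> homogmx d (row_mx A B).
Proof. by move=> hA hB i j; rewrite mxE; case: split. Qed.

Lemma homogmx0 d a b : homogmx d (0 : 'M_(a, b)).
Proof. by move=> i j; rewrite mxE rpred0. Qed.

(** Lift row by row, then keep of each lift its component of degree d. *)
Lemma homog_lift d e a b p (A : 'M_(a, p)) (B : 'M_(b, p)) c (V : 'M_(c, b)) :
  homogmx e A -> homogmx e B -> homogmx d V ->
  (forall i, exists u : 'rV_a, row i V *m B = u *m A) ->
  exists2 U : 'M_(c, a), homogmx d U & V *m B = U *m A.
Proof.
move=> hA hB hV /fin_all_exists[u uE].
pose U := \matrix_i u i : 'M_(c, a).
have UE : V *m B = U *m A.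
  by apply/row_matrixP=> i; rewrite !row_mul uE rowK.
exists (hcompmx d U); first exact: hcompmx_homog.
by rewrite -(hcompmxM _ _ hA) -UE (hcompmxM _ _ hB) hcompmx_id.
Qed.

Variant extension_syzygies : forall c, ('rV[S]_c -> Prop) -> Prop :=
  ExtensionSyzygies p d a b (A : 'M_(a, p)) (B : 'M_(b, p)) of
    homogmx d A & homogmx d B
    & linres (fun u : 'rV_a => u *m A = 0)
    & linres (fun v : 'rV_b => exists u : 'rV_a, v *m B = u *m A) :
    @extension_syzygies (a + b) (fun w => w *m col_mx A B = 0).

(** A relation between the rows of B modulo those of A lifts to a relation of
    the stacked matrix by a linear correction L, because the degrees force the
    lift to be linear. The relations of the new matrix have the same shape,
    which gives the coinduction. *)
Lemma linres_extension p d a b (A : 'M_(a, p)) (B : 'M_(b, p)) :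
  homogmx d A -> homogmx d B ->
  linres (fun u : 'rV_a => u *m A = 0) ->
  linres (fun v : 'rV_b => exists u : 'rV_a, v *m B = u *m A) ->
  linres (fun w : 'rV_(a + b) => w *m col_mx A B = 0).
Proof.
move=> hA hB kA kB; exists extension_syzygies; last exact: ExtensionSyzygies hA hB kA kB.
move=> c Z [] {hA hB kA kB}p {}d {}a {}b {}A {}B hA hB.
move=> /linresP[ra [RA [hRA ARA kA]]] /linresP[rb [RB [hRB BRB kB]]].
have [L hL LE] : exists2 L : 'M_(rb, a), homogmx 1 L & - RB *m B = L *m A.
  have hN : homogmx 1 (- RB) by move=> i j; rewrite mxE rpredN.
  apply: (homog_lift hA hB hN) => i.
  have [|u uE] := (BRB (row i RB)).2; first by exists (delta_mx 0 i); rewrite rowE.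
  by exists (- u); rewrite linearN mulNmx uE mulNmx.
exists (ra + rb)%N, (col_mx (row_mx RA 0) (row_mx L RB)); split.
- by apply: homogmx_col; apply: homogmx_row => //; exact: homogmx0.
- move=> v; rewrite -(hsubmxK v); set u := lsubmx v; set w := rsubmx v.
  rewrite mul_row_col; split=> [uw0|[z]].
    have [|y wE] := (BRB w).1.
      exists (- u); rewrite mulNmx; apply/eqP.
      by rewrite -addr_eq0 addrC uw0.
    have : (u - y *m L) *m A = 0.
      rewrite mulmxBl -mulmxA -LE mulNmx mulmxN opprK mulmxA -wE.
      exact: uw0.
    case/ARA => x xE; exists (row_mx x y).
    rewrite mul_row_col !mul_mx_row mulmx0 add_row_mx add0r -wE -xE.
    by rewrite subrK.
  rewrite -(hsubmxK z) mul_row_col !mul_mx_row mulmx0 add_row_mx add0r.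
  case/eq_row_mx => -> ->.
  rewrite mulmxDl -!mulmxA -LE mulNmx mulmxN addrNK mulmxA.
  by apply/ARA; exists (lsubmx z).
apply: (@ExtensionSyzygies _ 1%N).
- by apply: homogmx_row => //; exact: homogmx0.
- exact: homogmx_row.
- apply: linres_ext kA => u; rewrite mul_mx_row mulmx0; split=> [->|].
    by rewrite row_mx0.
  by rewrite -[0 in RHS]row_mx0 => /eq_row_mx[].
apply: linres_ext kB => v; split=> [v0|[u]]; last first.
  by rewrite !mul_mx_row mulmx0 => /eq_row_mx[].
have : (v *m L) *m A = 0.
  by rewrite -mulmxA -LE mulNmx mulmxN mulmxA v0 mul0mx oppr0.
by case/ARA => u uE; exists u; rewrite !mul_mx_row mulmx0 uE v0.
Qed.

(** If the rows of A are linear combinations L of the rows of B with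
    coefficients of degree 1, the relations of B modulo A are generated by
    those of B and the rows of L; their own relations are an extension again.
    *)
Lemma linres_quotient p d a b (A : 'M_(a, p)) (B : 'M_(b, p)) (L : 'M_(a, b)) :
  A = L *m B -> homogmx 1 L -> homogmx d B ->
  linres (fun u : 'rV_a => u *m A = 0) ->
  linres (fun v : 'rV_b => v *m B = 0) ->
  linres (fun v : 'rV_b => exists u : 'rV_a, v *m B = u *m A).
Proof.
move=> AE hL hB kA /linresP[rb [RB [hRB BRB kB]]]; apply: Linres.
exists (rb + a)%N, (col_mx RB L); split; first exact: homogmx_col.
  move=> v; split=> [[u uE]|[z]].
    have [|w wE] := (BRB (v - u *m L)).1.
      by rewrite mulmxBl uE AE mulmxA subrr.
    by exists (row_mx w u); rewrite mul_row_col -wE subrK.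
  rewrite -(hsubmxK z) mul_row_col => ->; exists (rsubmx z).
  rewrite mulmxDl -[X in _ + X]mulmxA -AE (_ : _ *m RB *m B = 0) ?add0r //.
  by apply/BRB; exists (lsubmx z).
apply: (linres_extension hRB hL kB); apply: linres_ext kA => u.
split=> [uA|[w wE]].
  by apply/BRB; rewrite -mulmxA -AE.
by rewrite AE mulmxA; apply/BRB; exists w.
Qed.

Variable (I : {pred S}).

(** Iterating the choice of a matrix of linear forms provided by linresP gives
    the whole resolution; it is minimal since its entries have positive degree.
    *)
Lemma linear_resolution_of_linres q r (g : 'M[S]_(r, 1)) :
  (0 < q)%N -> homogmx q g ->
  (forall f, f \in I <-> exists w : 'rV_r, f%:M = w *m g) ->
  linres (fun w : 'rV_r => w *m g = 0) ->
  (exists2 f : S, f \in I & f != 0) -> linear_resolution I q.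
Proof.
move=> q0 hg Ig kg nzI; split=> //.
pose state := {b : nat & {Z : 'rV[S]_b -> Prop | linres Z}}.
have nxt (s : state) : {a : nat & {R : 'M[S]_(a, tag s) | homogmx 1 R /\
    (forall v, sval (tagged s) v <-> exists w : 'rV_a, v = w *m R) /\
    linres (fun w : 'rV_a => w *m R = 0)}}.
  case: s => b [Z lZ] /=.
  have : exists aR : {a : nat & 'M[S]_(a, b)}, homogmx 1 (tagged aR) /\
    (forall v, Z v <-> exists w : 'rV_(tag aR), v = w *m tagged aR) /\
    linres (fun w : 'rV_(tag aR) => w *m tagged aR = 0).
    by case/linresP: lZ => a [R [hR ZR kR]]; exists (existT _ a R).
  case/constructive_indefinite_description => -[a R] /= aR.
  by exists a, R.
pose step (s : state) : state :=
  existT _ (tag (nxt s)) (exist _ _ (svalP (tagged (nxt s))).2.2).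
pose st0 : state := existT _ r (exist _ _ kg).
pose st i := iter i step st0.
pose rk i := if i is j.+1 then tag (st j) else 1%N.
pose df i : 'M[S]_(rk i.+1, rk i) :=
  match i return 'M[S]_(rk i.+1, rk i) with
  | 0 => g | j.+1 => sval (tagged (nxt (st j))) end.
pose sh i (c : 'I_(rk i)) := if i is j.+1 then (q + j)%N else 0%N.
have df_hom i r' c' : df i r' c' \is (if i is 0 then q else 1%N).-homog.
  by case: i r' c' => [|i] r' c'; [exact: hg | exact: (svalP (tagged (nxt (st i)))).1].
have df_exact i (v : 'rV_(rk i.+1)) :
  v *m df i = 0 <-> exists w : 'rV_(rk i.+2), v = w *m df i.+1.
  case: i v => [|i] v.
    exact: ((svalP (tagged (nxt st0))).2.1 v).
  exact: ((svalP (tagged (nxt (st i.+1)))).2.1 v).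
have dfsh i (r' : 'I_(rk i.+1)) (c : 'I_(rk i)) m :
    m \in msupp (df i r' c) -> (mdeg m + sh _ c = sh _ r')%N.
  move/(dhomogP _ _ _ (df_hom i r' c)).
  by case: i r' c => [|i] r' c /= ->; rewrite ?addn0 // addnCA add1n addnS.
have aug f : f \in I <-> exists w : 'rV_(rk 1), const_mx f = w *m df 0.
  have -> : const_mx f = f%:M :> 'M_1.
    by apply/matrixP=> i j; rewrite !mxE !ord1 eqxx.
  exact: Ig.
exists (@GradedResolution k n I rk sh df erefl (fun=> erefl) dfsh aug df_exact).
split=> [i r' c /=|i j i1 /negPf jq]; last first.
  rewrite /betti /=; apply/eqP; rewrite cards_eq0; apply/eqP/setP=> c.
  rewrite !inE; case: i i1 c jq => // i _ c jq /=.
  by rewrite eq_sym -[i]/(i.+1.-1) -subn1 jq.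
apply: (dhomog_nemf_coeff (df_hom i r' c)); rewrite mf0.
by case: i {r' c} => [|i] //; rewrite eq_sym -lt0n.
Qed.

End LinearResolutions.

(** * The 2-minors of a generic 2 x m matrix *)

Section TwoRowedMinors.
Variables (k : fieldType) (n : nat) (x y : nat -> 'I_n) (m : nat).
Local Notation S := {mpoly k[n]}.
Hypothesis xI : forall i j, (i < m)%N -> (j < m)%N -> x i = x j -> i = j.
Hypothesis yI : forall i j, (i < m)%N -> (j < m)%N -> y i = y j -> i = j.
Hypothesis xy : forall i j, (i < m)%N -> (j < m)%N -> x i != y j.

(** The column of the variables z 0, ..., z (j - 1). Its height is written as
    an iterated sum, convertible to the height of the stacked matrix at each
    step, to avoid casts. *)
Fixpoint vars (z : nat -> 'I_n) j : 'M[S]_(iter j (addn^~ 1%N) 0%N, 1) :=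
  if j is i.+1 then col_mx (vars z i) ('X_(z i))%:M else 0.

Lemma vars_homog z j : homogmx 1 (vars z j).
Proof.
elim: j => [|j IH]; first exact: homogmx0.
apply: homogmx_col => // i i'.
by rewrite !ord1 mxE eqxx dhomogX; apply/eqP/mdeg1.
Qed.

Definition has_var (z : nat -> 'I_n) j (e : 'X_{1..n}) :=
  has (fun i => e (z i) != 0)%N (iota 0 j).

Lemma has_varS z j e :
  has_var z j.+1 e = has_var z j e || (e (z j) != 0)%N.
Proof. by rewrite /has_var -addn1 iotaD has_cat /= orbF. Qed.

Lemma varsP z j (f : S) :
  (exists u, f%:M = u *m vars z j) <-> restr (predC (has_var z j)) f = 0.
Proof.
split=> [[u]|f0].
  elim: j u f => [|j IH] u f.
    rewrite /= mulmx0 => /matrixP/(_ 0 0); rewrite !mxE eqxx mulr1n => ->.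
    exact: raddf0.
  rewrite /= -(hsubmxK u) mul_row_col => /matrixP/(_ 0 0).
  rewrite mxE eqxx mulr1n => ->; rewrite mxE raddfD /= mul_mx_scalar [fun_of_matrix (_ *: _) _ _]mxE.
  apply/mpolyP=> e; rewrite mcoeffD !mcoeff_restr mcoeff0.
  have /mpolyP/(_ e) := IH (lsubmx u) _ (esym (mx11_scalar _)).
  rewrite mcoeff_restr mcoeff0 /= has_varS negb_or negbK.
  case: has_var => /=; first by rewrite addr0.
  move=> ->; rewrite if_same add0r; case: ifP => // /eqP ez; apply/memN_msupp_eq0/negP => /msuppM_le.
  rewrite msuppX => /allpairsP[[a b]] /= [+ _ E].
  rewrite inE => /eqP ea; move: ez.
  by rewrite E mnmDE ea mnm1E eqxx.
have: {in msupp f, forall e, has_var z j e}.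
  move=> e; rewrite mcoeff_msupp; apply: contraR => nh.
  by have /mpolyP/(_ e) := f0; rewrite mcoeff_restr /= nh mcoeff0 => ->.
rewrite [X in X%:M]mpolyE => H.
elim: (msupp f) H => [|e s IH] H.
  by exists 0; rewrite big_nil mul0mx raddf0.
have [|u uE] := IH; first by move=> e' es; apply: H; rewrite inE es orbT.
have /hasP[i] := H e (mem_head _ _); rewrite mem_iota /= add0n => ij ei.
suff [w wE] : exists w, (f@_e *: 'X_[e])%:M = w *m vars z j.
  by exists (w + u); rewrite big_cons mulmxDl -wE -uE raddfD.
move: ij; clear f0 H IH u uE; elim: j => // j IH; rewrite ltnS leq_eqVlt => /orP[/eqP ej|/IH[w wE]].
  exists (row_mx 0 ((f@_e *: 'X_[e - U_(z j)])%:M)).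
  rewrite mul_row_col mul0mx add0r -scalar_mxM -scalerAl -mpolyXD submK //.
  by rewrite lep1mP -ej.
by exists (row_mx w 0); rewrite mul_row_col mul0mx addr0.
Qed.

(** One variable at a time: x j is a nonzerodivisor modulo the earlier
    variables, so the relations of x j modulo them are generated by these
    variables. *)
Lemma linres_vars j : (j <= m)%N ->
  linres (fun v => v *m vars x j = 0).
Proof.
elim: j => [|j IH] jm; first by apply: linres_zero => v; rewrite mulmx0 thinmx0.
apply: (linres_extension (d := 1)); [exact: vars_homog| |exact: IH (ltnW jm)|].
  by move=> i i'; rewrite !ord1 mxE eqxx dhomogX; apply/eqP/mdeg1.
apply: Linres; exists _, (vars x j); split; [exact: vars_homog| |exact: IH (ltnW jm)].
move=> v; rewrite mul_mx_scalar [v]mx11_scalar; set f := v 0 0.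
rewrite scale_scalar_mx.
have -> : (exists u : 'rV_(iter j (addn^~ 1%N) 0%N), ('X_(x j) * f)%:M = u *m vars x j) <->
  (exists w, f%:M = w *m vars x j).
  rewrite !varsP mulrC (@restrM _ _ _ (predC (has_var x j))).
    split=> [/eqP|->]; last by rewrite mul0r.
    rewrite mulf_eq0 => /orP[/eqP//|/eqP X0].
    by have := mcoeffXU k (x j) (x j); rewrite X0 mcoeff0 eqxx => /eqP; rewrite eq_sym oner_eq0.
  move=> m1 m2; rewrite msuppX inE => /eqP-> /=; congr (~~ _).
  apply: eq_in_has => i; rewrite mem_iota /= add0n => ij.
  rewrite mnmDE mnm1E; suff /negPf-> : x j != x i by rewrite addn0.
  have im := ltn_trans ij jm.
  by apply: contraTneq ij => /(xI jm im) ->; rewrite ltnn.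
by [].
Qed.

Definition new_minors j : 'M[S]_(iter j (addn^~ 1%N) 0%N, 1) :=
  'X_(y j) *: vars x j - 'X_(x j) *: vars y j.

Fixpoint minors_size j :=
  if j is i.+1 then (minors_size i + iter i (addn^~ 1%N) 0)%N else 0%N.

Fixpoint minors j : 'M[S]_(minors_size j, 1) :=
  if j is i.+1 then col_mx (minors i) (new_minors i) else 0.

(** The minors are linear combinations, with coefficients among the y i, of the
    x i; so the ideal of the minors relates to that of the x i as A to B in
    linres_quotient. *)
Fixpoint minors_coef j : 'M[S]_(minors_size j, iter j (addn^~ 1%N) 0%N) :=
  if j is i.+1 then
    block_mx (minors_coef i) 0 ('X_(y i))%:M (- vars y i) else 0.

Lemma new_minors_homog j : homogmx 2 (new_minors j).
Proof.
by move=> i i'; rewrite !mxE rpredB // -[2%N]/(1 + 1)%N dhomogM ?vars_homog //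
  dhomogX; apply/eqP/mdeg1.
Qed.

Lemma minors_homog j : homogmx 2 (minors j).
Proof.
elim: j => [|j IH] /=; first exact: homogmx0.
by apply: homogmx_col => //; exact: new_minors_homog.
Qed.

Lemma minors_coefE j : minors j = minors_coef j *m vars x j.
Proof.
elim: j => [|j IH] /=; first by rewrite mul0mx.
rewrite mul_block_col mul0mx addr0 -IH mul_scalar_mx mul_mx_scalar.
by rewrite scalerN.
Qed.

Lemma minors_coef_homog j : homogmx 1 (minors_coef j).
Proof.
elim: j => [|j IH] /=; first exact: homogmx0.
have hX (a : nat) : homogmx 1 (('X_(y j))%:M : 'M[S]_a).
  move=> i i'; rewrite mxE; case: eqP => _; rewrite ?mulr0n ?rpred0 //.
  by rewrite mulr1n dhomogX; apply/eqP/mdeg1.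
apply: homogmx_col; apply: homogmx_row => //; first exact: homogmx0.
by move=> i i'; rewrite mxE rpredN vars_homog.
Qed.

(** Weights of the toric parametrization x i = s u_i, y i = t u_i for i < j,
    in which every other variable stays free. *)
Definition scroll_weight j (e : 'I_n) : 'X_{1..n + 2} :=
  if e \in map x (iota 0 j) then (U_(lshift 2 e) + U_(rshift n ord0))%MM
  else if e \in map y (iota 0 j) then
    (U_(lshift 2 (x (index e (map y (iota 0 j))))) + U_(rshift n ord_max))%MM
  else U_(lshift 2 e)%MM.

Local Notation psi j := (monomial_map (scroll_weight j) (k := k)).

Lemma mem_mapx j i : (j <= m)%N -> (i < m)%N ->
  (x i \in map x (iota 0 j)) = (i < j)%N.
Proof.
move=> jm im; apply/mapP/idP => [[i']|ij]; last by exists i => //; rewrite mem_iota.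
by rewrite mem_iota /= add0n => i'j /(xI im (leq_trans i'j jm)) ->.
Qed.

Lemma mem_mapy j i : (j <= m)%N -> (i < m)%N ->
  (y i \in map y (iota 0 j)) = (i < j)%N.
Proof.
move=> jm im; apply/mapP/idP => [[i']|ij]; last by exists i => //; rewrite mem_iota.
by rewrite mem_iota /= add0n => i'j /(yI im (leq_trans i'j jm)) ->.
Qed.

Lemma mem_mapxy j i : (j <= m)%N -> (i < m)%N ->
  (y i \in map x (iota 0 j)) = false.
Proof.
move=> jm im; apply/mapP => -[i']; rewrite mem_iota /= add0n => i'j /eqP.
by rewrite eq_sym (negPf (xy (leq_trans i'j jm) im)).
Qed.

Lemma mem_mapyx j i : (j <= m)%N -> (i < m)%N ->
  (x i \in map y (iota 0 j)) = false.
Proof.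
move=> jm im; apply/mapP => -[i']; rewrite mem_iota /= add0n => i'j /eqP.
by rewrite (negPf (xy im (leq_trans i'j jm))).
Qed.

Lemma scroll_weight_x j i : (j <= m)%N -> (i < j)%N ->
  scroll_weight j (x i) = (U_(lshift 2 (x i)) + U_(rshift n ord0))%MM.
Proof. by move=> jm ij; rewrite /scroll_weight mem_mapx ?ij // (leq_trans ij). Qed.

Lemma scroll_weight_y j i : (j <= m)%N -> (i < j)%N ->
  scroll_weight j (y i) = (U_(lshift 2 (x i)) + U_(rshift n ord_max))%MM.
Proof.
move=> jm ij; have im := leq_trans ij jm.
rewrite /scroll_weight mem_mapxy // mem_mapy // ij.
set a := index _ _; suff -> : a = i by [].
have aj : (a < j)%N by rewrite -[j](size_iota 0) -(size_map y) index_mem mem_mapy.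
apply: yI => //; first exact: leq_trans jm.
have := nth_index (y i) (_ : y i \in map y (iota 0 j)).
rewrite mem_mapy // ij => /(_ isT).
by rewrite (nth_map 0%N) ?size_iota // nth_iota.
Qed.

Lemma scroll_weight_free j i : (j <= m)%N -> (j <= i)%N -> (i < m)%N ->
  scroll_weight j (x i) = U_(lshift 2 (x i))%MM /\
  scroll_weight j (y i) = U_(lshift 2 (y i))%MM.
Proof.
move=> jm ji im; rewrite /scroll_weight mem_mapx // mem_mapyx // mem_mapxy //.
by rewrite mem_mapy // !ltnNge ji.
Qed.

Let sv : {mpoly k[n + 2]} := 'X_(rshift n ord0).
Let tv : {mpoly k[n + 2]} := 'X_(rshift n ord_max).

Lemma psi_vars j i a : (j <= m)%N -> (i <= j)%N ->
  tv * psi j (vars x i a 0) = sv * psi j (vars y i a 0).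
Proof.
move=> jm; elim: i a => [|i IH] a ij /=; first by rewrite !mxE !rmorph0 !mulr0.
rewrite !mxE; case: splitP => a' _; first by apply: IH; exact: ltnW.
rewrite !mxE; case: (_ == _) => /=; last by rewrite !mulr0n !rmorph0 !mulr0.
rewrite !mulr1n !monomial_mapX !weight1 scroll_weight_x // scroll_weight_y //.
by rewrite !mpolyXD /sv /tv; ring.
Qed.

Lemma mpolyX_neq0 N (e : 'X_{1..N}) : ('X_[e] : {mpoly k[N]}) != 0.
Proof.
apply/eqP => X0; have := mcoeffX k e e; rewrite X0 mcoeff0 eqxx.
by move/eqP; rewrite eq_sym oner_eq0.
Qed.

Lemma psi_new_minors J j a : (J <= m)%N -> (j <= J)%N ->
  sv * psi J (new_minors j a 0) =
  (sv * psi J 'X_(y j) - tv * psi J 'X_(x j)) * psi J (vars x j a 0).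
Proof.
move=> Jm jJ; rewrite !mxE rmorphB !rmorphM /=.
have := psi_vars a Jm jJ; set A := psi J (vars x j a 0).
set B := psi J (vars y j a 0) => tA.
rewrite mulrBr mulrBl; congr (_ - _); first by rewrite mulrA.
by rewrite mulrCA -tA; ring.
Qed.

Lemma psi_minors J j a : (J <= m)%N -> (j <= J)%N -> psi J (minors j a 0) = 0.
Proof.
move=> Jm; elim: j a => [|j IH] a jJ /=; first by rewrite mxE rmorph0.
rewrite mxE; case: splitP => a' _; first by apply: IH; exact: ltnW.
have := psi_new_minors a' Jm (ltnW jJ).
rewrite !monomial_mapX !weight1 scroll_weight_x // scroll_weight_y // !mpolyXD.
rewrite -/sv -/tv (_ : _ - _ = 0); last by ring.
by move/eqP; rewrite mul0r mulf_eq0 (negPf (mpolyX_neq0 _)) => /eqP.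
Qed.

(** Modulo the parametrization at step j, each minor with column j is, up to
    the factor s, the corresponding x i times the nonzero element s y_j - t
    x_j. *)
Lemma psi_new_minors_eq0 j (v : 'rV[S]_(iter j (addn^~ 1%N) 0%N)) : (j < m)%N ->
  psi j ((v *m new_minors j) 0 0) = 0 <-> psi j ((v *m vars x j) 0 0) = 0.
Proof.
move=> jm.
have e : sv * psi j ((v *m new_minors j) 0 0) =
  (sv * psi j 'X_(y j) - tv * psi j 'X_(x j)) * psi j ((v *m vars x j) 0 0).
  set cf := (_ - _); rewrite [fun_of_matrix (v *m new_minors j) _ _]mxE [fun_of_matrix (v *m vars x j) _ _]mxE.
  rewrite !rmorph_sum /= !mulr_sumr; apply: eq_bigr => a _.
  rewrite !rmorphM /= [LHS]mulrCA [RHS]mulrCA; congr (_ * _).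
  by rewrite /cf; apply: psi_new_minors (ltnW jm) (leqnn j).
move: e; set a := psi j _; set b := psi j ((v *m vars x j) 0 0) => e.
have nz : sv * psi j 'X_(y j) - tv * psi j 'X_(x j) != 0.
  rewrite !monomial_mapX !weight1.
  have [-> ->] := scroll_weight_free (ltnW jm) (leqnn j) jm.
  rewrite -!mpolyXD subr_eq0; apply/eqP => /mpolyP/(_ (U_(rshift n ord0) + U_(lshift 2 (y j)))%MM).
  rewrite !mcoeffX eqxx; case: eqP => [/mnmP/(_ (rshift n ord0))|_ /eqP]; last by rewrite oner_eq0.
  by rewrite !mnmDE !mnm1E !eqxx !eq_shift.
split=> z0; move/eqP: e; rewrite z0 mulr0.
  by rewrite eq_sym mulf_eq0 (negPf nz) => /eqP.
by rewrite mulf_eq0 (negPf (mpolyX_neq0 _)) => /eqP.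
Qed.

Definition scroll_ideal j (f : S) := exists u, f%:M = u *m minors j.

Lemma scroll_idealD j f g :
  scroll_ideal j f -> scroll_ideal j g -> scroll_ideal j (f + g).
Proof.
by move=> [u uE] [w wE]; exists (u + w); rewrite mulmxDl -uE -wE raddfD.
Qed.

Lemma scroll_idealM j c f : scroll_ideal j f -> scroll_ideal j (c * f).
Proof. by move=> [u uE]; exists (c *: u); rewrite -scalemxAl -uE scale_scalar_mx. Qed.

Lemma scroll_idealS j f : scroll_ideal j f -> scroll_ideal j.+1 f.
Proof.
by move=> [u uE]; exists (row_mx u 0); rewrite /= mul_row_col mul0mx addr0.
Qed.

Lemma scroll_ideal_minor j i : (i < j)%N ->
  scroll_ideal j.+1 ('X_(x i) * 'X_(y j) - 'X_(y i) * 'X_(x j)).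
Proof.
move=> ij; suff [v vE] : exists v : 'rV_(iter j (addn^~ 1%N) 0%N),
    v *m vars x j = ('X_(x i))%:M /\ v *m vars y j = ('X_(y i))%:M.
  exists (row_mx 0 v); rewrite /= mul_row_col mul0mx add0r /new_minors.
  rewrite mulmxBr -!scalemxAr vE.1 vE.2 !scale_scalar_mx -raddfB /=.
  by congr (_%:M); ring.
elim: j ij => // j IH; rewrite ltnS leq_eqVlt => /orP[/eqP->|/IH[v [vx vy]]].
  by exists (row_mx 0 1%:M); rewrite /= !mul_row_col !mul0mx !mul1mx !add0r.
by exists (row_mx v 0); rewrite /= !mul_row_col !mul0mx !addr0.
Qed.

Lemma scroll_weight_step j (e : 'X_{1..n}) : (j < m)%N ->
  (weight (scroll_weight j) e + (U_(lshift 2 (x j)) + U_(rshift n ord0)) *+ e (x j)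
     + (U_(lshift 2 (x j)) + U_(rshift n ord_max)) *+ e (y j))%MM =
  (weight (scroll_weight j.+1) e + U_(lshift 2 (x j)) *+ e (x j)
     + U_(lshift 2 (y j)) *+ e (y j))%MM.
Proof.
move=> jm; have yx : y j != x j by rewrite eq_sym xy.
apply/mnmP=> v; rewrite !mnmDE !mulmnE !mnmDE !weightE.
rewrite (bigD1 (x j)) //= (bigD1 (y j)) //= [in RHS](bigD1 (x j)) //= [in RHS](bigD1 (y j)) //=.
have [-> ->] := scroll_weight_free (ltnW jm) (leqnn j) jm.
rewrite scroll_weight_x // scroll_weight_y // !mnmDE.
suff -> : (\sum_(i | (i != x j) && (i != y j)) scroll_weight j.+1 i v * e i =
  \sum_(i | (i != x j) && (i != y j)) scroll_weight j i v * e i)%N by ring.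
apply: eq_bigr => i /andP[/negPf nx /negPf ny]; congr (_ * _)%N.
have iotaS : iota 0 j.+1 = iota 0 j ++ [:: j] by rewrite -[in LHS]addn1 iotaD.
rewrite /scroll_weight iotaS !map_cat !mem_cat /= !inE nx ny !orbF.
by case: ifP => // _; case: ifP => // iy; rewrite index_cat iy.
Qed.

Lemma scroll_weight_pair j (e e' : 'X_{1..n}) : (j < m)%N ->
  weight (scroll_weight j.+1) e = weight (scroll_weight j.+1) e' ->
  (e (x j) + e (y j) = e' (x j) + e' (y j))%N.
Proof.
move=> jm; have yx : y j != x j by rewrite eq_sym xy.
suff H (a : 'X_{1..n}) : weight (scroll_weight j.+1) a (lshift 2 (x j)) = (a (x j) + a (y j))%N.
  by move=> E; rewrite -!H E.
rewrite weightE (bigD1 (x j)) //= (bigD1 (y j)) //=.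
rewrite scroll_weight_x // scroll_weight_y // !mnmDE !mnm1E eqxx !eq_shift.
rewrite big1 ?addn0 ?mul1n // => i /andP[nx ny].
have [/mapP[i']|ix] := boolP (i \in map x (iota 0 j.+1)).
  rewrite mem_iota add0n /= => i'j iE.
  by rewrite iE scroll_weight_x // -iE mnmDE !mnm1E !eq_shift (negPf nx).
have [/mapP[i']|iy] := boolP (i \in map y (iota 0 j.+1)).
  rewrite mem_iota add0n /= => i'j iE.
  rewrite iE scroll_weight_y // mnmDE !mnm1E !eq_shift.
  suff /negPf-> : x i' != x j by [].
  have i'm := leq_trans i'j jm.
  by apply: contraNneq ny => /(xI i'm jm) i'E; rewrite iE i'E.
by rewrite /scroll_weight (negPf ix) (negPf iy) mnm1E eq_shift (negPf nx).
Qed.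

Lemma scroll_weight_s j (e : 'X_{1..n}) : (j <= m)%N ->
  weight (scroll_weight j) e (rshift n ord0) =
  (\sum_(i | i \in map x (iota 0 j)) e i)%N.
Proof.
move=> jm; rewrite weightE [RHS]big_mkcond; apply: eq_bigr => i _.
rewrite /scroll_weight; case: ifP => _.
  by rewrite mnmDE !mnm1E !eq_shift eqxx mul1n.
case: ifP => _; last by rewrite mnm1E eq_shift.
by rewrite mnmDE !mnm1E !eq_shift.
Qed.

(** Two monomials of equal weight that agree in x j come from step j. Otherwise
    the one with fewer x j has a factor x i y j with i < j, since the total
    exponents of the x agree; a minor turns this factor into y i x j. *)
Lemma scroll_exchange j d (e e' : 'X_{1..n}) : (j < m)%N ->
  (forall f, psi j f = 0 -> scroll_ideal j f) ->
  weight (scroll_weight j.+1) e = weight (scroll_weight j.+1) e' ->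
  e (x j) = (e' (x j) + d)%N -> scroll_ideal j.+1 ('X_[e] - 'X_[e']).
Proof.
move=> jm IH; elim: d e' => [|d IHd] e' we; rewrite ?addn0 => exj.
  apply/scroll_idealS/IH; rewrite raddfB /= !monomial_mapX.
  have := scroll_weight_pair jm we; rewrite exj => /addnI eyj.
  have := scroll_weight_step e jm; have := scroll_weight_step e' jm.
  rewrite we exj eyj => <- /(@addIm _ _ _ _) /(@addIm _ _ _ _) ->.
  by rewrite subrr.
have e'y : (0 < e' (y j))%N by have := scroll_weight_pair jm we; rewrite exj; lia.
have [i ij e'x] : exists2 i, (i < j)%N & (0 < e' (x i))%N.
  have := congr1 (fun w : 'X_{1..n + 2} => w (rshift n ord0)) we.
  rewrite !scroll_weight_s // => se; apply: NNPP => none.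
  have xj : x j \in map x (iota 0 j.+1) by rewrite mem_mapx.
  move: se xj; set X := map x _ => se xj.
  move: se; rewrite (bigD1 (x j)) // [in RHS](bigD1 (x j)) //= exj.
  rewrite [Y in _ = (_ + Y)%N]big1; first lia.
  move=> v /andP[/mapP[i]]; rewrite mem_iota add0n /= ltnS leq_eqVlt.
  move=> /orP[/eqP->->|ij -> _]; first by rewrite eqxx.
  by apply/eqP; rewrite -leqn0 leqNgt; apply/negP => e'x; case: none; exists i.
have im := ltn_trans ij jm; have yx := xy im jm.
pose c := (e' - U_(x i) - U_(y j))%MM.
have e'E : e' = (c + (U_(x i) + U_(y j)))%MM.
  apply/mnmP=> v; rewrite !(mnmDE, mnmBE, mnm1E).
  have [ev|_] := eqVneq (x i) v.
    have /negPf-> : y j != v by rewrite -ev eq_sym.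
    by rewrite -ev; lia.
  by have [<-|_] := eqVneq (y j) v; lia.
(* e1 is e' after the exchange of x i y j for y i x j. *)
pose e1 := (c + (U_(y i) + U_(x j)))%MM.
have [ij1 jj1] : (i < j.+1)%N /\ (j < j.+1)%N by rewrite ltnS ltnW.
rewrite -(subrKA 'X_[e1]); apply: scroll_idealD.
  apply: IHd.
    rewrite we e'E !weightD !weight1 !scroll_weight_x ?scroll_weight_y //.
    by apply/mnmP=> v; rewrite !mnmDE; lia.
  rewrite exj /e1 [in LHS]e'E !(mnmDE, mnmBE, mnm1E) eqxx.
  have /negPf-> : x i != x j.
    by apply: contraTneq ij => /(xI im jm) ->; rewrite ltnn.
  have /negPf-> : y j != x j by rewrite eq_sym xy.
  have /negPf-> : y i != x j by rewrite eq_sym xy.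
  by lia.
rewrite e'E /e1 !mpolyXD -mulrBr; apply: scroll_idealM.
by have [u uE] := scroll_ideal_minor ij; exists (- u); rewrite mulNmx -uE -raddfN opprB.
Qed.

(** The parametrized ring is a domain, so this makes the ideal of the minors
    prime. *)
Lemma scroll_idealP j f : (j <= m)%N -> psi j f = 0 <-> scroll_ideal j f.
Proof.
move=> jm; split=> [|[u uE]]; last first.
  have /matrixP/(_ 0 0) := uE; rewrite !mxE eqxx mulr1n => ->.
  rewrite rmorph_sum big1 // => a _.
  by rewrite rmorphM /= psi_minors // mulr0.
elim: j jm f => [|j IH] jm f.
  apply: monomial_ker_ind; first by exists 0; rewrite mul0mx raddf0.
    exact: scroll_idealD.
  move=> c e e' we; suff -> : e = e'.
    by exists 0; rewrite subrr scaler0 raddf0 mul0mx.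
  apply/mnmP=> v; have /mnmP/(_ (lshift 2 v)) := we.
  suff H (a : 'X_{1..n}) : weight (scroll_weight 0) a (lshift 2 v) = a v by rewrite !H.
  rewrite weightE (bigD1 v) //= /scroll_weight mnm1E eqxx mul1n big1 ?addn0 //.
  by move=> i /negPf iv; rewrite mnm1E eq_shift iv.
have {}IH := IH (ltnW jm).
apply: monomial_ker_ind; first by exists 0; rewrite mul0mx raddf0.
  exact: scroll_idealD.
move=> c e e' we; rewrite -mul_mpolyC; apply: scroll_idealM.
have [le|/ltnW le] := leqP (e' (x j)) (e (x j)).
  by apply: (@scroll_exchange j (e (x j) - e' (x j))) => //; lia.
rewrite -opprB -mulN1r; apply: scroll_idealM.
by apply: (@scroll_exchange j (e' (x j) - e (x j))) => //; lia.
Qed.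

(** Adding column j, the relations of the new minors modulo the old ones are
    those of x 0, ..., x (j - 1) modulo the old minors, because the quotient by
    the old minors is a domain. *)
Lemma linres_minors j : (j <= m)%N -> linres (fun v => v *m minors j = 0).
Proof.
elim: j => [|j IH] jm; first by apply: linres_zero => v; rewrite mulmx0 thinmx0.
have {}IH := IH (ltnW jm).
apply: (linres_extension (d := 2)) => //; first exact: minors_homog.
  exact: new_minors_homog.
have rel := linres_quotient (minors_coefE j) (@minors_coef_homog j)
  (@vars_homog x j) IH (linres_vars (ltnW jm)).
apply: linres_ext rel => v.
have idE (z : 'M[S]_(iter j (addn^~ 1%N) 0%N, 1)) :
  (exists u, v *m z = u *m minors j) <-> scroll_ideal j ((v *m z) 0 0).
  by rewrite /scroll_ideal -mx11_scalar.
by rewrite !idE -!scroll_idealP ?psi_new_minors_eq0 // ltnW.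
Qed.

Theorem minors_linear_resolution (I : {pred S}) : (2 <= m)%N ->
  (forall f, f \in I <-> psi m f = 0) -> linear_resolution I 2.
Proof.
move=> m2 IE.
apply: (@linear_resolution_of_linres _ _ _ _ _ (minors m)) => //.
- exact: minors_homog.
- by move=> f; rewrite IE; apply: scroll_idealP.
- exact: linres_minors.
have [m0 m1] : (0 < m)%N /\ (1 < m)%N by rewrite ltnW.
exists ('X_(x 0%N) * 'X_(y 1%N) - 'X_(y 0%N) * 'X_(x 1%N)).
  apply/IE; rewrite rmorphB !rmorphM /= !monomial_mapX !weight1.
  rewrite !scroll_weight_x // !scroll_weight_y // !mpolyXD.
  by apply/eqP; rewrite subr_eq0; apply/eqP; ring.
rewrite -!mpolyXD subr_eq0; apply/eqP => /mpolyP/(_ (U_(x 0%N) + U_(y 1%N))%MM).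
rewrite !mcoeffX eqxx; case: eqP => [/mnmP/(_ (x 0%N))|_ /eqP]; last by rewrite oner_eq0.
rewrite !mnmDE !mnm1E eqxx !(eq_sym _ (x 0%N)) !(negPf (xy _ _)) //.
by case: eqP => // /(xI m0 m1).
Qed.

End TwoRowedMinors.

(** * Multigraded generators *)

Section MultigradedGenerators.
Variables (k : fieldType) (n N : nat) (d : 'I_n -> 'X_{1..N}).
Local Notation S := {mpoly k[n]}.
Local Notation weight := (weight d).

(** The component of weight g of a vector, when the j-th basis vector of the
    free module has weight lam j. *)
Definition vcomp b (lam : 'I_b -> 'X_{1..N}) g (v : 'rV[S]_b) : 'rV[S]_b :=
  \row_j restr (fun m => weight m + lam j == g)%MM (v 0 j).

Lemma vcompK b (lam : 'I_b -> 'X_{1..N}) g v :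
  vcomp lam g (vcomp lam g v) = vcomp lam g v.
Proof.
apply/rowP=> j; rewrite !mxE; apply/mpolyP=> m; rewrite !mcoeff_restr.
by case: (_ == g).
Qed.

Definition multigraded b lam (Z : 'rV[S]_b -> Prop) :=
  forall v g, Z v -> Z (vcomp lam g v).

Definition multihomog a b (lam' : 'I_a -> 'X_{1..N}) lam (R : 'M[S]_(a, b)) :=
  forall i j, {in msupp (R i j), forall m, weight m + lam j = lam' i}%MM.

Lemma vcompM a b lam' lam (R : 'M[S]_(a, b)) g v :
  multihomog lam' lam R -> vcomp lam g (v *m R) = vcomp lam' g v *m R.
Proof.
move=> hR; apply/rowP=> j; rewrite !mxE restr_sum; apply: eq_bigr => i _.
rewrite mxE; apply: restrM => m1 m2 /hR <-.
by rewrite weightD addmA.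
Qed.

Lemma multigraded_ker a b lam' lam (R : 'M[S]_(a, b)) :
  multihomog lam' lam R -> multigraded lam' (fun v => v *m R = 0).
Proof.
move=> hR v g vR; rewrite -(vcompM _ _ hR) vR.
by apply/rowP=> j; rewrite !mxE raddf0.
Qed.

Definition vweights b lam (v : 'rV[S]_b) : seq 'X_{1..N} :=
  undup [seq (weight m + lam j)%MM | j <- enum 'I_b, m <- msupp (v 0 j)].

Lemma vcomp_sum b lam (v : 'rV[S]_b) :
  v = \sum_(g <- vweights lam v) vcomp lam g v.
Proof.
apply/rowP=> j; rewrite summxE; apply/mpolyP=> m; rewrite raddf_sum /=.
have [mv|mv] := boolP (m \in msupp (v 0 j)); last first.
  rewrite (memN_msupp_eq0 mv) big1 // => g _.
  by rewrite mxE mcoeff_restr (memN_msupp_eq0 mv) if_same.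
rewrite (bigD1_seq (weight m + lam j)%MM) ?undup_uniq //=; last first.
  rewrite mem_undup; apply/allpairsPdep; exists j, m.
  by rewrite mem_enum.
rewrite mxE mcoeff_restr eqxx big1 ?addr0 // => g /negPf ne.
by rewrite mxE mcoeff_restr eq_sym ne.
Qed.

(** Linear independence over the field of constants. *)
Definition const_free a b (A : 'M[S]_(a, b)) :=
  forall c : 'rV[S]_a, homogmx 0 c -> c *m A = 0 -> c = 0.

Definition const_span a b (A : 'M[S]_(a, b)) v :=
  exists2 c : 'rV[S]_a, homogmx 0 c & v = c *m A.

Lemma const_spanD a b (A : 'M[S]_(a, b)) u v :
  const_span A u -> const_span A v -> const_span A (u + v).
Proof.
move=> [c hc ->] [c' hc' ->]; exists (c + c'); last by rewrite mulmxDl.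
by move=> i j; rewrite mxE rpredD.
Qed.

Lemma homog0_const (f : S) : f \is 0.-homog -> f = (f@_0%MM)%:MP.
Proof.
move=> /dhomogP hf; apply/mpolyP=> m; rewrite mcoeffC.
have [->|m0] := eqVneq m 0%MM; first by rewrite mulr1.
rewrite mulr0; apply/memN_msupp_eq0/negP => /hf /eqP.
by rewrite [_ == _]mdeg_eq0 (negPf m0).
Qed.

Lemma homog_const c : (c%:MP : S) \is 0.-homog.
Proof. by rewrite -alg_mpolyC rpredZ // dhomog1. Qed.

(** A maximal subfamily of L that is independent over the field, with the
    weights that come along. *)
Lemma const_basis b (L : seq ('rV[S]_b * 'X_{1..N})) :
  exists a (A : 'M[S]_(a, b)) (lam : 'I_a -> 'X_{1..N}),
  [/\ forall i, (row i A, lam i) \in L, const_free A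
    & {in L, forall x, const_span A x.1}].
Proof.
elim: L => [|x L [a [A [lam [AL fA sA]]]]].
  exists 0%N, 0, (fun=> 0%MM); split=> [[]|c _ _|] //.
  by apply/rowP; case.
have [sx|nsx] := classic (const_span A x.1).
  exists a, A, lam; split=> // [i|y]; first by rewrite inE AL orbT.
  by rewrite inE => /orP[/eqP->|/sA].
exists (a + 1)%N, (col_mx A x.1),
  (fun i => if split i is inl i' then lam i' else x.2); split.
- move=> i; have [i' ->|i' ->] := split_ordP i.
    by rewrite rowKu inE AL orbT.
  rewrite rowKd inE; apply/orP; left.
  by rewrite ord1 row_id; case: (x).
- move=> c hc; rewrite -(hsubmxK c) mul_row_col.
  set c1 := lsubmx c; set c2 := rsubmx c; have hc1 : homogmx 0 c1.
    by move=> i j; rewrite mxE.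
  have hc2 : c2 0 0 \is 0.-homog by rewrite mxE.
  rewrite [c2]mx11_scalar (homog0_const hc2); set t := _@_ _.
  have [-> |t0 e] := eqVneq t 0.
    rewrite mpolyC0 raddf0 mul0mx addr0 => /fA -> //.
    by rewrite row_mx0.
  case: nsx; exists (- t^-1%:MP *: c1).
    by move=> i j; rewrite mxE -mpolyCN mul_mpolyC rpredZ.
  move/eqP: e; rewrite -scalemxAl addr_eq0 mul_scalar_mx => /eqP->.
  by rewrite scalerN scaleNr opprK scalerA -mpolyCM mulVf // mpolyC1 scale1r.
- move=> y; rewrite inE => /orP[/eqP->|/sA[c hc ->]].
    exists (row_mx 0 1%:M); last by rewrite mul_row_col mul0mx mul1mx add0r.
    apply: homogmx_row; first exact: homogmx0.
    by move=> i j; rewrite !ord1 mxE eqxx mulr1n dhomog1.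
  exists (row_mx c 0); last by rewrite mul_row_col mul0mx addr0.
  by apply: homogmx_row => //; exact: homogmx0.
Qed.

Lemma const_spanP e a b c (A : 'M[S]_(a, b)) (B : 'M[S]_(c, b)) :
  homogmx e A -> homogmx e B ->
  (forall i, exists w, row i B = w *m A) ->
  exists2 P : 'M[S]_(c, a), homogmx 0 P & B = P *m A.
Proof.
move=> hA hB BA.
have h1 : homogmx 0 (1%:M : 'M[S]_c).
  by move=> i j; rewrite mxE; case: (i == j); rewrite ?dhomog1 ?rpred0.
have [i|U hU] := homog_lift hA hB h1; last by rewrite mul1mx; exists U.
by have [w wE] := BA i; exists w; rewrite -row_mul mul1mx.
Qed.

(** The weight components of the rows of R belong to Z and have the same degree
    as R, so they span the same space over the field. A basis of it chosen
    among them is homogeneous for the weight, and it differs from the rows of R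
    by constant matrices, which preserve linearity of the relations. *)
Lemma multigraded_generators e a b lam (Z : 'rV[S]_b -> Prop) (R : 'M[S]_(a, b)) :
  multigraded lam Z -> homogmx e R ->
  (forall v, Z v <-> exists w, v = w *m R) ->
  linres (fun w => w *m R = 0) ->
  exists c (A : 'M[S]_(c, b)) lam',
  [/\ homogmx e A, multihomog lam' lam A, const_free A,
      forall v, Z v <-> exists w, v = w *m A & linres (fun w => w *m A = 0)].
Proof.
move=> gZ hR ZR /linresP[r1 [R1 [hR1 KR1 kR1]]].
pose L := [seq (vcomp lam g (row i R), g) | i <- enum 'I_a, g <- vweights lam (row i R)].
have [c [A [lam' [AL fA sA]]]] := const_basis L.
have LP i : exists i' g, row i A = vcomp lam g (row i' R) /\ lam' i = g.
  by have /allpairsPdep[i' [g [_ _ [-> ->]]]] := AL i; exists i', g.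
have hA : homogmx e A.
  move=> i j; have [i' [g [rE _]]] := LP i.
  have -> : A i j = (row i A) 0 j by rewrite mxE.
  rewrite rE !mxE; apply/dhomogP => m /msupp_restr[_ mR].
  exact: dhomog_mf (hR i' j) _ mR.
have mA : multihomog lam' lam A.
  move=> i j m; have [i' [g [rE ->]]] := LP i.
  have -> : A i j = (row i A) 0 j by rewrite mxE.
  by rewrite rE !mxE => /msupp_restr[/eqP].
have ZA i : Z (row i A).
  have [i' [g [-> _]]] := LP i; apply: gZ; apply/ZR.
  by exists (delta_mx 0 i'); rewrite rowE.
have RA i : const_span A (row i R).
  rewrite [row i R](vcomp_sum lam); elim/big_ind: _ => [|u v|g _].
  - by exists 0; [exact: homogmx0 | rewrite mul0mx].
  - exact: const_spanD.
  have [gw|gw] := boolP (g \in vweights lam (row i R)).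
    apply: (sA (_, g)); apply/allpairsPdep; exists i, g; split=> //.
    by rewrite mem_enum.
  exists 0; first exact: homogmx0.
  rewrite mul0mx; apply/rowP=> j; rewrite !mxE; apply/mpolyP=> m.
  rewrite mcoeff_restr mcoeff0; case: eqP => // gE.
  apply/memN_msupp_eq0/negP => mR; case/negP: gw; rewrite mem_undup.
  by apply/allpairsPdep; exists j, m; rewrite mem_enum !mxE gE.
have [P hP PE] := const_spanP hA hR (fun i => let: ex_intro2 w _ E := RA i in ex_intro _ w E).
have [Q hQ QE] := const_spanP hR hA (fun i => (ZR _).1 (ZA i)).
have QP : Q *m P = 1%:M.
  apply/eqP; rewrite -subr_eq0; apply/eqP/row_matrixP=> i; rewrite row0.
  apply: fA.
    move=> i' j; rewrite !mxE rpredB ?rpred_sum //.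
      by move=> l _; rewrite -[0%N]/(0 + 0)%N dhomogM.
    by case: (_ == _); rewrite ?dhomog1 ?rpred0.
  by rewrite -row_mul mulmxBl mul1mx -mulmxA -PE -QE subrr row0.
have PQ : P *m Q = 1%:M.
  apply/eqP; rewrite -subr_eq0; apply/eqP/row_matrixP=> i; rewrite row0.
  set v := row i _; have hv : homogmx 0 v.
    move=> i' j; rewrite !mxE rpredB ?rpred_sum //.
      by move=> l _; rewrite -[0%N]/(0 + 0)%N dhomogM.
    by case: (_ == _); rewrite ?dhomog1 ?rpred0.
  have /KR1[w wE] : v *m R = 0.
    by rewrite -row_mul mulmxBl mul1mx -mulmxA -QE -PE subrr row0.
  apply/rowP=> j; rewrite [RHS]mxE (homog0_const (hv 0 j)) wE !mxE raddf_sum big1 //=.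
  move=> l _; apply/memN_msupp_eq0/negP => /msuppM_le /allpairsP[[m1 m2]] /= [_ + E].
  move/(dhomog_mf (hR1 l j)) => /=.
  by move/esym/eqP: E; rewrite mnmD_eq0 => /andP[_ /eqP->]; rewrite mf0.
exists c, A, lam'; split=> //.
  move=> v; split=> [/ZR[w ->]|[w ->]]; first by exists (w *m P); rewrite PE mulmxA.
  by apply/ZR; exists (w *m Q); rewrite QE mulmxA.
apply: Linres; exists r1, (R1 *m P); split.
- exact: homogmxM hR1 hP.
- move=> v; split=> [vA|[w ->]].
    have /KR1[w wE] : (v *m Q) *m R = 0 by rewrite -mulmxA -QE.
    by exists w; rewrite mulmxA -wE -mulmxA QP mulmx1.
  by rewrite -!mulmxA -PE mulmxA; apply/KR1; exists w.
apply: linres_ext kR1 => w; rewrite mulmxA; split=> [->|wP]; first by rewrite mul0mx.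
by rewrite -[w *m R1]mulmx1 -PQ mulmxA wP mul0mx.
Qed.

End MultigradedGenerators.

(** * Dimensions of multigraded strands *)

Section StrandDimensions.
Variables (k : fieldType) (n N : nat) (d : 'I_n -> 'X_{1..N}) (D : nat).
Local Notation S := {mpoly k[n]}.
Local Notation weight := (weight d).
Implicit Type g : 'X_{1..N}.

Definition expo (f : {ffun 'I_n -> 'I_D}) : 'X_{1..n} := [multinom val (f i) | i < n].

Lemma expo_inj : injective expo.
Proof.
by move=> f f' /mnmP e; apply/ffunP=> i; apply: val_inj; have := e i; rewrite !mnmE.
Qed.

Lemma expo_surj (m : 'X_{1..n}) : (forall i, m i < D)%N -> exists f, expo f = m.
Proof.
move=> mD; exists [ffun i => Ordinal (mD i)]; apply/mnmP=> i.
by rewrite mnmE ffunE.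
Qed.

(** Exponents are bounded by D to make the monomials of the free module a
    finite type; D is used only above the total degree of g, so that no
    monomial is lost. *)
Definition strand b (lam : 'I_b -> 'X_{1..N}) g : {set 'I_b * {ffun 'I_n -> 'I_D}} :=
  [set t | (weight (expo t.2) + lam t.1)%MM == g].

Section Coordinates.
Variables (b : nat) (lam : 'I_b -> 'X_{1..N}) (g : 'X_{1..N}).
Local Notation T := (strand lam g).

Definition to_module (u : 'rV[k]_#|T|) : 'rV[S]_b :=
  \row_j \sum_(i | (enum_val i).1 == j) u 0 i *: 'X_[expo (enum_val i).2].

Definition coord (v : 'rV[S]_b) : 'rV[k]_#|T| :=
  \row_i (v 0 (enum_val i).1)@_(expo (enum_val i).2).

Lemma to_moduleK : cancel to_module coord.
Proof.
move=> u; apply/rowP=> i; rewrite !mxE raddf_sum /= (bigD1 i) //=.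
rewrite mcoeffZ mcoeffX eqxx mulr1 big1 ?addr0 // => i' /andP[/eqP e ne].
rewrite mcoeffZ mcoeffX; case: eqP => [/expo_inj e2|]; last by rewrite mulr0.
case/eqP: ne; apply: enum_val_inj; move: e e2.
by case: (enum_val i') (enum_val i) => [? ?] [? ?] /= -> ->.
Qed.

Lemma coordK v : (forall m : 'X_{1..n}, forall j, (weight m + lam j = g)%MM -> forall i, (m i < D)%N) ->
  vcomp d lam g v = v -> to_module (coord v) = v.
Proof.
move=> gD vg; apply/rowP=> j; rewrite mxE; apply/mpolyP=> m; rewrite raddf_sum /=.
have [wm|wm] := eqVneq (weight m + lam j)%MM g; last first.
  rewrite -vg mxE mcoeff_restr (negPf wm) big1 // => i /eqP ij.
  rewrite mcoeffZ mcoeffX; case: eqP => [e|]; last by rewrite mulr0.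
  by have := enum_valP i; rewrite inE ij e (negPf wm).
have [f fm] := expo_surj (gD _ _ wm).
have tT : (j, f) \in T by rewrite inE /= fm wm.
rewrite (bigD1 (enum_rank_in tT (j, f))) /=; last by rewrite enum_rankK_in.
rewrite enum_rankK_in //= fm mcoeffZ mcoeffX eqxx mulr1 mxE enum_rankK_in //= fm.
rewrite big1 ?addr0 // => i /andP[/eqP ij ne].
rewrite mcoeffZ mcoeffX; case: eqP => [e|]; last by rewrite mulr0.
case/eqP: ne; apply: enum_val_inj; rewrite enum_rankK_in //.
by rewrite [LHS]surjective_pairing ij; congr (_, _); apply: expo_inj; rewrite e fm.
Qed.

Lemma to_module_vcomp u : vcomp d lam g (to_module u) = to_module u.
Proof.
apply/rowP=> j; rewrite !mxE; apply: restr_id => m; rewrite mcoeff_msupp raddf_sum /=.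
apply: contraR => wm; rewrite big1 // => i /eqP ij.
rewrite mcoeffZ mcoeffX; case: eqP => [e|]; last by rewrite mulr0.
by have := enum_valP i; rewrite inE ij e (negPf wm).
Qed.

Lemma to_module_lin c u v : to_module (c *: u + v) = c%:MP *: to_module u + to_module v.
Proof.
apply/rowP=> j; rewrite !mxE mulr_sumr -big_split /=; apply: eq_bigr => i _.
by rewrite !mxE scalerDl mul_mpolyC scalerA.
Qed.

Lemma to_module0 : to_module 0 = 0.
Proof. by apply/rowP=> j; rewrite !mxE big1 // => i _; rewrite mxE scale0r. Qed.

End Coordinates.

Definition strand_dim b (Z : 'rV[S]_b -> Prop) lam g r :=
  exists q (U : 'M[k]_(q, #|strand lam g|)),
    (forall u, Z (to_module u) <-> (u <= U)%MS) /\ \rank U = r.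

(** The rank formula for the map given by A in weight g. *)
Lemma strand_dim_span a b lam' lam (A : 'M[S]_(a, b)) g r (Z : 'rV[S]_b -> Prop) :
  (forall m : 'X_{1..n}, forall j, (weight m + lam j = g)%MM -> forall i, (m i < D)%N) ->
  (forall m : 'X_{1..n}, forall j, (weight m + lam' j = g)%MM -> forall i, (m i < D)%N) ->
  multihomog d lam' lam A ->
  (forall v, Z v <-> exists w, v = w *m A) ->
  strand_dim (fun w => w *m A = 0) lam' g r ->
  (r <= #|strand lam' g|)%N /\ strand_dim Z lam g (#|strand lam' g| - r)%N.
Proof.
move=> gD gD' hA ZA [q [U [kU <-]]].
pose Phi := \matrix_i coord lam g (to_module (delta_mx 0 i : 'rV_#|strand lam' g|) *m A).
have PhiE u : to_module (u *m Phi) = to_module u *m A.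
  have -> : to_module u = \sum_i (u 0 i)%:MP *: to_module (delta_mx 0 i).
    rewrite {1}[u]row_sum_delta.
    elim/big_rec2: _ => [|i v w _ <-]; first exact: to_module0.
    by rewrite to_module_lin.
  have -> : to_module (u *m Phi) = \sum_i (u 0 i)%:MP *: to_module (row i Phi).
    rewrite mulmx_sum_row.
    elim/big_rec2: _ => [|i v w _ <-]; first exact: to_module0.
    by rewrite to_module_lin.
  rewrite mulmx_suml; apply: eq_bigr => i _; rewrite -scalemxAl; congr (_ *: _).
  rewrite rowK coordK // (vcompM _ _ hA).
  by rewrite to_module_vcomp.
have kPhi : (U == kermx Phi)%MS.
  have sub (u : 'rV_#|strand lam' g|) : (u <= U)%MS = (u <= kermx Phi)%MS.
    rewrite sub_kermx; apply/idP/eqP => [/kU uA|uPhi].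
      by rewrite -(to_moduleK (u *m Phi)) PhiE uA -(to_module0 lam g) to_moduleK.
    by apply/kU; rewrite -PhiE uPhi to_module0.
  by apply/andP; split; apply/row_subP => i; rewrite ?sub ?row_sub // -sub row_sub.
rewrite (eqmx_rank kPhi) mxrank_ker leq_subr; split=> //.
exists _, Phi; split; last by rewrite subKn // rank_leq_row.
move=> u; rewrite ZA; split=> [[w wE]|/submxP[w ->]]; last by exists (to_module w); rewrite PhiE.
have := to_module_vcomp u; rewrite wE (vcompM _ _ hA) => wE'.
apply/submxP; exists (coord lam' g (vcomp d lam' g w)).
apply: (can_inj (@to_moduleK _ _ _)); rewrite PhiE coordK //; first by rewrite wE' -wE.
exact: vcompK.
Qed.

Lemma strand_dim0 b lam g (Z : 'rV[S]_b -> Prop) :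
  (forall u, Z (to_module (u : 'rV_#|strand lam g|)) -> to_module u = 0) -> Z 0 ->
  strand_dim Z lam g 0.
Proof.
move=> Z0 Zz; exists _, (0 : 'M_#|strand lam g|); split=> [u|]; last exact: mxrank0.
split=> [/Z0 e|]; last by rewrite submx0 => /eqP->; rewrite to_module0.
by rewrite -(to_moduleK u) e -(to_module0 lam g) to_moduleK sub0mx.
Qed.

(** Up to the truncation at D, the multigraded Hilbert series of the polynomial
    ring, that is the product of the 1 / (1 - X^(d e)). *)
Definition gen_monomials : {mpoly int[N]} :=
  \prod_(e < n) \sum_(i < D) 'X_[(d e *+ i)%MM].

Lemma gen_monomialsE :
  gen_monomials = \sum_(f : {ffun 'I_n -> 'I_D}) 'X_[weight (expo f)].
Proof.
rewrite /gen_monomials bigA_distr_bigA /=; apply: eq_bigr => f _.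
by rewrite mprodXE; congr ('X_[_]); apply: eq_bigr => i _; rewrite mnmE.
Qed.

Lemma card_strand b (lam : 'I_b -> 'X_{1..N}) g :
  (#|strand lam g|%:Z = ((\sum_c 'X_[lam c]) * gen_monomials)@_g)%R.
Proof.
rewrite gen_monomialsE mulr_suml raddf_sum /= -[LHS]natz -sum1_card natr_sum.
rewrite (eq_bigr (fun c => \sum_(f : {ffun 'I_n -> 'I_D}) ((weight (expo f) + lam c)%MM == g)%:R)).
  rewrite pair_big /= [RHS](bigID (fun t => t \in strand lam g)) /=.
  rewrite [X in _ + X]big1 ?addr0.
    by apply: eq_bigr => -[c f]; rewrite inE /= => ->.
  by move=> [c f]; rewrite inE /= => /negPf->.
move=> c _; rewrite mulr_sumr raddf_sum /=; apply: eq_bigr => f _.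
by rewrite -mpolyXD mcoeffX addmC.
Qed.

End StrandDimensions.

(** * From graded resolutions to linear syzygies *)

Section ResolutionData.
Variables (k : fieldType) (n : nat) (I : {pred {mpoly k[n]}}).
Local Notation S := {mpoly k[n]}.

Variant resolution_tail (F : graded_resolution I) :
    forall b, ('rV[S]_b -> Prop) -> Prop :=
  ResolutionTail i : resolution_tail F (fun w => w *m res_diff F i = 0).

(** Vanishing Betti numbers force every shift in homological degree i > 0 to be
    q + i - 1, so all differentials after the first one have linear entries. *)
Lemma linres_of_linear_resolution q : (0 < q)%N -> linear_resolution I q ->
  exists r (g : 'M[S]_(r, 1)), [/\ homogmx q g,
    forall f, f \in I <-> exists w : 'rV_r, f%:M = w *m g
    & linres (fun w : 'rV_r => w *m g = 0)].
Proof.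
move=> q0 [_ [F [_ bF]]].
have shE i (c : 'I_(res_rank F i.+1)) : res_shift c = (q + i)%N.
  apply/eqP/negPn/negP => ne; have := bF i.+1 (res_shift c) isT.
  rewrite subn1 => /(_ ne) /eqP; rewrite cards_eq0 => /eqP/setP/(_ c).
  by rewrite !inE eqxx.
pose c0 : 'I_(res_rank F 0) := cast_ord (esym (res_rank0 F)) ord0.
have cE (c : 'I_(res_rank F 0)) : c = c0.
  apply: val_inj => /=; apply/eqP; rewrite -leqn0 -ltnS.
  by apply: leq_trans (ltn_ord c) _; rewrite res_rank0.
pose g : 'M[S]_(res_rank F 1, 1) := \matrix_(i, j) res_diff F 0 i c0.
have gE a (w : 'M_(a, res_rank F 1)) i : (w *m res_diff F 0) i c0 = (w *m g) i 0.
  by rewrite !mxE; apply: eq_bigr => l _; rewrite !mxE.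
exists (res_rank F 1), g; split.
- move=> i j; rewrite mxE; apply/dhomogP => m /res_homog /=.
  by rewrite res_shift0 addn0 shE addn0.
- move=> f; rewrite (res_aug F); split=> -[w wE]; exists w.
    by apply/matrixP=> i j; rewrite !ord1 -gE -wE !mxE eqxx.
  apply/matrixP=> i j; rewrite !ord1 (cE j) gE -wE !mxE eqxx.
  by rewrite mulr1n.
have tail : linres (fun w : 'rV_(res_rank F 1) => w *m res_diff F 0 = 0).
  exists (resolution_tail F); last exact: ResolutionTail.
  move=> b Z [i]; exists _, (res_diff F i.+1); split; last exact: ResolutionTail.
    move=> r c; apply/dhomogP => m /res_homog /=.
    by rewrite !shE => e; change (mdeg m = 1%N); lia.
  by move=> v; apply: res_exact.
apply: linres_ext tail => v; split=> v0; apply/matrixP=> i j.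
  by rewrite !ord1 -gE v0 !mxE.
by rewrite !ord1 (cE j) gE v0 !mxE.
Qed.

End ResolutionData.

(** * Signs of the coefficients of the K-polynomial *)

Section EulerSign.
Variables (k : fieldType) (n N : nat) (d : 'I_n -> 'X_{1..N}).
Hypothesis d2 : forall e, mdeg (d e) = 2%N.
Local Notation S := {mpoly k[n]}.
Local Notation weight := (weight d).
Implicit Type g : 'X_{1..N}.

Lemma mdeg_weight m : mdeg (weight m) = (2 * mdeg m)%N.
Proof.
rewrite /weight mdeg_sum mdegE big_distrr /=; apply: eq_bigr => e _.
by rewrite mdegMn d2.
Qed.

(** Each d e has degree 2, hence the factors 2; independence is used to have a
    nonzero entry in row i. *)
Lemma multihomog_label e s a b (A : 'M[S]_(a, b)) lam' lam i :
  homogmx e A -> multihomog d lam' lam A -> const_free A ->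
  (forall j, mdeg (lam j) = 2 * s)%N -> mdeg (lam' i) = (2 * (s + e))%N.
Proof.
move=> hA mA fA ls; have [j Aij] : exists j, A i j != 0.
  apply: NNPP => none; have /rowP/(_ i) : (delta_mx 0 i : 'rV[S]_a) = 0.
    apply: fA.
      by move=> i' j; rewrite mxE; case: (_ && _); rewrite ?dhomog1 ?rpred0.
    rewrite -rowE; apply/rowP=> j; rewrite !mxE; apply/eqP/negPn/negP => ne.
    by case: none; exists j.
  by rewrite !mxE !eqxx => /eqP; rewrite oner_eq0.
rewrite -(mA i j _ (mlead_supp Aij)) mdegD mdeg_weight ls.
by rewrite (dhomog_mf (hA i j) (mlead_supp Aij)) /= mulnDr addnC.
Qed.

Variable D : nat.

Lemma expo_bound b (lam : 'I_b -> 'X_{1..N}) g : (mdeg g < D)%N ->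
  forall (m : 'X_{1..n}) j, (weight m + lam j = g)%MM -> forall i, (m i < D)%N.
Proof.
move=> gD m j wm i; apply: leq_ltn_trans gD; rewrite -wm mdegD mdeg_weight.
have : (m i <= mdeg m)%N by rewrite mdegE (bigD1 i) //= leq_addr.
by lia.
Qed.

(** Q is the alternating sum of the generating functions of the weights of the
    generators in a multigraded linear resolution of Z.  As the i-th step sits
    in a single total degree, no cancellation occurs and signs alternate. *)
Lemma syzygy_poly t : forall s b lam (Z : 'rV[S]_b -> Prop),
  (forall c, mdeg (lam c) = 2 * s)%N -> multigraded d lam Z -> linres Z ->
  exists Q : {mpoly int[N]}, [/\
    forall g, (mdeg g <= 2 * (s + t))%N -> (mdeg g < D)%N -> exists2 r,
      strand_dim d D Z lam g r & r%:Z = (Q * gen_monomials d D)@_g,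
    forall g, (mdeg g < 2 * s.+1)%N -> Q@_g = 0
    & forall g i, mdeg g = (2 * (s.+1 + i))%N -> 0 <= (-1) ^+ i * Q@_g].
Proof.
elim: t => [|t IH] s b lam Z ls gZ lZ.
  exists 0; split=> [g|g|g i]; rewrite ?mcoeff0 ?mulr0 //.
  rewrite addn0 => gs gD; exists 0%N; last by rewrite mul0r mcoeff0.
  case/linresP: lZ => a [R [hR ZR _]].
  apply: strand_dim0; last by apply/ZR; exists 0; rewrite mul0mx.
  move=> u /ZR[w wE].
  have h0 : homogmx 0 (to_module u).
    move=> i j; rewrite ord1; apply/dhomogP => m.
    rewrite -(to_module_vcomp u) mxE => /msupp_restr[/eqP wm _] /=.
    by move: gs; rewrite -wm mdegD mdeg_weight ls; lia.
  apply/matrixP=> i j; have := homog0_const (h0 i j).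
  rewrite [in X in _ = X%:MP]wE !mxE => ->.
  suff -> : (\sum_l w i l * R l j)@_0%MM = 0 by rewrite mpolyC0.
  rewrite raddf_sum big1 // => l _; apply/memN_msupp_eq0/negP.
  move=> /msuppM_le /allpairsP[[m1 m2]] /= [_ + E].
  move/(dhomog_mf (hR l j)) => /=.
  by move/esym/eqP: E; rewrite mnmD_eq0 => /andP[_ /eqP->]; rewrite mf0.
have [a [R [hR ZR kR]]] := linresP lZ.
have [c [A [lam' [hA mA fA ZA kA]]]] := multigraded_generators gZ hR ZR kR.
have ls' i : mdeg (lam' i) = (2 * s.+1)%N.
  by rewrite (multihomog_label i hA mA fA ls) addn1.
have [Q1 [dQ1 zQ1 sQ1]] := IH _ _ _ _ ls' (multigraded_ker mA) kA.
exists (\sum_i 'X_[lam' i] - Q1); split.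
- move=> g gs gD.
  have [|r1 dr1 r1E] := dQ1 g _ gD; first by rewrite addSnnS.
  have [le dr] := strand_dim_span (expo_bound gD) (expo_bound gD) mA ZA dr1.
  exists (#|strand d D lam' g| - r1)%N => //.
  by rewrite mulrBl mcoeffB -card_strand -r1E -subzn.
- move=> g gs; rewrite mcoeffB raddf_sum /= zQ1 ?subr0; last by lia.
  rewrite big1 // => i _; rewrite mcoeffX; case: eqP => // e.
  by move: gs; rewrite -e ls'; lia.
move=> g [|i] gs; rewrite mcoeffB raddf_sum /=.
  rewrite mul1r zQ1; last by lia.
  by rewrite subr0 sumr_ge0 // => i _; rewrite mcoeffX; case: eqP.
rewrite big1 => [|l _]; last first.
  rewrite mcoeffX; case: eqP => // e.
  by move: gs; rewrite -e ls'; lia.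
rewrite sub0r exprS mulN1r mulrNN; apply: sQ1.
by rewrite gs; lia.
Qed.

(** The coefficient at g of the product of h with the 1 - X^(d e), for e in L,
    where h is read as a power series; this form computes. *)
Fixpoint euler (h : 'X_{1..N} -> int) (L : seq 'I_n) g : int :=
  if L is e :: L' then
    euler h L' g - (if (d e <= g)%MM then euler h L' (g - d e)%MM else 0)
  else h g.

Lemma mcoeffMXle (f : {mpoly int[N]}) m g :
  (f * 'X_[m])@_g = if (m <= g)%MM then f@_(g - m)%MM else 0.
Proof.
case: ifP => [le|nle]; first by rewrite -{1}(submK le) addmC mcoeffMX.
apply/memN_msupp_eq0/negP => /msuppM_le; rewrite msuppX => /allpairsP[[a b]] /=.
by rewrite inE => -[_ /eqP-> e]; rewrite e lem_addl in nle.
Qed.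

Lemma mcoeff_euler (f : {mpoly int[N]}) L g :
  (f * \prod_(e <- L) (1 - 'X_[d e]))@_g = euler (fun g' => f@_g') L g.
Proof.
elim: L g => [|e L IH] g; first by rewrite big_nil mulr1.
rewrite big_cons mulrCA mulrBl mul1r mcoeffB IH /=; congr (_ - _).
by rewrite [_ * (f * _)]mulrC mcoeffMXle; case: ifP.
Qed.

Lemma eq_euler h h' L g :
  (forall g', (mdeg g' <= mdeg g)%N -> h g' = h' g') -> euler h L g = euler h' L g.
Proof.
elim: L g => [|e L IH] g hh' /=; first exact: hh'.
rewrite IH //; congr (_ - _); case: ifP => // le; apply: IH => g' g'le.
by apply: hh'; apply: leq_trans g'le _; exact: mdegB.
Qed.

End EulerSign.

Section EulerSignTheorem.
Variables (k : fieldType) (n N : nat) (d : 'I_n -> 'X_{1..N}).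
Hypothesis d2 : forall e, mdeg (d e) = 2%N.
Local Notation S := {mpoly k[n]}.
Local Notation weight := (weight d).

Lemma monomial_map_fibre (f : S) g :
  (monomial_map d f)@_g = 0 <-> monomial_map d (restr (fun m => weight m == g) f) = 0.
Proof.
have -> : monomial_map d (restr (fun m => weight m == g) f) =
    (monomial_map d f)@_g *: 'X_[g].
  rewrite /restr rmorph_sum mcoeff_monomial_map scaler_suml.
  by apply: eq_bigr => m /eqP wm /=; rewrite monomial_mapZ monomial_mapX wm.
split=> [->|/mpolyP/(_ g)]; first by rewrite scale0r.
by rewrite mcoeffZ mcoeffX eqxx mulr1 mcoeff0.
Qed.

Lemma strand_dim_uniq D b lam (Z : 'rV[S]_b -> Prop) g r r' :
  strand_dim d D Z lam g r -> strand_dim d D Z lam g r' -> r = r'.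
Proof.
move=> [q [U [UZ <-]]] [q' [U' [UZ' <-]]]; apply: eqmx_rank.
apply/andP; split; apply/row_subP => i.
  by apply/UZ'/UZ; exact: row_sub.
by apply/UZ/UZ'; exact: row_sub.
Qed.

(** The toric ring has dimension at most one in each weight. *)
Lemma toric_strand_dim D g (I : {pred S}) :
  (forall f, f \in I <-> monomial_map d f = 0) ->
  let lam := fun=> 0%MM in
  strand_dim d D (fun v : 'rV[S]_1 => v 0 0 \in I) lam g
    (#|strand d D lam g| - (0 < #|strand d D lam g|))%N.
Proof.
move=> IE lam; set t := #|_|.
exists t, (kermx (const_mx 1 : 'cV[k]_t)); split; last first.
  rewrite mxrank_ker; congr (_ - _)%N; case: (posnP t) => [t0|t0].
    by apply/eqP; rewrite -leqn0; apply: leq_trans (rank_leq_row _) _; rewrite t0.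
  rewrite -mxrank_tr rank_rV; congr (nat_of_bool _).
  apply/eqP => /rowP/(_ (Ordinal t0)); rewrite !mxE => /eqP.
  by rewrite oner_eq0.
move=> u; rewrite IE sub_kermx.
have -> : monomial_map d (to_module u 0 0) = (\sum_i u 0 i) *: 'X_[g].
  rewrite mxE rmorph_sum scaler_suml /=.
  rewrite (eq_bigl xpredT) => [|i]; last by rewrite !ord1.
  apply: eq_bigr => i _; rewrite monomial_mapZ monomial_mapX.
  by have := enum_valP i; rewrite inE addm0 => /eqP->.
have -> : (u *m (const_mx 1 : 'cV_t) == 0) = (\sum_i u 0 i == 0).
  apply/idP/idP => [/eqP/matrixP/(_ 0 0) e|/eqP s0]; apply/eqP.
    move: e; rewrite !mxE => e; by rewrite -[RHS]e; apply: eq_bigr => i _; rewrite mxE mulr1.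
  apply/matrixP=> i j; rewrite !ord1 !mxE -[RHS]s0.
  by apply: eq_bigr => l _; rewrite mxE mulr1.
split=> [/mpolyP/(_ g)|/eqP->]; last by rewrite scale0r.
by rewrite mcoeffZ mcoeffX eqxx mulr1 mcoeff0 => ->.
Qed.

Lemma mcoeff_high_prod (f : {mpoly int[N]}) D L g : (mdeg g < D)%N ->
  (f * \prod_(e <- L) (1 - 'X_[(d e *+ D)%MM]))@_g = f@_g.
Proof.
move=> gD; elim: L => [|e L IH]; first by rewrite big_nil mulr1.
rewrite big_cons mulrCA mulrBl mul1r mcoeffB IH mulrC mcoeffMXle.
case: ifP => [le|_]; last by rewrite subr0.
have : (mdeg (d e *+ D)%MM <= mdeg g)%N by rewrite -(submK le) mdegD leq_addl.
by rewrite mdegMn d2; lia.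
Qed.

Lemma gen_monomials_inv D L : perm_eq L (enum 'I_n) ->
  gen_monomials d D * \prod_(e <- L) (1 - 'X_[d e]) =
  \prod_(e <- L) (1 - 'X_[(d e *+ D)%MM]).
Proof.
move=> pL; rewrite /gen_monomials -(big_enum _ _ xpredT) /=.
rewrite -(perm_big _ pL) -big_split /=; apply: eq_bigr => e _.
rewrite -mpolyXn -opprB -[in RHS]opprB mulrN subrX1 mulrC; congr (- (_ * _)).
by apply: eq_bigr => i _; rewrite mpolyXn.
Qed.

(** The coefficient of the K-polynomial of the toric ring at a weight of degree
    q + i is the alternating sum of the multigraded Betti numbers there; with a
    linear resolution only the one in homological degree i + 1 contributes.
    Multiplying the Hilbert function h by the 1 - X^(d e) computes this
    coefficient without any resolution. *)
Theorem euler_sign (I : {pred S}) q i (h : 'X_{1..N} -> int) L mu :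
  (0 < q)%N -> linear_resolution I q ->
  (forall f, f \in I <-> monomial_map d f = 0) ->
  (forall m, h (weight m) = 1) ->
  (forall g, (forall m, weight m <> g) -> h g = 0) ->
  perm_eq L (enum 'I_n) -> mdeg mu = (2 * (q + i))%N ->
  (-1) ^+ i * euler d h L mu <= 0.
Proof.
(* Truncating at D leaves all coefficients of degree at most that of mu
   unchanged. *)
move=> q0 lI IE h1 h0 pL mu_i; pose D := (mdeg mu).+1.
have [r [gs [hgs Igs kgs]]] := linres_of_linear_resolution q0 lI.
pose lam : 'I_1 -> 'X_{1..N} := fun=> 0%MM.
pose Z (v : 'rV[S]_1) := v 0 0 \in I.
have ZE v : Z v <-> exists w, v = w *m gs.
  by rewrite /Z Igs -mx11_scalar.
have gZ : multigraded d lam Z.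
  move=> v g /IE v0; apply/IE; rewrite mxE.
  rewrite (_ : restr _ _ = restr (fun m => weight m == g) (v 0 0)).
    by apply/monomial_map_fibre; rewrite v0 mcoeff0.
  by apply/mpolyP=> m; rewrite !mcoeff_restr addm0.
have [c [A [lam' [hA mA fA ZA kA]]]] := multigraded_generators gZ hgs ZE kgs.
have l0 j : mdeg (lam j) = (2 * 0)%N by rewrite mdeg0.
have ls' a : mdeg (lam' a) = (2 * q)%N.
  by rewrite (multihomog_label d2 a hA mA fA l0).
have [Q1 [dQ1 zQ1 sQ1]] := syzygy_poly d2 D i ls' (multigraded_ker mA) kA.
(* W agrees with the K-polynomial up to the degree of mu. *)
pose W := 1 - \sum_a 'X_[lam' a] + Q1.
have HW g : (mdeg g <= mdeg mu)%N -> h g = (W * gen_monomials d D)@_g.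
  move=> gmu; have gD : (mdeg g < D)%N by [].
  have [|r1 dr1 r1E] := dQ1 g _ gD; first by rewrite -mu_i.
  have [le dr] := strand_dim_span (expo_bound d2 gD) (expo_bound d2 gD) mA ZA dr1.
  have rE := strand_dim_uniq (toric_strand_dim D g IE) dr.
  change (#|strand d D lam g| - (0 < #|strand d D lam g|) = #|strand d D lam' g| - r1)%N in rE.
  have hE : h g = ((0 < #|strand d D lam g|)%N : nat)%:Z.
    have [/cards0_eq t0|/card_gt0P[[a f]]] := posnP; last first.
      by rewrite inE addm0 => /eqP<-; rewrite h1.
    apply: h0 => m wm; have wm0 : (weight m + lam ord0 = g)%MM by rewrite addm0.
    have [f fm] := expo_surj (expo_bound d2 gD wm0).
    by have /setP/(_ (ord0, f)) := t0; rewrite !inE /= fm wm0 eqxx.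
  have tE : #|strand d D lam g|%:Z = (gen_monomials d D)@_g.
    by rewrite card_strand big_ord1 mpolyX0 mul1r.
  rewrite hE /W mulrDl mulrBl mul1r mcoeffD mcoeffB -tE -card_strand -r1E.
  move: rE le; move: #|_| #|_| r1 {dr1 dr r1E hE tE} => t t' r1; case: t => [|t] /=; lia.
suff -> : euler d h L mu = W@_mu.
  rewrite /W mcoeffD mcoeffB mcoeff1 raddf_sum /=.
  have /negPf-> : mu != 0%MM by rewrite -mdeg_eq0 mu_i; lia.
  rewrite sub0r; clear dQ1 HW; case: i mu_i sQ1 => [|i] mu_i sQ1.
    rewrite zQ1 ?addr0 ?mul1r; last by rewrite mu_i; lia.
    by rewrite oppr_le0 sumr_ge0 // => a _; rewrite mcoeffX; case: eqP.
  rewrite big1 => [|a _]; last first.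
    rewrite mcoeffX; case: eqP => // e.
    by move: mu_i; rewrite -e ls'; lia.
  rewrite oppr0 add0r exprS mulN1r mulNr oppr_le0; apply: sQ1.
  by rewrite mu_i; lia.
rewrite (eq_euler _ _ HW) -mcoeff_euler -mulrA gen_monomials_inv //.
exact: mcoeff_high_prod.
Qed.

End EulerSignTheorem.

(** * The toric edge ideal as the kernel of a monomial map *)

Section EdgeWeights.
Variable G : sgraph.
Local Notation nE := #|edges G|.
Local Notation nV := #|G|.

Definition ends (i : 'I_nE) : 'X_{1..nV} :=
  [multinom nat_of_bool (enum_val j \in enum_val i) | j < nV].

Lemma mem_edges x y : adj x y -> [set x; y] \in edges G.
Proof.
by move=> xy; rewrite inE; apply/existsP; exists x; apply/existsP; exists y; rewrite xy eqxx.
Qed.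

Lemma edgeP (i : 'I_nE) : exists x y : G, adj x y /\ enum_val i = [set x; y].
Proof.
have := enum_valP i; rewrite inE => /existsP[x /existsP[y /andP[xy /eqP e]]].
by exists x, y.
Qed.

Lemma adj_neq (x y : G) : adj x y -> x != y.
Proof. by apply: contraTneq => ->; rewrite adj_irrefl. Qed.

Lemma adj_edge (x y : G) (i : 'I_nE) : enum_val i = [set x; y] -> adj x y.
Proof.
have [a [b [ab ->]]] := edgeP i.
move=> e; have := set21 a b; have := set22 a b; have := set21 x y; have := set22 x y.
rewrite {1 2}e -{1 2}e !in_set2.
have nab := adj_neq ab.
case/orP=> /eqP y1 /orP[] /eqP x1 /orP[] /eqP b1 /orP[] /eqP a1; subst;
  by rewrite ?eqxx // in nab *; rewrite // adj_sym.
Qed.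

Lemma mdeg_ends i : mdeg (ends i) = 2%N.
Proof.
have [x [y [xy e]]] := edgeP i.
rewrite mdegE (reindex (@enum_rank G)) /=; last first.
  by exists enum_val => v _; [exact: enum_rankK | exact: enum_valK].
rewrite (eq_bigr (fun v => nat_of_bool (v \in [set x; y]))); last first.
  by move=> v _; rewrite mnmE enum_rankK e.
by rewrite -big_mkcond sum1_card cards2 (adj_neq xy).
Qed.

Lemma toric_edge_idealE (k : fieldType) (f : {mpoly k[nE]}) :
  f \in @toric_edge_ideal k G <-> monomial_map ends f = 0.
Proof.
rewrite unfold_in /toric_edge_ideal /= /edge_map /monomial_map.
rewrite (_ : [tuple _ | i < nE] = [tuple 'X_[ends i] | i < nE]).
  by split=> [/eqP|->].
apply: eq_mktuple => i; rewrite /edge_monomial mprodXE; congr ('X_[_]).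
apply/mnmP=> j; rewrite mnm_sumE mnmE big_mkcond (bigD1 (enum_val j)) //=.
rewrite mnm1E enum_valK eqxx big1 ?addn0 => [|v vj]; first by case: (_ \in _).
case: (v \in _) => //; rewrite mnm1E; case: eqP => // e.
by rewrite -e enum_rankK eqxx in vj.
Qed.

Lemma weight_ends (m : 'X_{1..nE}) (v : G) :
  weight ends m (enum_rank v) = (\sum_(i : 'I_nE | v \in enum_val i) m i)%N.
Proof.
rewrite weightE [RHS]big_mkcond; apply: eq_bigr => i _.
by rewrite mnmE enum_rankK; case: (_ \in _); rewrite ?mul1n.
Qed.

Lemma mnm_list n (m : 'X_{1..n}) :
  exists t : seq 'I_n, m = (\sum_(e <- t) U_(e))%MM /\ size t = mdeg m.
Proof.
have [s ms] := ubnP (mdeg m); elim: s m ms => // s IH m ms.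
have [->|] := eqVneq m 0%MM; first by exists [::]; rewrite big_nil mdeg0.
move=> m0; have [i mi] : exists i, m i != 0%N.
  apply: NNPP => none; case/eqP: m0; apply/mnmP=> i; rewrite mnm0E.
  by apply/eqP/negPn/negP => mi; case: none; exists i.
have mE : (m - U_(i) + U_(i) = m)%MM by rewrite submK // lep1mP.
have dE : mdeg m = (mdeg (m - U_(i))%MM).+1 by rewrite -{1}mE mdegD mdeg1 addn1.
have [|t [tE st]] := IH (m - U_(i))%MM; first by rewrite -ltnS -dE.
by exists (i :: t); rewrite big_cons -tE addmC mE /= st dE.
Qed.

End EdgeWeights.

(** * K-polynomials of induced subgraphs *)

Definition decr_ends (p : nat * nat) (g : seq nat) : seq nat :=
  set_nth 0%N (set_nth 0%N g p.1 (nth 0 g p.1).-1)%N p.2 (nth 0 g p.2).-1%N.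

Definition decr_ok (p : nat * nat) (g : seq nat) :=
  (0 < nth 0 g p.1)%N && (0 < nth 0 g p.2)%N.

(** Whether g is the degree sequence of a multiset of edges of E, searching for
    an edge at the first vertex of nonzero degree. Conditionals replace the
    conjunctions of coversE so that evaluation by value does not explore
    useless branches. *)
Fixpoint covers fuel (E : seq (nat * nat)) g : bool :=
  if all (eq_op 0%N) g then true else
  if fuel is fuel'.+1 then
    let i := find (fun a => a != 0)%N g in
    has (fun p => if (p.1 == i) || (p.2 == i) then
                    if decr_ok p g then covers fuel' E (decr_ends p g) else false
                  else false) E
  else false.

Lemma coversE fuel E g : covers fuel E g =
  all (eq_op 0%N) g ||
  (if fuel is fuel'.+1 then
     let i := find (fun a => a != 0)%N g in
     has (fun p => [&& (p.1 == i) || (p.2 == i), decr_ok p g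
                     & covers fuel' E (decr_ends p g)]) E
   else false).
Proof. by case: fuel => [|fuel] /=; case: (all _ _). Qed.

(** The function euler for the toric ring of the graph with edge list E, with
    vertices numbered and weights written as lists of degrees; it evaluates by
    computation. *)
Fixpoint local_euler (E L : seq (nat * nat)) g : int :=
  if L is p :: L' then
    local_euler E L' g - (if decr_ok p g then local_euler E L' (decr_ends p g) else 0)
  else if covers (sumn g) E g then 1 else 0.

Section LocalEuler.
Variables (G : sgraph) (vs : seq G) (E : seq (nat * nat)).
Hypothesis vs_uniq : uniq vs.
Hypothesis E_uniq : uniq E.
Hypothesis E_lt : {in E, forall p, (p.1 < p.2 < size vs)%N}.
Variable x0 : G.
Hypothesis E_adj : forall i j, (i < j < size vs)%N ->
  adj (nth x0 vs i) (nth x0 vs j) = ((i, j) \in E).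
Local Notation nE := #|edges G|.
Local Notation nV := #|G|.
Implicit Types (g : seq nat).

Definition local_weight g : 'X_{1..nV} :=
  [multinom nth 0%N g (index (enum_val j) vs) | j < nV].

Definition local_edge (p : nat * nat) := [set nth x0 vs p.1; nth x0 vs p.2].

Lemma size_decr_ends p g : p \in E -> size g = size vs -> size (decr_ends p g) = size vs.
Proof.
move=> /E_lt/andP[pp pv] sg; have pv1 := ltn_trans pp pv.
by rewrite !size_set_nth sg (maxn_idPr pv1) (maxn_idPr pv).
Qed.

Lemma nth_decr_ends p g i : p \in E -> nth 0%N (decr_ends p g) i = (nth 0 g i - ((i == p.1) + (i == p.2)))%N.
Proof.
move=> /E_lt/andP[pp _]; rewrite !nth_set_nth /= nth_set_nth /=.
have [->|_] := eqVneq i p.2; first by rewrite (gtn_eqF pp) subn1.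
by have [->|_] := eqVneq i p.1; rewrite ?subn1 ?subn0.
Qed.

Lemma sumn_local g : size g = size vs -> mdeg (local_weight g) = sumn g.
Proof.
move=> sg; rewrite mdegE (reindex (@enum_rank G)) /=; last first.
  by exists enum_val => v _; [exact: enum_rankK | exact: enum_valK].
rewrite (bigID (mem vs)) /= [X in (_ + X)%N]big1 ?addn0; last first.
  by move=> v nv; rewrite mnmE enum_rankK memNindex // nth_default // sg.
rewrite (eq_bigr (fun v => nth 0%N g (index v vs))); last first.
  by move=> v _; rewrite mnmE enum_rankK.
rewrite -(big_uniq _ vs_uniq) /= (big_nth x0) sumnE [RHS](big_nth 0%N) sg.
apply: eq_big_nat => i /andP[_ iv]; by rewrite index_uniq.
Qed.

Lemma local_weight_edge e p g : p \in E -> enum_val e = local_edge p -> size g = size vs ->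
  (ends e <= local_weight g)%MM = decr_ok p g /\
  (decr_ok p g -> (local_weight g - ends e)%MM = local_weight (decr_ends p g)).
Proof.
move=> pE eE sg; have /andP[pp pv] := E_lt pE; have pv1 := ltn_trans pp pv.
have endE (v : G) : ends e (enum_rank v) = ((index v vs == p.1) + (index v vs == p.2))%N.
  rewrite mnmE enum_rankK eE in_set2.
  have idx i : (i < size vs)%N -> (v == nth x0 vs i) = (index v vs == i).
    move=> iv; apply/eqP/eqP => [->|ei]; first by rewrite index_uniq.
    by rewrite -ei nth_index // -index_mem ei.
  rewrite !idx //; case: eqP => // ->; by rewrite (ltn_eqF pp).
split=> [|ok].
  apply/mnm_lepP/andP => [le|[p1 p2] j].
    split.
      have := le (enum_rank (nth x0 vs p.1)); rewrite endE mnmE enum_rankK index_uniq //.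
      by rewrite eqxx => /(leq_trans _) -> //; rewrite addn_gt0 ?orbT.
    have := le (enum_rank (nth x0 vs p.2)); rewrite endE mnmE enum_rankK index_uniq //.
    by rewrite eqxx => /(leq_trans _) -> //; rewrite addn_gt0 ?orbT.
  rewrite -(enum_valK j) endE mnmE enum_rankK.
  case: eqP => [->|_]; case: eqP => [e2|_] //; first by move: pp; rewrite e2 ltnn.
  by rewrite e2.
apply/mnmP=> j; rewrite mnmBE -(enum_valK j) endE !mnmE enum_rankK nth_decr_ends //.
Qed.

Definition edge_index p : option 'I_nE := [pick e | enum_val e == local_edge p].

Lemma edge_indexP p : p \in E ->
  exists2 e, edge_index p = Some e & enum_val e = local_edge p.
Proof.
move=> pE; have /andP[pp pv] := E_lt pE.
have pG : local_edge p \in edges G.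
  by apply: mem_edges; rewrite E_adj ?pp // -surjective_pairing.
rewrite /edge_index; case: pickP => [e /eqP eE|none]; first by exists e.
by have := none (enum_rank_in pG (local_edge p)); rewrite enum_rankK_in // eqxx.
Qed.

Lemma local_edge_inj p p' : p \in E -> p' \in E -> local_edge p = local_edge p' -> p = p'.
Proof.
move=> pE p'E e; have /andP[pp pv] := E_lt pE; have /andP[pp' pv'] := E_lt p'E.
have pv1 := ltn_trans pp pv; have pv1' := ltn_trans pp' pv'.
have : nth x0 vs p.1 \in local_edge p' by rewrite -e set21.
have : nth x0 vs p.2 \in local_edge p' by rewrite -e set22.
rewrite !in_set2 !nth_uniq // {e pE p'E pv pv' pv1 pv1'}.
case: p p' pp pp' => a b [a' b'] /= pp pp'.
by move=> /orP[] /eqP eb /orP[] /eqP ea; congr (_, _); lia.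
Qed.

Lemma mem_edge_index L e : {subset L <= E} ->
  e \in pmap edge_index L <-> exists2 p, p \in L & enum_val e = local_edge p.
Proof.
move=> LE; rewrite mem_pmap; split=> [/mapP[p pL pe]|[p pL eE]].
  have [e' e'E eE] := edge_indexP (LE _ pL).
  by exists p => //; move: pe; rewrite e'E => -[->].
apply/mapP; exists p => //; have [e' -> e'E] := edge_indexP (LE _ pL).
by congr Some; apply: enum_val_inj; rewrite e'E.
Qed.

Lemma edge_index_uniq L : {subset L <= E} -> uniq L -> uniq (pmap edge_index L).
Proof.
elim: L => //= p L IH LE /andP[pL uL].
have pE : p \in E by rewrite LE ?mem_head.
have {}LE : {subset L <= E} by move=> p' p'L; rewrite LE // inE p'L orbT.
have [e -> eE] := edge_indexP pE; rewrite /= IH // andbT.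
apply: contra pL => /(mem_edge_index _ LE)[p' p'L].
by rewrite eE => /(local_edge_inj pE (LE _ p'L)) ->.
Qed.

Lemma local_eulerE h L L2 g : {subset L <= E} -> size g = size vs ->
  (forall g', size g' = size vs -> euler (@ends G) h L2 (local_weight g') =
     if covers (sumn g') E g' then 1 else 0) ->
  euler (@ends G) h (pmap edge_index L ++ L2) (local_weight g) = local_euler E L g.
Proof.
move=> LE sg hL2; elim: L g sg LE => [|p L IH] g sg LE /=; first exact: hL2.
have pE : p \in E by rewrite LE ?mem_head.
have {}LE : {subset L <= E} by move=> p' p'L; rewrite LE // inE p'L orbT.
have [e -> eE] := edge_indexP pE.
have [le ge] := local_weight_edge pE eE sg.
rewrite /= IH // le; case: ifP => // ok.
by rewrite ge // IH // size_decr_ends.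
Qed.

Lemma euler_outside h L2 g : size g = size vs ->
  (forall e : 'I_nE, e \in L2 -> exists2 v, v \in enum_val e & v \notin vs) ->
  euler (@ends G) h L2 (local_weight g) = h (local_weight g).
Proof.
move=> sg; elim: L2 => //= e L2 IH out.
rewrite IH => [|e' e'L]; last by apply: out; rewrite inE e'L orbT.
have [v ve vv] := out e (mem_head _ _); case: ifP => [/mnm_lepP/(_ (enum_rank v))|_].
  by rewrite !mnmE enum_rankK ve memNindex // nth_default // sg.
by rewrite subr0.
Qed.

Lemma local_weight0 g : all (eq_op 0%N) g -> local_weight g = 0%MM.
Proof.
move=> /all_nthP g0; apply/mnmP=> j; rewrite mnmE mnm0E.
set i := index _ _; have [ig|ig] := ltnP i (size g); last by rewrite nth_default.
by apply/esym/eqP; apply: g0.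
Qed.

Lemma covers_sound fuel g : size g = size vs -> covers fuel E g ->
  exists m, weight (@ends G) m = local_weight g.
Proof.
elim: fuel g => [|fuel IH] g sg; rewrite coversE => /orP[/local_weight0 ->|] //;
  try by exists 0%MM; exact: weight0.
case/hasP => p pE /and3P[_ ok /IH]; rewrite size_decr_ends // => /(_ erefl)[m mE].
have [e _ eE] := edge_indexP pE.
have [le ge] := local_weight_edge pE eE sg.
exists (m + U_(e))%MM; rewrite weightD weight1 mE -ge // submK // le.
exact: ok.
Qed.

Lemma weight_list (t : seq 'I_nE) :
  weight (@ends G) (\sum_(e <- t) U_(e))%MM = (\sum_(e <- t) ends e)%MM.
Proof.
elim: t => [|e t IH]; first by rewrite !big_nil weight0.
by rewrite !big_cons weightD weight1 IH.
Qed.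

Lemma covers_complete t fuel g : size g = size vs -> (size t <= fuel)%N ->
  (\sum_(e <- t) ends e)%MM = local_weight g -> covers fuel E g.
Proof.
elim: fuel t g => [|fuel IH] t g sg.
  rewrite leqn0 size_eq0 => /eqP->; rewrite big_nil => g0; rewrite coversE orbF.
  apply/(all_nthP 0%N) => i; rewrite sg => iv.
  have /mnmP/(_ (enum_rank (nth x0 vs i))) := g0.
  by rewrite mnm0E mnmE enum_rankK index_uniq // => <-.
move=> st tE; rewrite coversE; case: allP => //= nz; pose i := find (fun a => a != 0)%N g.
have gi : has (fun a => a != 0)%N g.
  apply/hasPn => none; case: nz => a ag; have := none a ag; by rewrite negbK eq_sym.
have ig : (i < size vs)%N by rewrite -sg -has_find.
have gi0 : nth 0%N g i != 0%N by exact: (nth_find 0%N gi).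
pose v := nth x0 vs i.
have [e et ve] : exists2 e, e \in t & v \in enum_val e.
  apply: NNPP => none; case/eqP: gi0.
  have /mnmP/(_ (enum_rank v)) := tE.
  rewrite mnmE enum_rankK index_uniq // => <-; rewrite mnm_sumE big_seq big1 // => e et.
  by rewrite mnmE enum_rankK; case: (boolP (v \in _)) => // ve; case: none; exists e.
have le : (ends e <= local_weight g)%MM by rewrite -tE (big_rem e) //= lem_addr.
have in_vs u : u \in enum_val e -> u \in vs.
  move=> ue; apply: contraT => uv; have /mnm_lepP/(_ (enum_rank u)) := le.
  by rewrite !mnmE enum_rankK ue memNindex // nth_default // sg.
have [p pE eE] : exists2 p, p \in E & enum_val e = local_edge p.
  have [x [y [xy eE]]] := edgeP e.
  have /(nthP x0)[a av ax] : x \in vs by apply: in_vs; rewrite eE set21.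
  have /(nthP x0)[b bv bx] : y \in vs by apply: in_vs; rewrite eE set22.
  have [ab|ba|ab] := ltngtP a b.
  - by exists (a, b); rewrite -?E_adj ?ab // ?ax ?bx // /local_edge /= ax bx.
  - exists (b, a); last by rewrite /local_edge /= ax bx setUC.
    by rewrite -E_adj ?ba // ax bx adj_sym.
  by move: (adj_neq xy); rewrite -ax -bx ab eqxx.
have [leE ge] := local_weight_edge pE eE sg; rewrite leE in le.
apply/hasP; exists p => //; rewrite le /=; apply/andP; split.
  have /andP[pp pv] := E_lt pE; have pv1 := ltn_trans pp pv.
  move: ve; rewrite eE in_set2 /v !nth_uniq //.
  by rewrite eq_sym => /orP[->|]; rewrite // eq_sym => ->; rewrite orbT.
apply: (IH (rem e t)); rewrite ?size_decr_ends //.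
  by rewrite size_rem //; case: (t) st.
by rewrite -ge // -tE (big_rem e et) /= addmC addmK.
Qed.

(** An edge with an end outside vs divides no monomial whose weight is
    supported on vs, so the K-polynomial of the whole graph agrees there with
    that of the induced subgraph. *)
Theorem local_euler_sign (k : fieldType) q i g :
  has_linear_resolution k G q -> (0 < q)%N ->
  size g = size vs -> sumn g = (2 * (q + i))%N ->
  (-1) ^+ i * local_euler E E g <= 0.
Proof.
move=> lin q0 sg gi.
pose h gam : int := if excluded_middle_informative
  (exists m, weight (@ends G) m = gam) then 1 else 0.
have EE : {subset E <= E} by [].
pose inside (e : 'I_nE) := [forall v in enum_val e, v \in vs].
pose L1 := pmap edge_index E; pose L2 := [seq e <- enum 'I_nE | ~~ inside e].
have := @euler_sign k _ _ _ (@mdeg_ends G) _ q i h (L1 ++ L2) (local_weight g) q0 lin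
  (@toric_edge_idealE G k).
rewrite local_eulerE //; last first.
  move=> g' sg'; rewrite euler_outside //; last first.
    by move=> e; rewrite mem_filter => /andP[/forall_inPn[v ve vv] _]; exists v.
  rewrite /h; case: excluded_middle_informative => [[m mE]|none].
    have [t [tE st]] := mnm_list m.
    rewrite (@covers_complete t) //; last by rewrite -weight_list -tE.
    by rewrite st -sumn_local // -mE (mdeg_weight (@mdeg_ends G)) leq_pmull.
  by case: ifP => // /(covers_sound sg').
apply.
- by move=> m; rewrite /h; case: excluded_middle_informative => // -[]; exists m.
- by move=> gam none; rewrite /h; case: excluded_middle_informative => // -[m mE]; case: (none m mE).
- apply: uniq_perm; rewrite ?enum_uniq //.
    rewrite cat_uniq filter_uniq ?enum_uniq // edge_index_uniq // andbT /=.
    apply/hasPn => e; rewrite mem_filter => /andP[out _]; apply: contra out.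
    move/(mem_edge_index e EE) => -[p /E_lt/andP[pp pv] eE].
    apply/forall_inP => v; rewrite eE in_set2 => /orP[] /eqP->; rewrite mem_nth //.
    exact: ltn_trans pv.
  move=> e; rewrite mem_cat mem_filter mem_enum andbT.
  apply/orP; case: (boolP (inside e)) => [/forall_inP ins|]; [left|by right].
  apply/(mem_edge_index e EE).
  have [x [y [xy eE]]] := edgeP e.
  have /(nthP x0)[a av ax] : x \in vs by apply: ins; rewrite eE set21.
  have /(nthP x0)[b bv bx] : y \in vs by apply: ins; rewrite eE set22.
  have [ab|ba|ab] := ltngtP a b.
  - by exists (a, b); rewrite -?E_adj ?ab // ?ax ?bx // /local_edge /= ax bx.
  - exists (b, a); last by rewrite /local_edge /= ax bx setUC.
    by rewrite -E_adj ?ba // ax bx adj_sym.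
  by move: (adj_neq xy); rewrite -ax -bx ab eqxx.
by rewrite sumn_local.
Qed.

End LocalEuler.

(** * Induced subgraphs with a nonlinear syzygy *)

Section ForbiddenConfigurations.
Variables (k : fieldType) (G : sgraph) (side : G -> bool).
Hypothesis bip : forall x y : G, adj x y -> side x != side y.

Lemma same_side_adj (x y : G) : side x = side y -> adj x y = false.
Proof. by move=> e; apply/negP => /bip; rewrite e eqxx. Qed.

Lemma adj_side (x y : G) : adj x y -> side y = ~~ side x.
Proof. by move/bip; case: (side x) (side y) => [] []. Qed.

Lemma local_euler_absurd q i (vs : seq G) x0 E g :
  has_linear_resolution k G q -> (0 < q)%N -> uniq vs -> uniq E ->
  all (fun p => p.1 < p.2 < size vs)%N E -> size g = size vs ->
  (forall i j, (i < j < size vs)%N ->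
     adj (nth x0 vs i) (nth x0 vs j) = ((i, j) \in E)) ->
  sumn g = (2 * (q + i))%N ->
  local_euler E E g = (-1) ^+ i -> False.
Proof.
move=> lin q0 uvs uE /allP ltE sg adjE gi eE.
have := local_euler_sign uvs uE ltE adjE lin q0 sg gi.
by rewrite eE -exprMn mulrNN mulr1 expr1n.
Qed.

Definition hexagon_edges b0 b1 b2 : seq (nat * nat) :=
  [:: (0, 1); (1, 2); (2, 3); (3, 4); (4, 5); (0, 5)]%N ++
  (if b0 then [:: (0, 3)%N] else [::]) ++ (if b1 then [:: (1, 4)%N] else [::]) ++
  (if b2 then [:: (2, 5)%N] else [::]).

(** The ring of a hexagon with its chords is Gorenstein, so it has a last
    syzygy, whose degree 3 + b0 + b1 + b2 exceeds by 1 that of a linear one;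
    its weight has degree 2 at the ends of the chords and 1 at the other
    vertices. *)
Lemma no_hexagon (v0 v1 v2 v3 v4 v5 : G) :
  has_linear_resolution k G 2 -> uniq [:: v0; v1; v2; v3; v4; v5] ->
  adj v0 v1 -> adj v1 v2 -> adj v2 v3 -> adj v3 v4 -> adj v4 v5 -> adj v5 v0 ->
  False.
Proof.
move=> lin uv a01 a12 a23 a34 a45 a50.
have s1 := adj_side a01; have s2 := adj_side a12; have s3 := adj_side a23.
have s4 := adj_side a34; have s5 := adj_side a45.
rewrite s1 negbK in s2; rewrite s2 in s3; rewrite s3 negbK in s4; rewrite s4 in s5.
have a05 : adj v0 v5 by rewrite adj_sym.
have a02 : adj v0 v2 = false by apply: same_side_adj; rewrite s2.
have a04 : adj v0 v4 = false by apply: same_side_adj; rewrite s4.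
have a24 : adj v2 v4 = false by apply: same_side_adj; rewrite s2 s4.
have a13 : adj v1 v3 = false by apply: same_side_adj; rewrite s1 s3.
have a15 : adj v1 v5 = false by apply: same_side_adj; rewrite s1 s5.
have a35 : adj v3 v5 = false by apply: same_side_adj; rewrite s3 s5.
pose b0 := adj v0 v3; pose b1 := adj v1 v4; pose b2 := adj v2 v5.
pose c (b : bool) := if b then 2%N else 1%N.
apply: (@local_euler_absurd 2 (1 + b0 + b1 + b2) [:: v0; v1; v2; v3; v4; v5] v0
  (hexagon_edges b0 b1 b2) [:: c b0; c b1; c b2; c b0; c b1; c b2]) => //.
- by case: (b0); case: (b1); case: (b2).
- by case: (b0); case: (b1); case: (b2).
- move=> i j; rewrite -/b0 -/b1 -/b2.
  have E03 : adj v0 v3 = b0 by []. have E14 : adj v1 v4 = b1 by [].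
  have E25 : adj v2 v5 = b2 by [].
  move: (b0) (b1) (b2) E03 E14 E25 => d0 d1 d2 E03 E14 E25.
  move: i j => [|[|[|[|[|[|i]]]]]] [|[|[|[|[|[|j]]]]]] //=; rewrite ?andbF //= => _;
  rewrite ?(a01, a12, a23, a34, a45, a05, a02, a04, a24, a13, a15, a35, E03, E14, E25);
  by case: (d0); case: (d1); case: (d2).
- by rewrite /c; case: (b0); case: (b1); case: (b2).
by rewrite /c; case: (b0); case: (b1); case: (b2); vm_compute.
Qed.

Definition two_squares_edges b1 b3 : seq (nat * nat) :=
  [:: (0, 1); (1, 2); (2, 3); (0, 3); (4, 5); (5, 6); (6, 7); (4, 7)]%N ++
  (if b1 then [:: (0, 5)%N] else [::]) ++ (if b3 then [:: (0, 7)%N] else [::]).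

(** The Koszul relation between the binomials of the squares is a second syzygy
    of degree 4, at the weight 1 on all eight vertices; a linear one has degree
    3. *)
Lemma no_disjoint_squares (v0 v1 v2 v3 w0 w1 w2 w3 : G) :
  has_linear_resolution k G 2 -> uniq [:: v0; v1; v2; v3; w0; w1; w2; w3] ->
  adj v0 v1 -> adj v1 v2 -> adj v2 v3 -> adj v3 v0 ->
  adj w0 w1 -> adj w1 w2 -> adj w2 w3 -> adj w3 w0 ->
  side w0 = side v0 ->
  {in [:: v1; v2; v3] & [:: w0; w1; w2; w3], forall x y, adj x y = false} ->
  False.
Proof.
move=> lin uv a01 a12 a23 a30 c01 c12 c23 c30 s0 out.
have s1 := adj_side a01; have s2 := adj_side a12; have s3 := adj_side a23.
rewrite s1 negbK in s2; rewrite s2 in s3.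
have t1 := adj_side c01; have t2 := adj_side c12; have t3 := adj_side c23.
rewrite t1 negbK in t2; rewrite t2 in t3.
have a03 : adj v0 v3 by rewrite adj_sym.
have c03 : adj w0 w3 by rewrite adj_sym.
have a02 : adj v0 v2 = false by apply: same_side_adj; rewrite s2.
have a13 : adj v1 v3 = false by apply: same_side_adj; rewrite s1 s3.
have c02 : adj w0 w2 = false by apply: same_side_adj; rewrite t2.
have c13 : adj w1 w3 = false by apply: same_side_adj; rewrite t1 t3.
have d00 : adj v0 w0 = false by apply: same_side_adj; rewrite s0.
have d02 : adj v0 w2 = false by apply: same_side_adj; rewrite t2 s0.
pose b1 := adj v0 w1; pose b3 := adj v0 w3.
apply: (@local_euler_absurd 2 2 [:: v0; v1; v2; v3; w0; w1; w2; w3] v0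
  (two_squares_edges b1 b3) [:: 1; 1; 1; 1; 1; 1; 1; 1]%N) => //.
- by case: (b1); case: (b3).
- by case: (b1); case: (b3).
- move=> i j; have E1 : adj v0 w1 = b1 by []. have E3 : adj v0 w3 = b3 by [].
  move: (b1) (b3) E1 E3 => d1 d3 E1 E3.
  move: i j => [|[|[|[|[|[|[|[|i]]]]]]]] [|[|[|[|[|[|[|[|j]]]]]]]] //=; rewrite ?andbF //= => _;
  rewrite ?(a01, a12, a23, a03, c01, c12, c23, c03, a02, a13, c02, c13, d00, d02, E1, E3);
  rewrite ?out ?inE ?eqxx ?orbT //; by case: (d1); case: (d3).
by case: (b1); case: (b3); vm_compute.
Qed.

(** As for disjoint squares, with degree 2 at the shared vertex. *)
Lemma no_touching_squares (v0 v1 v2 v3 w1 w2 w3 : G) :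
  has_linear_resolution k G 2 -> uniq [:: v0; v1; v2; v3; w1; w2; w3] ->
  adj v0 v1 -> adj v1 v2 -> adj v2 v3 -> adj v3 v0 ->
  adj v0 w1 -> adj w1 w2 -> adj w2 w3 -> adj w3 v0 ->
  {in [:: v1; v2; v3] & [:: w1; w2; w3], forall x y, adj x y = false} ->
  False.
Proof.
move=> lin uv a01 a12 a23 a30 c01 c12 c23 c30 out.
have s1 := adj_side a01; have s2 := adj_side a12; have s3 := adj_side a23.
rewrite s1 negbK in s2; rewrite s2 in s3.
have t1 := adj_side c01; have t2 := adj_side c12; have t3 := adj_side c23.
rewrite t1 negbK in t2; rewrite t2 in t3.
have a03 : adj v0 v3 by rewrite adj_sym.
have c03 : adj v0 w3 by rewrite adj_sym.
have a02 : adj v0 v2 = false by apply: same_side_adj; rewrite s2.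
have a13 : adj v1 v3 = false by apply: same_side_adj; rewrite s1 s3.
have c02 : adj v0 w2 = false by apply: same_side_adj; rewrite t2.
have c13 : adj w1 w3 = false by apply: same_side_adj; rewrite t1 t3.
apply: (@local_euler_absurd 2 2 [:: v0; v1; v2; v3; w1; w2; w3] v0
  [:: (0, 1); (1, 2); (2, 3); (0, 3); (0, 4); (4, 5); (5, 6); (0, 6)]%N
  [:: 2; 1; 1; 1; 1; 1; 1]%N) => //.
move=> i j.
move: i j => [|[|[|[|[|[|[|i]]]]]]] [|[|[|[|[|[|[|j]]]]]]] //=; rewrite ?andbF //= => _;
rewrite ?(a01, a12, a23, a03, c01, c12, c23, c03, a02, a13, c02, c13) //;
by rewrite ?out ?inE ?eqxx ?orbT.
Qed.

(** Let three paths of length 3 with edges a, b, c join the same two vertices.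
    The three hexagons give the 2-minors of the matrix with columns (a c, b),
    whose two syzygies have degrees 4 and 5; the weight is that of the second
    one, 2 at the common ends v2 and v5 and 1 elsewhere. *)
Lemma no_theta (v0 v1 v2 v3 v4 v5 v6 v7 : G) :
  has_linear_resolution k G 3 -> uniq [:: v0; v1; v2; v3; v4; v5; v6; v7] ->
  adj v0 v1 -> adj v1 v2 -> adj v2 v3 -> adj v3 v4 -> adj v4 v5 -> adj v5 v0 ->
  adj v5 v6 -> adj v6 v7 -> adj v7 v2 ->
  adj v0 v3 = false -> adj v0 v7 = false -> adj v1 v4 = false ->
  adj v1 v6 = false -> adj v2 v5 = false -> adj v3 v6 = false ->
  adj v4 v7 = false -> False.
Proof.
move=> lin uv a01 a12 a23 a34 a45 a50 a56 a67 a72 n03 n07 n14 n16 n25 n36 n47.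
have s1 := adj_side a01; have s2 := adj_side a12; have s3 := adj_side a23.
have s4 := adj_side a34; have s5 := adj_side a45; have s6 := adj_side a56.
have s7 := adj_side a67.
rewrite s1 negbK in s2; rewrite s2 in s3; rewrite s3 negbK in s4; rewrite s4 in s5.
rewrite s5 negbK in s6; rewrite s6 in s7.
have a05 : adj v0 v5 by rewrite adj_sym.
have a27 : adj v2 v7 by rewrite adj_sym.
have same x y := @same_side_adj x y.
apply: (@local_euler_absurd 3 2 [:: v0; v1; v2; v3; v4; v5; v6; v7] v0
  [:: (0, 1); (1, 2); (2, 3); (3, 4); (4, 5); (0, 5); (2, 7); (6, 7); (5, 6)]%N
  [:: 1; 1; 2; 1; 1; 2; 1; 1]%N) => //.
move=> i j.
move: i j => [|[|[|[|[|[|[|[|i]]]]]]]] [|[|[|[|[|[|[|[|j]]]]]]]] //=; rewrite ?andbF //= => _;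
rewrite ?(a01, a12, a23, a34, a45, a05, a56, a67, a27, n03, n07, n14, n16, n25, n36, n47) //;
by rewrite same // ?s1 ?s2 ?s3 ?s4 ?s5 ?s6 ?s7.
Qed.

End ForbiddenConfigurations.

(** * Monomials of a bipartite graph as lists of oriented edges *)

Section OrientedLists.
Variables (G : sgraph) (side : G -> bool).
Hypothesis bip : forall x y : G, adj x y -> side x != side y.
Local Notation nE := #|edges G|.
Local Notation nV := #|G|.
Local Notation weight := (weight (@ends G)).
Implicit Types (t u : seq (G * G)).

Definition edge_mnm (p : G * G) : 'X_{1..nE} :=
  [multinom nat_of_bool (enum_val i == [set p.1; p.2]) | i < nE].

Definition list_mnm t : 'X_{1..nE} := (\sum_(p <- t) edge_mnm p)%MM.

(** Pairs listing first the end on the side of side, so that an edge has a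
    single representation and a weight splits into the multisets of first and
    of second components. *)
Definition oriented t := all (fun p => adj p.1 p.2 && side p.1) t.

Lemma edge_mnmU p (i : 'I_nE) : enum_val i = [set p.1; p.2] -> edge_mnm p = U_(i)%MM.
Proof.
move=> e; apply/mnmP=> j; rewrite mnmE mnm1E -e (inj_eq enum_val_inj).
by rewrite eq_sym.
Qed.

Lemma edge_mnm_ex (x y : G) : adj x y ->
  exists2 i : 'I_nE, enum_val i = [set x; y] & edge_mnm (x, y) = U_(i)%MM.
Proof.
move=> xy; have e := mem_edges xy; exists (enum_rank_in e [set x; y]).
  by rewrite enum_rankK_in.
by apply: edge_mnmU; rewrite enum_rankK_in.
Qed.

Lemma weight_edge_mnm p v : adj p.1 p.2 ->
  weight (edge_mnm p) (enum_rank v) = ((v == p.1) + (v == p.2))%N.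
Proof.
case: p => x y /= xy; have [i e ->] := edge_mnm_ex xy.
rewrite weight1 mnmE enum_rankK e in_set2.
by case: eqP => [->|_] //; rewrite (negPf (adj_neq xy)).
Qed.

Lemma list_mnm_weight t v : oriented t ->
  weight (list_mnm t) (enum_rank v) = (count_mem v (unzip1 t) + count_mem v (unzip2 t))%N.
Proof.
elim: t => [|p t IH] /=; first by rewrite /list_mnm big_nil weight0 mnm0E.
case/andP=> /andP[ap _] /IH; rewrite /list_mnm big_cons weightD mnmDE => ->.
by rewrite weight_edge_mnm // ![_ == v]eq_sym addnACA.
Qed.

Lemma oriented1 t v : oriented t -> side v = false -> count_mem v (unzip1 t) = 0%N.
Proof.
move=> ot sv; apply/count_memPn/negP => /mapP[p /(allP ot)/andP[_ sp] vp].
by rewrite vp sp in sv.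
Qed.

Lemma oriented2 t v : oriented t -> side v -> count_mem v (unzip2 t) = 0%N.
Proof.
move=> ot sv; apply/count_memPn/negP => /mapP[p /(allP ot)/andP[/bip + sp] vp].
by rewrite sp -vp sv eqxx.
Qed.

Definition same_fibre t t' := perm_eq (unzip1 t) (unzip1 t') && perm_eq (unzip2 t) (unzip2 t').

Lemma same_fibreP t t' : oriented t -> oriented t' ->
  (weight (list_mnm t) = weight (list_mnm t')) <-> same_fibre t t'.
Proof.
move=> ot ot'; split=> [/mnmP e|/andP[/permP p1 /permP p2]].
  apply/andP; split; apply/allP => v _; apply/eqP; have := e (enum_rank v);
    rewrite !list_mnm_weight //; have [sv|/negbTE sv] := boolP (side v);
    rewrite ?(oriented1 _ sv) ?(oriented2 _ sv) // ?addn0 //.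
apply/mnmP=> j; rewrite -(enum_valK j) !list_mnm_weight //.
by rewrite p1 p2.
Qed.

Lemma list_mnm_perm t t' : perm_eq t t' -> list_mnm t = list_mnm t'.
Proof. exact: perm_big. Qed.

Lemma list_mnm_cat t t' : list_mnm (t ++ t') = (list_mnm t + list_mnm t')%MM.
Proof. exact: big_cat. Qed.

Lemma oriented_edge_inj p p' : oriented [:: p; p'] ->
  [set p.1; p.2] = [set p'.1; p'.2] -> p = p'.
Proof.
case: p p' => a b [a' b'] /= /and3P[/andP[ab sa] /andP[ab' sa'] _] e.
have := set21 a b; have := set22 a b; rewrite e !in_set2.
have sb := bip ab; have sb' := bip ab'; rewrite sa sa' in sb sb'.
case/orP=> /eqP eb; first by move: sb; rewrite eb sa'.
by case/orP=> /eqP ea; [rewrite ea eb | move: sb'; rewrite -ea sa].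
Qed.

Lemma list_mnmE t p (i : 'I_nE) : oriented (p :: t) ->
  enum_val i = [set p.1; p.2] -> list_mnm t i = count_mem p t.
Proof.
move=> + e; elim: t => [|p' t IH]; first by rewrite /list_mnm big_nil mnm0E.
move=> /and3P[op op' ot]; rewrite /list_mnm big_cons mnmDE /= -/(list_mnm t) IH //=.
  congr (_ + _)%N; rewrite mnmE e; congr nat_of_bool.
  apply/eqP/eqP => [/oriented_edge_inj->//|->//]; by rewrite /oriented /= op op'.
by rewrite op.
Qed.

Lemma list_mnm_inj t t' : oriented t -> oriented t' ->
  list_mnm t = list_mnm t' -> perm_eq t t'.
Proof.
move=> ot ot' e; apply/allP => p pt; apply/eqP.
have op : adj p.1 p.2 && side p.1.
  by move: pt; rewrite mem_cat => /orP[/(allP ot)|/(allP ot')].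
have [i ei _] := edge_mnm_ex (andP op).1.
by rewrite -!(list_mnmE (i := i)) ?e //= op.
Qed.

Lemma list_mnm_ex (m : 'X_{1..nE}) : exists2 t, oriented t & m = list_mnm t /\ size t = mdeg m.
Proof.
have [s [-> _]] := mnm_list m; elim: s => [|i s [t ot [IH st]]].
  by exists [::] => //; rewrite /list_mnm !big_nil mdeg0.
have [x [y [xy e]]] := edgeP i.
wlog sx : x y xy e / side x.
  move=> W; have [|sx] := boolP (side x); first exact: (W x y).
  apply: (W y x); rewrite 1?adj_sym // 1?setUC //.
  by have := bip xy; rewrite (negPf sx); case: (side y).
exists ((x, y) :: t); first by rewrite /= xy sx.
rewrite !big_cons /list_mnm big_cons -/(list_mnm t) -IH (edge_mnmU (p := (x, y)) e).
by split; rewrite // mdegD mdeg1 /= st.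
Qed.

Lemma fibre_size t t' : same_fibre t t' -> size t = size t'.
Proof. by case/andP=> /perm_size; rewrite !size_map. Qed.

(** Generation in degree q, for monomials: every binomial of the ideal involves
    a multiple of a degree q monomial that is not alone in its fibre. *)
Lemma fibre_generated (k : fieldType) q t t' : (0 < q)%N ->
  has_linear_resolution k G q -> oriented t -> oriented t' -> same_fibre t t' ->
  ~~ perm_eq t t' ->
  exists u r u', [/\ perm_eq t (u ++ r), oriented u', size u = q, same_fibre u u' & ~~ perm_eq u u'].
Proof.
move=> q0 lin ot ot' ftt' ntt'.
have [r [g [hg gE _]]] := linres_of_linear_resolution q0 lin.
pose f : {mpoly k[nE]} := 'X_[list_mnm t] - 'X_[list_mnm t'].
have fJ : f \in @toric_edge_ideal k G.
  apply/toric_edge_idealE; rewrite rmorphB /= !monomial_mapX.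
  by rewrite (same_fibreP ot ot').2 // subrr.
have [w /matrixP/(_ 0 0)] := (gE f).1 fJ; rewrite !mxE eqxx mulr1n => fE.
have nm : list_mnm t != list_mnm t'.
  by apply: contraNneq ntt' => /(list_mnm_inj ot ot').
have tf : list_mnm t \in msupp f.
  by rewrite mcoeff_msupp mcoeffB !mcoeffX eqxx [list_mnm t' == _]eq_sym (negPf nm) subr0 oner_eq0.
have [c cs] : exists c, list_mnm t \in msupp (w 0 c * g c 0).
  apply: NNPP => none; move: tf; rewrite mcoeff_msupp fE raddf_sum big1 ?eqxx // => c _.
  by apply/eqP; rewrite mcoeff_eq0; apply/negP => cs; case: none; exists c.
have /allpairsP[[m1 m2] /= [_ m2g tE]] := msuppM_le cs.
have gJ : monomial_map (@ends G) (g c 0) = 0.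
  apply/toric_edge_idealE/gE; exists (delta_mx 0 c); rewrite -rowE.
  by apply/matrixP=> i j; rewrite !ord1 !mxE eqxx.
have [m2' [_ ne w2]] := monomial_ker_partner gJ m2g.
have dm2 : mdeg m2 = q by exact: dhomog_mf (hg c 0) _ m2g.
have [r1 or1 [m1E _]] := list_mnm_ex m1.
have [u ou [m2E su]] := list_mnm_ex m2.
have [u' ou' [m2'E _]] := list_mnm_ex m2'.
exists u, r1, u'; split=> //.
- apply: list_mnm_inj => //; first by rewrite /oriented all_cat; apply/andP.
  by rewrite list_mnm_cat -m1E -m2E addmC.
- by rewrite su.
- by apply/(same_fibreP ou ou'); rewrite -m2E -m2'E.
- by apply: contraNN ne => /list_mnm_perm; rewrite -m2E -m2'E => ->.
Qed.

(** No binomial of the ideal has degree below that of its generators. *)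
Lemma fibre_min (k : fieldType) q t t' : (0 < q)%N ->
  has_linear_resolution k G q -> oriented t -> oriented t' -> same_fibre t t' ->
  ~~ perm_eq t t' -> (q <= size t)%N.
Proof.
move=> q0 lin ot ot' ftt' ntt'.
have [u [r [u' [/perm_size-> _ <- _ _]]]] := fibre_generated q0 lin ot ot' ftt' ntt'.
by rewrite size_cat leq_addr.
Qed.

Fixpoint pairs (s : seq G) : seq (G * G) :=
  if s is a :: b :: s' then (a, b) :: pairs s' else [::].

(** The other perfect matching of a cycle: pairs takes the edges number 1, 3,
    5, ..., and this one, applied to the tail of the cycle with z its first
    vertex, takes the edges 2, 4, 6, ... turned around. *)
Fixpoint shifted_pairs z (s : seq G) : seq (G * G) :=
  if s is b :: s1 then
    if s1 is a :: s' then (a, b) :: shifted_pairs z s' else [:: (z, b)]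
  else [::].

Lemma path_side x s : path (@adj G) x s -> side (last x s) = side x (+) odd (size s).
Proof.
elim: s x => [|y s IH] x /=; first by rewrite addbF.
case/andP=> /bip xy /IH ->; move: xy.
by case: (side x) (side y) => [] [] //=; case: (odd _).
Qed.

Lemma cycle_even c : cycle (@adj G) c -> ~~ odd (size c).
Proof.
case: c => // x s; rewrite /cycle => /path_side; rewrite last_rcons size_rcons /=.
by case: (side x) (odd _) => [] [].
Qed.

Lemma seq2_ind (P : seq G -> Prop) :
  P [::] -> (forall x, P [:: x]) -> (forall x y s, P s -> P (x :: y :: s)) -> forall s, P s.
Proof.
move=> P0 P1 P2 s; suff [] : P s /\ (forall x, P (x :: s)) by [].
by elim: s => [|y s [IH1 IH2]]; split=> // x; apply: P2.
Qed.

Lemma pairs_oriented x s : side x -> path (@adj G) x s -> oriented (pairs (x :: s)).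
Proof.
elim/seq2_ind: s x => [|y|y z s IH] x sx //=.
  by rewrite andbT => ->; rewrite sx.
case/and3P=> xy yz pz; rewrite xy sx; apply: IH => //.
by move: (bip xy) (bip yz); rewrite sx; case: (side y) (side z) => [] [].
Qed.

Lemma shifted_pairs_oriented z y s : side z -> ~~ side y -> ~~ odd (size s) ->
  path (@adj G) y (rcons s z) -> oriented (shifted_pairs z (y :: s)).
Proof.
elim/seq2_ind: s y => [|x|x x' s IH] y sz sy //=.
  by rewrite andbT adj_sym => _ ->; rewrite sz.
rewrite negbK => os /and3P[yx xx' pz].
have sx : side x by move: (bip yx); rewrite (negPf sy); case: (side x).
have sx' : ~~ side x' by move: (bip xx'); rewrite sx; case: (side x').
by rewrite adj_sym yx sx; apply: IH.
Qed.

Lemma pairs_shifted2 x z s : odd (size s) -> unzip2 (shifted_pairs z s) = unzip2 (pairs (x :: s)).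
Proof.
elim/seq2_ind: s x => [|y|y y' s IH] x //=; rewrite negbK => os.
by congr (_ :: _); apply: IH.
Qed.

Lemma pairs_shifted1 x z s : odd (size s) ->
  x :: unzip1 (shifted_pairs z s) = rcons (unzip1 (pairs (x :: s))) z.
Proof.
elim/seq2_ind: s x => [|y|y y' s IH] x //=; rewrite negbK => os.
by congr (_ :: _); apply: IH.
Qed.

Lemma pairs_same_fibre x s : odd (size s) ->
  same_fibre (pairs (x :: s)) (shifted_pairs x s).
Proof.
move=> os; rewrite /same_fibre (pairs_shifted2 x) // perm_refl andbT.
rewrite -(perm_cons x) (pairs_shifted1 x) // perm_sym perm_rcons.
exact: perm_refl.
Qed.

Lemma size_pairs s : size (pairs s) = (size s)./2.
Proof. by elim/seq2_ind: s => //= x y s ->. Qed.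

Lemma mem_shifted_pairs z s p : p \in shifted_pairs z s -> p.2 \in s.
Proof.
elim/seq2_ind: s => [|y|y y' s IH] //=; rewrite !inE.
  by move/eqP->.
by case/orP=> [/eqP->|/IH ->]; rewrite ?eqxx ?orbT.
Qed.

(** The two perfect matchings of an even cycle of length at least 4 have the
    same vertices and are different. *)
Lemma cycle_same_fibre x s : ucycle (@adj G) (x :: s) -> (1 < size s)%N -> side x ->
  exists t', [/\ oriented (pairs (x :: s)), oriented t', same_fibre (pairs (x :: s)) t'
    & ~~ perm_eq (pairs (x :: s)) t'].
Proof.
case/andP=> cs us ss sx; have := cycle_even cs; rewrite /= negbK => os.
exists (shifted_pairs x s); split.
- by apply: pairs_oriented => //; move: cs; rewrite /cycle rcons_path => /andP[].
- case: s cs us ss os => // y s /= /andP[xy py] _ _ os.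
  apply: shifted_pairs_oriented => //.
  by move: (bip xy); rewrite sx; case: (side y).
- exact: pairs_same_fibre.
case: s us ss os {cs} => [|y [|z s]] //= us _ os.
apply/negP => /perm_mem/(_ (x, y)); rewrite !inE eqxx /=.
case/esym/orP=> [/eqP[xz]|/mem_shifted_pairs /=].
  by move: us; rewrite xz !inE eqxx !orbT.
by move=> yws; move: us; rewrite !inE yws !orbT /= andbF.
Qed.

End OrientedLists.

(** * Cycles when the resolution is 2-linear *)

Section LongCycles.
Variables (k : fieldType) (G : sgraph) (side : G -> bool).
Hypothesis bip : forall x y : G, adj x y -> side x != side y.
Hypothesis lin : has_linear_resolution k G 2.

Lemma perm_eq2 (T : eqType) (a b c e : T) : perm_eq [:: a; b] [:: c; e] ->
  (a = c /\ b = e) \/ (a = e /\ b = c).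
Proof.
move=> pe; have : a \in [:: c; e] by rewrite -(perm_mem pe) mem_head.
rewrite !inE => /orP[] /eqP ae; [left|right]; split=> //; move: pe; rewrite ae.
  by rewrite perm_cons => /perm_mem/(_ b); rewrite !inE eqxx => /esym/eqP.
move=> pe; have : perm_eq [:: e; b] [:: e; c].
  by apply: (perm_trans pe); apply/permP=> P /=; lia.
by rewrite perm_cons => /perm_mem/(_ b); rewrite !inE eqxx => /esym/eqP.
Qed.

Lemma uniq_part (T : eqType) (X Y c : seq T) : perm_eq (X ++ Y) c -> uniq c -> uniq X.
Proof. by move/perm_uniq => <-; rewrite cat_uniq => /andP[]. Qed.

Lemma pairs_cat (s1 s2 : seq G) : ~~ odd (size s1) -> pairs (s1 ++ s2) = pairs s1 ++ pairs s2.
Proof.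
elim/seq2_ind: s1 => [|x|x y s IH] //=; rewrite negbK => os.
by rewrite IH.
Qed.

Lemma mem_pairs p (c : seq G) : p \in pairs c ->
  exists s1 s2, c = s1 ++ p.1 :: p.2 :: s2 /\ ~~ odd (size s1).
Proof.
elim/seq2_ind: c => [|x|x y s IH] //=; rewrite inE => /orP[/eqP->|/IH].
  by exists [::], s.
by case=> s1 [s2 [-> os]]; exists (x :: y :: s1), s2; rewrite /= negbK.
Qed.

Lemma mem_pairs1 p (c : seq G) : p \in pairs c -> p.1 \in c.
Proof. by move/mem_pairs=> [s1 [s2 [-> _]]]; rewrite mem_cat inE eqxx orbT. Qed.

Lemma uniq_pairs (c : seq G) : uniq c -> uniq (pairs c).
Proof.
elim/seq2_ind: c => [|x|x y s IH] //= /and3P[xs ys /IH ->]; rewrite andbT.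
by apply: contra xs => /mem_pairs1 /= xs; rewrite inE xs orbT.
Qed.

Lemma split_pairs p p' (c : seq G) : ucycle (@adj G) c -> p != p' ->
  p \in pairs c -> p' \in pairs c -> exists z1 z2,
  ucycle (@adj G) (p.1 :: p.2 :: z1 ++ p'.1 :: p'.2 :: z2) /\
  size c = (size z1 + size z2 + 4)%N.
Proof.
move=> uc ne /mem_pairs[s1 [s2 [cE os1]]].
rewrite cE pairs_cat //= -surjective_pairing mem_cat inE [p' == p]eq_sym (negPf ne) /= => p'c.
have uc' : ucycle (@adj G) (p.1 :: p.2 :: s2 ++ s1).
  by rewrite -[_ :: _]/((p.1 :: p.2 :: s2) ++ s1) -rot_size_cat rot_ucycle -cE.
have sc : size c = (size s1 + size s2 + 2)%N by rewrite cE size_cat /= ; lia.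
case/orP: p'c => /mem_pairs[s3 [s4 [sE _]]].
  exists (s2 ++ s3), s4; move: uc'; rewrite sE catA; split=> //.
  by rewrite !size_cat /= ?size_cat /=; lia.
exists s3, (s4 ++ s1); move: uc'; rewrite sE -catA; split=> //.
by rewrite !size_cat /= ?size_cat /=; lia.
Qed.

Lemma cycle_on_side (c : seq G) : ucycle (@adj G) c -> (1 < size c)%N ->
  exists x s, [/\ ucycle (@adj G) (x :: s), size c = (size s).+1, side x
    & perm_eq (x :: s) c].
Proof.
case: c => [|x [|y s]] // uc _; have [sx|sx] := boolP (side x).
  by exists x, (y :: s).
exists y, (rcons s x); split.
- by rewrite -rcons_cons -rot1_cons rot_ucycle.
- by rewrite size_rcons.
- by case/andP: uc => /= /andP[/bip xy _] _; move: xy; rewrite (negPf sx); case: (side y).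
by rewrite -rcons_cons -rot1_cons perm_rot.
Qed.

Lemma split_cycle a b a' b' (z1 z2 : seq G) :
  ucycle (@adj G) (a :: b :: z1 ++ a' :: b' :: z2) -> adj a b' -> adj a' b ->
  [/\ ucycle (@adj G) (b :: rcons z1 a'), ucycle (@adj G) (b' :: rcons z2 a),
      ucycle (@adj G) (a :: b :: z1 ++ [:: a'; b'])
    & ucycle (@adj G) (a' :: b' :: z2 ++ [:: a; b])].
Proof.
case/andP=> cz uz ab' a'b.
move: cz; rewrite /= rcons_cat /= cat_path /= rcons_path.
case/and5P=> ab pz1 zb a'b' /andP[pz2 zz].
have part X Y : perm_eq (X ++ Y) (a :: b :: z1 ++ a' :: b' :: z2) -> uniq X.
  by move=> pXY; apply: uniq_part pXY uz.
split; apply/andP; split.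
- by rewrite /cycle /= !rcons_path last_rcons pz1 zb.
- apply: (part _ (a :: b' :: z2)); clear; apply/permP=> P.
  by rewrite /= -cats1 !count_cat /= ?count_cat /=; lia.
- by rewrite /cycle /= !rcons_path last_rcons pz2 zz.
- apply: (part _ (b :: z1 ++ [:: a'])); clear; apply/permP=> P.
  by rewrite /= -cats1 !count_cat /= ?count_cat /=; lia.
- by rewrite /cycle /= rcons_path cat_path last_cat /= ab pz1 zb a'b' adj_sym ab'.
- apply: (part _ z2); clear; apply/permP=> P.
  by rewrite /= !count_cat /= ?count_cat /=; lia.
- by rewrite /cycle /= rcons_path cat_path last_cat /= a'b' pz2 zz ab adj_sym a'b.
apply: (part _ z1); clear; apply/permP=> P.
by rewrite /= !count_cat /= ?count_cat /=; lia.
Qed.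

(** Two lists of two edges in the same fibre that differ are the two matchings
    of a square. *)
Lemma swap_adj (p p' f f' : G * G) : oriented side [:: f; f'] ->
  same_fibre [:: p; p'] [:: f; f'] -> ~~ perm_eq [:: p; p'] [:: f; f'] ->
  [/\ adj p.1 p'.2, adj p'.1 p.2, p.1 != p'.1 & p.2 != p'.2].
Proof.
case: p p' f f' => [a b] [a' b'] [x y] [x' y'] /and3P[/andP[/= xy _] /andP[/= x'y' _] _].
case/andP=> /= /perm_eq2 e1 /perm_eq2 e2 np.
have swap (T : eqType) (z w : T) : perm_eq [:: z; w] [:: w; z].
  by clear; apply/permP=> P /=; lia.
case: e1 e2 => [] [/= ? ?] [] [/= ? ?]; subst => //; try by rewrite ?perm_refl ?swap in np.
  split=> //; apply: contraNneq np => e.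
    by rewrite e swap.
  by rewrite e perm_refl.
split=> //; apply: contraNneq np => e.
  by rewrite e perm_refl.
by rewrite e swap.
Qed.

(** A quadric move on a cycle of length at least 8 exchanges two of its edges
    for two chords; these cut out shorter cycles, one of length at least 6. *)
Lemma no_long_cycle (c : seq G) : ucycle (@adj G) c -> (5 < size c)%N -> False.
Proof.
have [N] := ubnP (size c); elim: N c => // N IH c; rewrite ltnS => cN uc c6.
have [|x [s [uxs cE sx _]]] := cycle_on_side uc; first exact: leq_trans c6.
have xs6 : (5 < (size s).+1)%N by rewrite -cE.
rewrite cE in cN; clear c uc c6 cE.
have [s6|s6] := eqVneq (size s) 5.
  case: s s6 uxs {cN xs6} => [|v1 [|v2 [|v3 [|v4 [|v5 [|]]]]]] // _ /andP[/= cy us].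
  by case/and5P: cy => a b c' d /and3P[e f _]; apply: (no_hexagon bip lin us).
have os : odd (size s) by case/andP: uxs => /cycle_even; rewrite /= => /(_ _ bip); rewrite negbK.
have s8 : (6 < size s)%N by move: xs6 s6 os; case: (size s) => [|[|[|[|[|[|[|]]]]]]].
have [|t' [ot ot' ftt' ntt']] := cycle_same_fibre bip uxs _ sx; first exact: leq_trans s8.
have [u [r [u' [pu ou' su fuu' nuu']]]] := fibre_generated bip (isT : (0 < 2)%N) lin ot ot' ftt' ntt'.
have su' : size u' = 2%N by rewrite -(fibre_size fuu').
case: u su pu fuu' nuu' => [|p [|p' []]] // _ pu fuu' nuu'.
case: u' su' ou' fuu' nuu' => [|f [|f' []]] // _ /and3P[af af' _] fuu' nuu'.
have ut : uniq (p :: p' :: r).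
  by rewrite -(perm_uniq pu) uniq_pairs //; case/andP: uxs.
have pc : p \in pairs (x :: s) by rewrite (perm_mem pu) mem_head.
have p'c : p' \in pairs (x :: s) by rewrite (perm_mem pu) !inE eqxx orbT.
have pp' : p != p' by apply: contraTneq ut => ->; rewrite /= inE eqxx.
have [adj1 adj2 _ _] := swap_adj (introT and3P (And3 af af' isT)) fuu' nuu'.
have [z1 [z2 [uz sz]]] := split_pairs uxs pp' pc p'c.
move: uz sz adj1 adj2; move: (p.1) (p.2) (p'.1) (p'.2) => a b a' b' uz sz ab' a'b.
have [C1 C2 C3 C4] := split_cycle uz ab' a'b.
have sN : (size z1 + size z2 + 4 <= N)%N by rewrite /= in sz; rewrite -sz; exact: cN.
have s4 : (4 <= size z1 + size z2)%N by move: s8 sz; clear; rewrite /=; lia.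
clear -sN s4 C1 C2 C3 C4 IH.
have [z2_0|z2_0] := posnP (size z2).
  by apply: (IH _ _ C1); rewrite /= size_rcons; move: sN s4 z2_0; clear; move: (size z1) (size z2) => n1 n2; lia.
have [z1_0|z1_0] := posnP (size z1).
  by apply: (IH _ _ C2); rewrite /= size_rcons; move: sN s4 z1_0; clear; move: (size z1) (size z2) => n1 n2; lia.
have [z1_1|z1_1] := leqP (size z1) 1.
  by apply: (IH _ _ C4); rewrite /= size_cat /=; move: sN s4 z1_0 z1_1; clear; move: (size z1) (size z2) => n1 n2; lia.
by apply: (IH _ _ C3); rewrite /= size_cat /=; move: sN s4 z2_0 z1_1; clear; move: (size z1) (size z2) => n1 n2; lia.
Qed.

End LongCycles.

(** * Disjoint squares when the resolution is 2-linear *)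

Section Squares.
Variables (k : fieldType) (G : sgraph) (side : G -> bool).
Hypothesis bip : forall x y : G, adj x y -> side x != side y.
Hypothesis lin : has_linear_resolution k G 2.

Definition square (a b c e : G) :=
  [&& uniq [:: a; b; c; e], adj a b, adj b c, adj c e & adj e a].

Lemma square_rot a b c e : square a b c e -> square b c e a.
Proof.
case/and5P=> u ab bc ce ea; apply/and5P; split=> //.
by rewrite -(rot_uniq 1) in u.
Qed.

Lemma square_at a b c e x : square a b c e -> x \in [:: a; b; c; e] ->
  exists b' c' e', square x b' c' e' /\ perm_eq [:: x; b'; c'; e'] [:: a; b; c; e].
Proof.
move=> s; have s1 := square_rot s; have s2 := square_rot s1; have s3 := square_rot s2.
rewrite !inE => /or4P[] /eqP->.
- by exists b, c, e.
- by exists c, e, a; split=> //; apply/permP=> P /=; lia.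
- by exists e, a, b; split=> //; apply/permP=> P /=; lia.
by exists a, b, c; split=> //; apply/permP=> P /=; lia.
Qed.

Lemma square_path a b c e x x' : square a b c e ->
  x \in [:: a; b; c; e] -> x' \in [:: a; b; c; e] -> x != x' ->
  exists s, [/\ path (@adj G) x s, last x s = x', uniq (x :: s),
    {subset x :: s <= [:: a; b; c; e]} & (1 < size s)%N].
Proof.
move=> sq xc x'c ne; have [y [z [w [sq' pe]]]] := square_at sq xc.
move: x'c; rewrite -(perm_mem pe) !inE eq_sym (negPf ne) /=.
have sub s : {subset s <= [:: x; y; z; w]} -> {subset s <= [:: a; b; c; e]}.
  by move=> ss v /ss; rewrite (perm_mem pe).
case/and5P: sq' => /= /and4P[xyzw yzw zw _] xy yz zw' wx.
move: xyzw yzw zw; rewrite !inE !negb_or => /and3P[nxy nxz nxw] /andP[nyz nyw] nzw.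
case/or3P=> /eqP->.
- exists [:: w; z; y]; split=> //=; first by rewrite (adj_sym x w) (adj_sym w z) (adj_sym z y) wx zw' yz.
    by rewrite !inE !negb_or nxw nxz nxy (eq_sym w z) (eq_sym w y) (eq_sym z y) nzw nyw nyz.
  by apply: sub => v; rewrite !inE => /or4P[] ->; rewrite ?orbT.
- exists [:: y; z]; split=> //=; first by rewrite xy yz.
    by rewrite !inE !negb_or nxy nxz nyz.
  by apply: sub => v; rewrite !inE => /or3P[] ->; rewrite ?orbT.
exists [:: y; z; w]; split=> //=; first by rewrite xy yz zw'.
  by rewrite !inE !negb_or nxy nxz nxw nyz nyw nzw.
exact: sub.
Qed.

(** Two edges with distinct ends in both squares would close up to a cycle with
    at least three vertices in each of them. *)
Lemma cross_edges a b c e a' b' c' e' x x' y y' :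
  square a b c e -> square a' b' c' e' ->
  uniq ([:: a; b; c; e] ++ [:: a'; b'; c'; e']) ->
  x \in [:: a; b; c; e] -> x' \in [:: a; b; c; e] ->
  y \in [:: a'; b'; c'; e'] -> y' \in [:: a'; b'; c'; e'] ->
  adj x y -> adj x' y' -> x = x' \/ y = y'.
Proof.
move=> s s' u xc xc' yc yc' xy xy'.
have [|nx] := eqVneq x x'; first by left.
have [|ny] := eqVneq y' y; first by right.
have [p [pp lp up sp zp]] := square_path s xc xc' nx.
have [q [pq lq uq sq zq]] := square_path s' yc' yc ny.
exfalso; apply: (@no_long_cycle k G side bip lin ((x :: p) ++ (y' :: q))).
  apply/andP; split.
    by rewrite /= rcons_cat cat_path /= rcons_path pp lp xy' pq lq adj_sym xy.
  rewrite cat_uniq up uq andbT; apply/hasPn => v /sq vq; apply/negP => /sp vp.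
  move: u; rewrite cat_uniq => /and3P[_ /hasPn nc _]; by case/negP: (nc _ vq).
by rewrite size_cat /=; move: zp zq; clear; move: (size p) (size q) => n1 n2; lia.
Qed.

(** By cross_edges, all the edges between the squares pass through one vertex
    of one of them. Rotating the squares, this is the situation of
    no_disjoint_squares. *)
Lemma disjoint_squares a b c e a' b' c' e' :
  square a b c e -> square a' b' c' e' ->
  uniq ([:: a; b; c; e] ++ [:: a'; b'; c'; e']) -> False.
Proof.
move=> s s' u.
have core v0 v1 v2 v3 w0 w1 w2 w3 : square v0 v1 v2 v3 -> square w0 w1 w2 w3 ->
    uniq ([:: v0; v1; v2; v3] ++ [:: w0; w1; w2; w3]) -> side w0 = side v0 ->
    (forall x y, x \in [:: v0; v1; v2; v3] -> y \in [:: w0; w1; w2; w3] -> adj x y -> x = v0) ->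
    False.
  case/and5P=> _ a01 a12 a23 a30 /and5P[_ c01 c12 c23 c30] uvw s0 at0.
  apply: (no_disjoint_squares bip lin uvw) => // x y xv yw; apply/negP => xy.
  have xv' : x \in [:: v0; v1; v2; v3] by rewrite inE xv orbT.
  move: (at0 x y xv' yw xy) uvw => x0 /=; rewrite -x0.
  by case/andP => + _; rewrite !inE; move: xv; rewrite !inE => /or3P[] ->; rewrite ?orbT.
have core1 v0 v1 v2 v3 w0 w1 w2 w3 y : square v0 v1 v2 v3 -> square w0 w1 w2 w3 ->
    uniq ([:: v0; v1; v2; v3] ++ [:: w0; w1; w2; w3]) ->
    y \in [:: w0; w1; w2; w3] -> adj v0 y ->
    (forall x y, x \in [:: v0; v1; v2; v3] -> y \in [:: w0; w1; w2; w3] -> adj x y -> x = v0) ->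
    False.
  move=> sv sw uvw yw v0y at0; have [z1 [z2 [z3 [sz pz]]]] := square_at sw yw.
  apply: (core v0 v1 v2 v3 z1 z2 z3 y sv) => //; first exact: square_rot.
  - rewrite (perm_uniq (_ : perm_eq _ ([:: v0; v1; v2; v3] ++ [:: w0; w1; w2; w3]))) //.
    rewrite perm_cat2l; apply: perm_trans pz.
    by clear; apply/permP=> P /=; lia.
  - case/and5P: sz => _ /bip yz1 _ _ _; move: (bip v0y) yz1.
    by case: (side v0) (side y) (side z1) => [] [] [].
  move=> x' y' xv yz; apply: at0 => //; rewrite -(perm_mem pz).
  by move: yz; rewrite !inE => /or4P[] ->; rewrite ?orbT.
have [[x [y [xc yc xy]]]|none] := classic (exists x y,
  [/\ x \in [:: a; b; c; e], y \in [:: a'; b'; c'; e'] & adj x y]); last first.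
  have noc x y : x \in [:: a; b; c; e] -> y \in [:: a'; b'; c'; e'] -> adj x y -> x = a.
    by move=> xc yc xy; case: none; exists x, y.
  have [sa|sa] := eqVneq (side a') (side a); first exact: (core _ _ _ _ _ _ _ _ s s').
  apply: (core _ _ _ _ _ _ _ _ s (square_rot s')).
  - rewrite (perm_uniq (_ : perm_eq _ ([:: a; b; c; e] ++ [:: a'; b'; c'; e']))) //.
    by rewrite perm_cat2l; clear; apply/permP=> P /=; lia.
  - case/and5P: s' => _ /bip + _ _ _; move: sa.
    by case: (side a') (side a) (side b') => [] [] [].
  move=> x y xc yc; apply: noc => //.
  by move: yc; rewrite !inE => /or4P[] ->; rewrite ?orbT.
have [x1 [x2 [x3 [sx px]]]] := square_at s xc.
have [y1 [y2 [y3 [sy py]]]] := square_at s' yc.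
have u' : uniq ([:: x; x1; x2; x3] ++ [:: y; y1; y2; y3]).
  rewrite (perm_uniq (_ : perm_eq _ ([:: a; b; c; e] ++ [:: a'; b'; c'; e']))) //.
  exact: perm_cat.
have [[y' [yc' xy' ny]]|one] := classic (exists y',
  [/\ y' \in [:: a'; b'; c'; e'], adj x y' & y' != y]).
  apply: (core1 _ _ _ _ _ _ _ _ y sx sy u') => //; first exact: mem_head.
  move=> z w; rewrite (perm_mem px) (perm_mem py) => zc wc zw.
  have [//|e1] := cross_edges s s' u zc xc wc yc zw xy.
  have [//|e2] := cross_edges s s' u zc xc wc yc' zw xy'.
  by rewrite -e1 -e2 eqxx in ny.
apply: (core1 _ _ _ _ _ _ _ _ x sy sx) => //.
- by rewrite uniq_catC.
- exact: mem_head.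
- by rewrite adj_sym.
move=> w z; rewrite (perm_mem px) (perm_mem py) adj_sym => wc zc zw.
have [e1|//] := cross_edges s s' u zc xc wc yc zw xy.
have [//|nw] := eqVneq w y; case: one; exists w; split=> //; by rewrite -e1.
Qed.

End Squares.

(** * The opposite pair common to all squares *)

Section SquareStructure.
Variables (k : fieldType) (G : sgraph) (side : G -> bool).
Hypothesis bip : forall x y : G, adj x y -> side x != side y.
Hypothesis lin : has_linear_resolution k G 2.

Definition common (a b : G) : {set G} := [set v | adj a v && adj b v].

Lemma pick_other (T : finType) (A : {set T}) r : (1 < #|A|)%N -> exists2 b, b \in A & b != r.
Proof.
move=> A1; have : (0 < #|A :\ r|)%N by have := cardsD1 r A; lia.
by case/card_gt0P => b; rewrite !inE => /andP[br bA]; exists b.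
Qed.

Lemma pick_third (T : finType) (A : {set T}) r r' : (2 < #|A|)%N ->
  exists b, [/\ b \in A, b != r & b != r'].
Proof.
move=> A2; have [|b] := @pick_other _ (A :\ r) r'.
  by have := cardsD1 r A; lia.
by rewrite !inE => /andP[br bA] br'; exists b.
Qed.

(** The ideal is nonzero and generated by quadrics. *)
Lemma square_exists : exists a b a' b', square (a : G) b a' b'.
Proof.
have [[f fJ f0] _] := lin.
have [m mf] : exists m, m \in msupp f by exists (mlead f); exact: mlead_supp.
have [m' [_ ne wm]] := monomial_ker_partner ((toric_edge_idealE f).1 fJ) mf.
have [t ot [tE _]] := list_mnm_ex bip m.
have [t' ot' [t'E _]] := list_mnm_ex bip m'.
have ftt' : same_fibre t t' by apply/(same_fibreP bip ot ot'); rewrite -tE -t'E.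
have ntt' : ~~ perm_eq t t'.
  by apply: contraNN ne => /list_mnm_perm; rewrite -tE -t'E => ->.
have [u [r [u' [pu ou' su fuu' nuu']]]] := fibre_generated bip (isT : (0 < 2)%N) lin ot ot' ftt' ntt'.
have su' : size u' = 2%N by rewrite -(fibre_size fuu').
have ou : oriented side u.
  by apply/allP => p pu'; apply: (allP ot); rewrite (perm_mem pu) mem_cat pu'.
case: u su pu fuu' nuu' ou => [|[a b] [|[a' b'] []]] // _ pu fuu' nuu'.
case/and3P=> /andP[/= ab _] /andP[/= a'b' _] _.
case: u' su' ou' fuu' nuu' => [|x [|x' []]] // _ ou' fuu' nuu'.
have [/= ab' a'b na nb] := swap_adj ou' fuu' nuu'.
exists a, b, a', b'; apply/and5P; split; rewrite // 1?adj_sym //.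
rewrite /= !inE !negb_or na nb (adj_neq ab) (adj_neq ab') (adj_neq a'b').
by rewrite (eq_sym b) (adj_neq a'b).
Qed.

Lemma hexagon_false (v0 v1 v2 v3 v4 v5 : G) : uniq [:: v0; v2; v4] -> uniq [:: v1; v3; v5] ->
  adj v0 v1 -> adj v1 v2 -> adj v2 v3 -> adj v3 v4 -> adj v4 v5 -> adj v5 v0 -> False.
Proof.
move=> ue uo a01 a12 a23 a34 a45 a50; apply: (no_hexagon bip lin _ a01 a12 a23 a34 a45 a50).
have s v w : side v != side w -> v != w by apply: contraNneq => ->.
have b01 := bip a01; have b12 := bip a12; have b23 := bip a23.
have b34 := bip a34; have b45 := bip a45; have b50 := bip a50.
have d03 : v0 != v3 by apply: s; move: b01 b12 b23; case: (side v0) (side v1) (side v2) (side v3) => [] [] [] [].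
have d14 : v1 != v4 by apply: s; move: b34 b12 b23; case: (side v1) (side v2) (side v3) (side v4) => [] [] [] [].
have d25 : v2 != v5 by apply: s; move: b34 b45 b23; case: (side v2) (side v3) (side v4) (side v5) => [] [] [] [].
move: ue uo; rewrite /= !inE !negb_or !andbT => /andP[/andP[-> ->] ->] /andP[/andP[-> ->] ->].
rewrite d03 d14 d25 (adj_neq a01) (adj_neq a12) (adj_neq a23) (adj_neq a34) (adj_neq a45).
by rewrite eq_sym (adj_neq a50).
Qed.

(* Distinctness within a list, from disequalities known up to symmetry; those
   between the two sides of the bipartition come from the lemma e. *)
Local Ltac uniq_by e := rewrite /= ?inE ?negb_or ?andbT;
  repeat (apply/andP; split);
  first [done | by rewrite eq_sym | by apply: e | by rewrite eq_sym; apply: e].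

Section BasePair.
Variables (a1 a2 : G).
Hypothesis a12 : a1 != a2.
Hypothesis N2 : (1 < #|common a1 a2|)%N.
Hypothesis Nmax : forall x y, x != y -> (#|common x y| <= #|common a1 a2|)%N.
Local Notation Nb := (common a1 a2).

Lemma NbP b : b \in Nb -> [/\ adj a1 b, adj a2 b & side b = ~~ side a1].
Proof. by rewrite inE => /andP[ab1 ab2]; split=> //; rewrite (adj_side bip ab1). Qed.

Lemma side_a2 : side a2 = side a1.
Proof.
have [b bN _] := pick_other a1 N2; have [_ /(adj_side bip) + sb] := NbP bN.
by rewrite sb; case: (side a1) (side a2) => [] [].
Qed.

(** The common neighbours of r and r' include a1, a2 and p, so there is a third
    common neighbour of a1 and a2, hence a hexagon. *)
Lemma square_base_both p r r' : r != r' -> r \in Nb -> r' \in Nb ->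
  adj p r -> adj p r' -> p \notin [:: a1; a2] -> False.
Proof.
move=> rr' rN r'N pr pr'; rewrite !inE negb_or => /andP[p1 p2].
have [b [bN br br']] : exists b, [/\ b \in Nb, b != r & b != r'].
  apply: pick_third; apply: leq_trans (Nmax rr').
  have <- : #|[set a1; a2; p]| = 3%N.
    by rewrite setUC cardsU1 cards2 !inE negb_or a12 p1 p2.
  apply: subset_leq_card; apply/subsetP => v; rewrite !inE -orbA.
  have [r1 r2 _] := NbP rN; have [r1' r2' _] := NbP r'N.
  by case/or3P => /eqP->; rewrite ![adj r _]adj_sym ![adj r' _]adj_sym ?r1 ?r2 ?r1' ?r2' ?pr ?pr'.
have [r1 r2 _] := NbP rN; have [r1' r2' _] := NbP r'N; have [b1 b2 _] := NbP bN.
apply: (@hexagon_false a1 b a2 r p r') => //; try by rewrite adj_sym.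
  by rewrite /= !inE !negb_or a12 (eq_sym a1) (eq_sym a2) p1 p2.
by rewrite /= !inE !negb_or br br' rr'.
Qed.

Lemma side_neq (x y : G) : side y = ~~ side x -> x != y.
Proof. by move=> sy; apply: contraTneq isT => e; move: sy; rewrite e; case: (side y). Qed.

Lemma square_sides p r p' r' : square p r p' r' ->
  [/\ side r = ~~ side p, side p' = side p & side r' = ~~ side p].
Proof.
case/and5P=> _ /(adj_side bip) sr /(adj_side bip) sp' /(adj_side bip) sr' _.
by rewrite sr' sp' sr negbK.
Qed.

(** Let b, b' be common neighbours of a1 and a2. If both r and r' are such
    neighbours too, the maximality of a1, a2 is contradicted; if exactly one
    is, a hexagon appears; if none is, either a hexagon appears or the squares
    a1 b a2 b' and a1 r p' r' touch in a1 only. *)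
Lemma square_base_one r p' r' : square a1 r p' r' -> p' != a2 -> False.
Proof.
move=> sq np'2; have /and5P[+ a1r rp' p'r' r'a1] := sq.
rewrite /= !inE !negb_or !andbT => /and3P[/and3P[nar nap' nar'] /andP[nrp' nrr'] np'r'].
have [sr sp' sr'] := square_sides sq.
have one r0 r1 : r0 != r1 -> adj a1 r0 -> adj r0 p' -> adj p' r1 -> adj r1 a1 ->
    r0 \in Nb -> r1 \notin Nb -> False.
  move=> n01 a10 r0p' p'r1 r1a r0N r1N; have [b bN nb] := pick_other r0 N2.
  have [b1 b2 _] := NbP bN; have [r01 r02 _] := NbP r0N.
  apply: (@hexagon_false a1 b a2 r0 p' r1) => //; try by rewrite adj_sym.
    by rewrite /= !inE !negb_or a12 nap' eq_sym np'2.
  rewrite /= !inE !negb_or nb n01 !andbT.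
  by apply: contraNneq r1N => <-.
have [rN|rN] := boolP (r \in Nb); have [r'N|r'N] := boolP (r' \in Nb).
- apply: (square_base_both nrr' rN r'N _ p'r'); rewrite 1?adj_sym //.
  by rewrite !inE negb_or eq_sym nap' np'2.
- exact: (one r r').
- by apply: (one r' r); rewrite // 1?eq_sym // 1?adj_sym.
have [b bN _] := pick_other a1 N2; have [b' b'N nb] := pick_other b N2.
have [b1 b2 sb] := NbP bN; have [b1' b2' sb'] := NbP b'N; have sa2 := side_a2.
have neN x y : x \in Nb -> y \notin Nb -> x != y by move=> xN; apply: contraNneq => <-.
have nap y : side y = ~~ side a1 -> [/\ y != p', y != a2 & y != a1].
  by move=> sy; rewrite !(eq_sym y) !side_neq // ?sp' ?sa2.
have [nbp' nba2 nba1] := nap _ sb; have [nbp2 nb'a2 nb'a1] := nap _ sb'.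
have [nrp2 nra2 nra1] := nap _ sr; have [nr'p' nr'a2 nr'a1] := nap _ sr'.
have cross x : x \in Nb -> adj x p' = false.
  move=> xN; apply/negP => xp'; have [y yN nyx] := pick_other x N2.
  have [x1 x2 _] := NbP xN; have [y1 y2 _] := NbP yN.
  apply: (@hexagon_false x p' r a1 y a2) => //; try by rewrite adj_sym.
    by rewrite /= !inE !negb_or neN // eq_sym nyx eq_sym neN.
  by rewrite /= !inE !negb_or eq_sym nap' np'2 a12.
have cross2 x : adj a1 x -> x \notin Nb -> adj a2 x = false.
  by move=> ax xN; apply: contraNF xN => a2x; rewrite inE ax a2x.
apply: (@no_touching_squares k G side bip a1 b a2 b' r p' r' lin) => //; try by rewrite adj_sym.
  by uniq_by neN.
move=> x y; rewrite !inE => /or3P[] /eqP-> /or3P[] /eqP->;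
  first [by apply: (same_side_adj bip); rewrite ?sb ?sb' ?sr ?sr' ?sa2 ?sp'
        | by apply: cross | by apply: cross2; rewrite // adj_sym].
Qed.

(** As before, with squares that are disjoint or touch in a common neighbour of
    a1 and a2. *)
Lemma square_base_none p r p' r' : square p r p' r' -> side p = side a1 ->
  p \notin [:: a1; a2] -> p' \notin [:: a1; a2] -> False.
Proof.
move=> sq sp pA p'A; have /and5P[+ pr rp' p'r' r'p] := sq.
rewrite /= !inE !negb_or !andbT => /and3P[/and3P[npr npp' npr'] /andP[nrp' nrr'] np'r'].
have [sr sp' sr'] := square_sides sq; rewrite sp in sr sp' sr'.
have sa2 := side_a2.
move: (pA) (p'A); rewrite !inE !negb_or => /andP[np1 np2] /andP[np1' np2'].
have neN x y : x \in Nb -> y \notin Nb -> x != y by move=> xN; apply: contraNneq => <-.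
have one r0 r1 : r0 != r1 -> adj p r0 -> adj r0 p' -> adj p' r1 -> adj r1 p ->
    side r0 = ~~ side a1 -> side r1 = ~~ side a1 ->
    r0 \in Nb -> r1 \notin Nb -> False.
  move=> n01 pr0 r0p' p'r1 r1p sr0 sr1 r0N r1N; have [b bN nb] := pick_other r0 N2.
  have [b1 b2 sb] := NbP bN; have [r01 r02 _] := NbP r0N.
  have c1 : adj a1 r1 = false.
    apply/negP => a1r1; apply: (@hexagon_false a1 r1 p r0 a2 b) => //; try by rewrite adj_sym.
      by rewrite /= !inE !negb_or (eq_sym a1 p) np1 a12 np2.
    by rewrite /= !inE !negb_or (eq_sym r1) n01 (eq_sym r1) (neN b) // (eq_sym r0) nb.
  have c2 : adj a2 r1 = false.
    apply/negP => a2r1; apply: (@hexagon_false a2 r1 p r0 a1 b) => //; try by rewrite adj_sym.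
      by rewrite /= !inE !negb_or (eq_sym a2 p) np2 (eq_sym a2) a12 np1.
    by rewrite /= !inE !negb_or (eq_sym r1) n01 (eq_sym r1) (neN b) // (eq_sym r0) nb.
  have c3 : adj b p = false.
    apply/negP => bp; apply: (@hexagon_false b p r1 p' r0 a1) => //; try by rewrite adj_sym.
      by rewrite /= !inE !negb_or (neN b r1) // nb (eq_sym r1) n01.
    by rewrite /= !inE !negb_or npp' np1 np1'.
  have c4 : adj b p' = false.
    apply/negP => bp; apply: (@hexagon_false b p' r1 p r0 a1) => //; try by rewrite adj_sym.
      by rewrite /= !inE !negb_or (neN b r1) // nb (eq_sym r1) n01.
    by rewrite /= !inE !negb_or (eq_sym p') npp' np1 np1'.
  have dif x y : side x = ~~ side a1 -> side y = side a1 -> x != y.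
    by move=> sx sy; apply: side_neq; rewrite sx sy negbK.
  have dif' x y : side x = ~~ side a1 -> side y = side a1 -> y != x.
    by move=> sx sy; rewrite eq_sym dif.
  apply: (@no_touching_squares k G side bip r0 a1 b a2 p r1 p' lin) => //; try by rewrite adj_sym.
    by have nbr1 := neN b r1 bN r1N; uniq_by dif.
  move=> x y; rewrite !inE => /or3P[] /eqP-> /or3P[] /eqP->;
    first [done | by apply: (same_side_adj bip); rewrite ?sb ?sr1 ?sa2 ?sp ?sp'].
have [rN|rN] := boolP (r \in Nb); have [r'N|r'N] := boolP (r' \in Nb).
- by apply: (square_base_both nrr' rN r'N pr _ pA); rewrite adj_sym.
- exact: (one r r').
- by apply: (one r' r); rewrite // 1?eq_sym // 1?adj_sym.
have [b bN _] := pick_other a1 N2; have [b' b'N nb] := pick_other b N2.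
have [b1 b2 sb] := NbP bN; have [b1' b2' sb'] := NbP b'N.
have dif x y : side x = ~~ side a1 -> side y = side a1 -> x != y.
  by move=> sx sy; apply: side_neq; rewrite sx sy negbK.
have dif' x y : side x = ~~ side a1 -> side y = side a1 -> y != x.
  by move=> sx sy; rewrite eq_sym dif.
apply: (@disjoint_squares k G side bip lin a1 b a2 b' p r p' r') => //.
  by apply/and5P; split; rewrite // 1?adj_sym //; uniq_by dif.
have n1 := neN b r bN rN; have n2 := neN b r' bN r'N.
have n3 := neN b' r b'N rN; have n4 := neN b' r' b'N r'N.
by uniq_by dif.
Qed.

End BasePair.

(** Once a1 and a2 have the largest possible number of common neighbours, they
    are opposite in every square: a square placed otherwise gives a larger
    number of common neighbours or one of the forbidden configurations. *)
Lemma square_base a1 a2 p r p' r' : a1 != a2 -> (1 < #|common a1 a2|)%N ->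
  (forall x y, x != y -> (#|common x y| <= #|common a1 a2|)%N) ->
  square p r p' r' -> side p = side a1 ->
  (p = a1 /\ p' = a2) \/ (p = a2 /\ p' = a1).
Proof.
move=> a12 N2 Nmax sq sp; have a21 : a2 != a1 by rewrite eq_sym.
have cC : common a2 a1 = common a1 a2 by apply/setP => v; rewrite !inE andbC.
have N2' : (1 < #|common a2 a1|)%N by rewrite cC.
have Nmax' x y : x != y -> (#|common x y| <= #|common a2 a1|)%N by rewrite cC; exact: Nmax.
have npp' : p != p' by case/and5P: sq => /=; rewrite !inE !negb_or => /andP[/and3P[]].
have [pA|pA] := boolP (p \in [:: a1; a2]).
  move: pA; rewrite !inE => /orP[] /eqP pE; rewrite pE in sq npp' *; [left|right]; split=> //;
    apply/eqP/negPn/negP => np'.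
    exact: (square_base_one a12 N2 Nmax sq).
  exact: (square_base_one a21 N2' Nmax' sq).
have sq2 := square_rot (square_rot sq); have [_ sp' _] := square_sides sq.
have [p'A|p'A] := boolP (p' \in [:: a1; a2]).
  exfalso; move: p'A pA; rewrite !inE negb_or => /orP[] /eqP pE /andP[np1 np2]; rewrite pE in sq2.
    exact: (square_base_one a12 N2 Nmax sq2).
  exact: (square_base_one a21 N2' Nmax' sq2).
by case: (square_base_none a12 N2 Nmax sq).
Qed.

End SquareStructure.

(** * The core and its branches *)

Section TreeDecomposition.
Variables (k : fieldType) (G : sgraph) (side : G -> bool).
Hypothesis bip : forall x y : G, adj x y -> side x != side y.
Hypothesis lin : has_linear_resolution k G 2.

Lemma maximal_pair : exists a1 a2 : G, [/\ a1 != a2, (1 < #|common a1 a2|)%N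
  & forall x y : G, x != y -> (#|common x y| <= #|common a1 a2|)%N].
Proof.
have [a [b [a' [b' sq]]]] := square_exists bip lin.
have /and5P[+ ab ba' a'b' b'a] := sq.
rewrite /= !inE !negb_or !andbT => /and3P[/and3P[_ naa' _] /andP[_ nbb'] _].
have [[a1 a2] /= n12 max12] :=
  @arg_maxnP _ (a, a') (fun p => p.1 != p.2) (fun p => #|common p.1 p.2|) naa'.
exists a1, a2; split=> //; last by move=> x y xy; apply: (max12 (x, y)).
apply: leq_trans (max12 (a, a') naa').
have <- : #|[set b; b']| = 2%N by rewrite cards2 nbb'.
apply: subset_leq_card; apply/subsetP => v; rewrite !inE => /orP[] /eqP->.
  by rewrite ab adj_sym.
by rewrite a'b' adj_sym b'a.
Qed.

Variables (a1 a2 : G).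
Hypothesis a12 : a1 != a2.
Hypothesis N2 : (1 < #|common a1 a2|)%N.
Hypothesis Nmax : forall x y : G, x != y -> (#|common x y| <= #|common a1 a2|)%N.
Local Notation Nb := (@common G a1 a2).

Definition core : {set G} := a1 |: (a2 |: Nb).

Lemma coreP x : x \in core -> [\/ x = a1, x = a2 | x \in Nb].
Proof. by rewrite 2!in_setU1 => /or3P[/eqP|/eqP|]; [constructor 1|constructor 2|constructor 3]. Qed.

(** A cycle is a square, and two of its opposite vertices are a1 and a2. *)
Lemma cycle_in_core c : ucycle (@adj G) c -> (2 < size c)%N -> {subset c <= core}.
Proof.
move=> uc c2; have c6 : (size c < 6)%N.
  by rewrite ltnNge; apply/negP => c5; exact: (no_long_cycle bip lin uc c5).
have os : ~~ odd (size c) by case/andP: uc => /(cycle_even bip).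
have [p [r [p' [r' [sq sp pc]]]]] : exists p r p' r',
    [/\ square p r p' r', side p = side a1 & {subset c <= [:: p; r; p'; r']}].
  case: c uc c2 c6 os => [|x [|y [|z [|w [|? [|? ?]]]]]] // /andP[/= cc uc] _ _ _.
  have sq : square x y z w by case/and5P: cc => xy yz zw wx _; apply/and5P; split.
  have [sx|sx] := eqVneq (side x) (side a1); first by exists x, y, z, w; split=> // v.
  exists y, z, w, x; split; first exact: square_rot.
    case/and5P: sq => _ /bip + _ _ _; move: sx.
    by case: (side x) (side a1) (side y) => [] [] [].
  by move=> v; rewrite !inE => /or4P[] ->; rewrite ?orbT.
have /and5P[_ pr rp' p'r' r'p] := sq.
have inC : (p = a1 /\ p' = a2) \/ (p = a2 /\ p' = a1).
  exact: (square_base bip lin a12 N2 Nmax sq sp).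
move=> v /pc; rewrite !inE.
by case: inC => -[pE p'E]; subst; case/or4P => /eqP->;
  rewrite ?eqxx ?orbT //= ?pr ?p'r' ?[adj a2 r]adj_sym ?[adj a1 r]adj_sym ?rp'
    ?[adj a2 r']adj_sym ?[adj a1 r']adj_sym ?r'p ?orbT //; rewrite adj_sym rp' orbT.
Qed.

Definition off_core : rel G := fun x y => adj x y && ~~ ((x \in core) && (y \in core)).

Lemma off_core_sym : ssrbool.symmetric off_core.
Proof. by move=> x y; rewrite /off_core adj_sym [_ && (x \in _)]andbC. Qed.

Lemma core_link x y : x \in core -> y \in core -> x != y ->
  adj x y \/ exists z, [/\ z \in core, adj x z & adj z y].
Proof.
have inN b : b \in Nb -> b \in core by move=> bN; rewrite 2!in_setU1 bN !orbT.
have [b bN _] := pick_other a1 N2; have [b1 b2 _] := NbP bip bN.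
have a1c : a1 \in core by rewrite !inE eqxx.
case/coreP => [->|->|xN] /coreP[->|->|yN]; rewrite ?eqxx // => _.
- by right; exists b; split; rewrite ?inN // adj_sym.
- by left; have [] := NbP bip yN.
- by right; exists b; split; rewrite ?inN // adj_sym.
- by left; have [] := NbP bip yN.
- by left; rewrite adj_sym; have [] := NbP bip xN.
- by left; rewrite adj_sym; have [] := NbP bip xN.
right; exists a1; split=> //; last by have [] := NbP bip yN.
by rewrite adj_sym; have [] := NbP bip xN.
Qed.

(** A path outside the core between two core vertices would close up through
    the core to a cycle leaving the core. *)
Lemma off_core_connect v w : v \in core -> w \in core -> connect off_core v w -> v = w.
Proof.
move=> vK wK /connectP[p0 pp0 wE]; apply/eqP/negPn/negP => vw; subst w.
case/shortenP: pp0 vw wK => p pp up _ vw lK.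
have hp : has (mem core) p.
  case: p {pp up} vw lK => [|y p]; first by rewrite eqxx.
  by move=> _ lK; apply/hasP; exists (last y p); rewrite ?mem_last.
case/split_find: hp pp up => w p1 p2 wK np1 pp up {vw lK}.
have {}wK : w \in core := wK.
have {}pp : path off_core v (rcons p1 w) by move: pp; rewrite cat_path => /andP[].
have {}up : uniq (v :: rcons p1 w).
  by move: up; rewrite -cat_cons cat_uniq => /andP[].
have vw : v != w by move: up; rewrite /= mem_rcons inE negb_or => /andP[/andP[]].
have pa : path (@adj G) v (rcons p1 w).
  by apply: sub_path pp => x y /andP[].
have [y yp1] : exists y, y \in p1.
  case: p1 pp {np1 up pa} => [|y p1]; last by exists y; rewrite mem_head.
  by rewrite /= /off_core vK wK andbF.
have yK : y \notin core by exact: (hasPn np1).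
have absurd c : ucycle (@adj G) c -> (2 < size c)%N -> y \in c -> False.
  by move=> uc sc yc; case/negP: yK; apply: (cycle_in_core uc sc).
have s1 : (0 < size p1)%N by case: (p1) yp1.
have [wv|[z [zK wz zv]]] := core_link wK vK (negbT (introF eqP (fun e => negP vw (introT eqP (esym e))))).
  apply: (absurd (v :: rcons p1 w)).
  - by apply/andP; split=> //; rewrite /= rcons_path pa last_rcons.
  - by rewrite /= size_rcons.
  by rewrite inE mem_rcons inE yp1 !orbT.
apply: (absurd (v :: rcons (rcons p1 w) z)).
- apply/andP; split; first by rewrite /= rcons_path rcons_path pa !last_rcons wz zv.
  rewrite -rcons_cons rcons_uniq up andbT inE mem_rcons inE !negb_or.
  rewrite (adj_neq zv) eq_sym (adj_neq wz) /=.
  by apply/negP => zp1; move: (hasPn np1 _ zp1); rewrite /= zK.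
- by rewrite /= !size_rcons.
by rewrite inE !mem_rcons !inE mem_rcons inE yp1 !orbT.
Qed.

Section Component.
Variable v : G.

Definition branch_adj : rel {u : G | connect off_core v u} :=
  fun x y => adj (val x) (val y).

Lemma branch_sym : ssrbool.symmetric branch_adj.
Proof. by move=> x y; apply: adj_sym. Qed.

Lemma branch_irrefl : irreflexive branch_adj.
Proof. by move=> x; apply: adj_irrefl. Qed.

Definition branch : sgraph := SGraph branch_sym branch_irrefl.

Definition branch_root : branch := exist _ v (connect0 off_core v).

Lemma branch_connected : connected branch.
Proof.
split; first by apply/card_gt0P; exists branch_root.
suff H (x : branch) : connect (@adj branch) branch_root x.
  move=> x y; apply: connect_trans (H y).
  by rewrite (sym_connect_sym (@adj_sym branch)).
case: x => u vu; have /connectP[p pp uE] := vu.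
elim/last_ind: p u uE pp vu => [|p w IH] u uE pp vu.
  by rewrite (_ : exist _ u vu = branch_root) ?connect0 //; apply: val_inj.
rewrite last_rcons in uE; subst u; move: pp; rewrite rcons_path => /andP[pp lw].
have vl : connect off_core v (last v p) by apply/connectP; exists p.
apply: connect_trans (IH _ erefl pp vl) _; apply: connect1.
by case/andP: lw.
Qed.

Lemma branch_acyclic : v \in core -> acyclic branch.
Proof.
move=> vK c uc; rewrite ltnNge; apply/negP => c3.
have uvc : ucycle (@adj G) (map val c).
  case/andP: uc => cc uc; apply/andP; split; last by rewrite map_inj_uniq //; exact: val_inj.
  by rewrite cycle_map.
have sub : {subset map val c <= core} by apply: cycle_in_core uvc _; rewrite size_map.
have eqv x : x \in c -> val x = v.
  move=> xc; apply/esym/off_core_connect => //; last exact: (valP x).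
  by apply: sub; apply: map_f.
case: c uc c3 eqv {uvc sub} => [|x [|y c]] // /andP[_ /= /andP[xy _]] _ eqv.
move: xy; rewrite inE (_ : x = y) ?eqxx //; apply: val_inj.
apply: etrans (eqv x _) (esym (eqv y _)); first exact: mem_head.
by rewrite inE mem_head orbT.
Qed.

End Component.

(** A path from u to the core stays off the core until its first core vertex.
    *)
Lemma branch_cover u : connected G -> exists2 v, v \in core & connect off_core v u.
Proof.
case=> _ /(_ a1 u)/connectP[p pp ->].
have a1c : a1 \in core by rewrite !inE eqxx.
have : exists2 v, v \in core & connect off_core v a1 by exists a1.
elim: p (a1) pp => //= y p IH x /andP[xy pp] [v vK vx].
apply: IH pp _; have [/andP[xK yK]|xyK] := boolP ((x \in core) && (y \in core)).
  by exists y.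
by exists v => //; apply: connect_trans vx _; apply: connect1; rewrite /off_core xy.
Qed.

Definition core_vertex (v : complete_bipartite 2 #|Nb|) : G :=
  match v with
  | inl i => if i == ord0 then a1 else a2
  | inr j => enum_val j
  end.

Lemma core_vertexK v : core_vertex v \in core.
Proof.
case: v => [i|j] /=; first by case: ifP; rewrite !inE eqxx ?orbT.
by rewrite 2!in_setU1 (enum_valP j) !orbT.
Qed.

Lemma core_vertex_adj v w : adj (core_vertex v) (core_vertex w) = adj v w.
Proof.
have sa2 := side_a2 bip N2.
case: v w => [i|j] [i'|j'] /=.
- by apply: (same_side_adj bip); case: ifP; case: ifP; rewrite ?sa2.
- by have [h1 h2 _] := NbP bip (enum_valP j'); case: ifP.
- by have [h1 h2 _] := NbP bip (enum_valP j); rewrite adj_sym; case: ifP.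
have [_ _ s1] := NbP bip (enum_valP j); have [_ _ s2] := NbP bip (enum_valP j').
by apply: (same_side_adj bip); rewrite s1 s2.
Qed.

Lemma core_vertex_inj : injective core_vertex.
Proof.
have na x : x \in Nb -> a1 != x /\ a2 != x.
  by move=> xN; have [/adj_neq ? /adj_neq ? _] := NbP bip xN.
move=> [i|j] [i'|j'] /= e.
- congr inl; apply: val_inj; move: e.
  case: i i' => [[|[|i]] hi] [[|[|i']] hi'] //= /eqP; rewrite ?(negPf a12) //.
  by rewrite eq_sym (negPf a12).
- have [n1 n2] := na _ (enum_valP j').
  by move: e; case: ifP => _ /eqP; rewrite ?(negPf n1) ?(negPf n2).
- have [n1 n2] := na _ (enum_valP j).
  by move: e; case: ifP => _ /esym/eqP; rewrite ?(negPf n1) ?(negPf n2).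
by congr inr; apply: enum_val_inj.
Qed.

Lemma core_vertex_surj x : x \in core -> exists v, core_vertex v = x.
Proof.
case/coreP => [->|->|xN].
- by exists (inl ord0).
- by exists (inl (lift ord0 ord0)).
by exists (inr (enum_rank_in xN x)); rewrite /= enum_rankK_in.
Qed.

(** The branches at the core vertices are disjoint by off_core_connect, acyclic
    because cycles stay in the core, and together with the edges of the core
    they give back the graph. *)
Lemma core_decomposition : connected G ->
  obtained_by_appending_trees (complete_bipartite 2 #|Nb|) G.
Proof.
move=> connG; pose T v := branch (core_vertex v); pose r v : T v := branch_root (core_vertex v).
exists T, r; split=> [v|].
  by split; [exact: branch_connected | exact/branch_acyclic/core_vertexK].
pose g (p : append_graphs r) : G := val (tagged p).
have gtag p q : core_vertex (tag p) = g q -> tag p = tag q.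
  move=> e; apply: core_vertex_inj; rewrite e.
  apply/esym/off_core_connect; rewrite -?e ?core_vertexK // e.
  exact: (valP (tagged q)).
have gI : injective g.
  move=> [v x] [w y]; rewrite /g /= => e.
  have vw : v = w.
    apply: core_vertex_inj; apply: off_core_connect; rewrite ?core_vertexK //.
    have cx : connect off_core (core_vertex v) (sval x) := valP x.
    apply: connect_trans cx _; rewrite e (sym_connect_sym off_core_sym).
    exact: (valP y).
  by subst w; congr existT; apply: val_inj.
have gS u : exists p, g p = u.
  have [x xK xu] := branch_cover u connG; have [v vE] := core_vertex_surj xK.
  subst x; by exists (existT _ v (exist _ u xu)).
have [f fE] := fin_all_exists gS; exists f; split.
  by exists g => // p; apply: gI; rewrite fE.
move=> x y; rewrite -{2}(fE x) -{2}(fE y); move: (f x) (f y) => [v p] [w q] {x y}.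
rewrite /g /= /append_adj /=; have [vw|vw] := eqVneq v w.
  by subst w; rewrite tagged_asE Kab_irrefl !andbF orbF.
apply/and3P/idP => [[/eqP-> /eqP-> vw']|pq].
  by rewrite /= (core_vertex_adj v w).
have off_false : ~~ off_core (val p) (val q).
  apply: contra_neqN vw => pq'; apply: core_vertex_inj.
  apply: off_core_connect; rewrite ?core_vertexK //.
  apply: connect_trans (valP p) _; apply: connect_trans (connect1 pq') _.
  by rewrite (sym_connect_sym off_core_sym); exact: (valP q).
move: off_false; rewrite /off_core pq /= negbK => /andP[pK qK].
have pE : val p = core_vertex v.
  by apply/esym/off_core_connect; rewrite ?core_vertexK //; exact: (valP p).
have qE : val q = core_vertex w.
  by apply/esym/off_core_connect; rewrite ?core_vertexK //; exact: (valP q).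
split; [exact/eqP/val_inj | exact/eqP/val_inj|].
by rewrite -[Kab_adj v w](core_vertex_adj v w) -pE -qE.
Qed.

End TreeDecomposition.

Theorem linear_resolution_decomposition (k : fieldType) (G : sgraph) :
  connected G -> bipartite G -> has_linear_resolution k G 2 ->
  exists m : nat, (2 <= m)%N /\ obtained_by_appending_trees (complete_bipartite 2 m) G.
Proof.
move=> connG [side bip] lin; have [a1 [a2 [a12 N2 Nmax]]] := maximal_pair bip lin.
have decomposition := core_decomposition bip lin a12 N2 Nmax connG.
by exists #|common a1 a2|.
Qed.

(** * A linear syzygy of a nonprincipal toric ideal *)

Section LinearSyzygies.
Variables (k : fieldType) (n N : nat) (d : 'I_n -> 'X_{1..N}).
Local Notation S := {mpoly k[n]}.

Lemma linres_const_free r (g : 'M[S]_(r, 1)) :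
  linres (fun w : 'rV_r => w *m g = 0) -> const_free g.
Proof.
move=> /linresP[a [R [hR KR _]]] c hc /KR[w wE]; apply/rowP=> j.
rewrite [RHS]mxE (homog0_const (hc 0 j)) wE !mxE raddf_sum big1 //= => l _.
apply/memN_msupp_eq0/negP => /msuppM_le /allpairsP[[m1 m2]] /= [_ + E].
move/(dhomog_mf (hR l j)) => /=.
by move/esym/eqP: E; rewrite mnmD_eq0 => /andP[_ /eqP->]; rewrite mf0.
Qed.

Lemma linear_formE (l : S) : l \is 1.-homog -> l = \sum_e l@_U_(e) *: 'X_e.
Proof.
move=> /dhomogP hl; apply/mpolyP=> m; rewrite raddf_sum /=.
have [/mdeg1P[e /eqP->]|m1] := boolP (mdeg m == 1%N).
  rewrite (bigD1 e) //= mcoeffZ mcoeffX eqxx mulr1 big1 ?addr0 // => e' /negPf ne.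
  by rewrite mcoeffZ mcoeffX eq_mnm1 ne mulr0.
rewrite (memN_msupp_eq0 (_ : m \notin msupp l)); last first.
  by apply: contra m1 => /hl /= /eqP.
rewrite big1 // => e _; rewrite mcoeffZ mcoeffX; case: eqP => [e'|]; last by rewrite mulr0.
by rewrite -e' mdeg1 in m1.
Qed.

(** Two generators have a Koszul syzygy, so some syzygy R is nonzero and
    linear. Writing it as a sum of X_e h_e, where h_e in I is a combination of
    the generators with constant coefficients not all zero, a monomial of X_e1
    h_e1 must cancel against one of X_e2 h_e2. So h_e1 and h_e2 contain
    monomials M U_e2 and M U_e1, neither alone in its fibre. *)
Lemma nonprincipal_overlap (I : {pred S}) q : (0 < q)%N -> linear_resolution I q ->
  (forall f, f \in I <-> monomial_map d f = 0) -> ~ principal I ->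
  exists e1 e2 (M M1 M2 : 'X_{1..n}), [/\ e1 != e2, mdeg M = q.-1,
    M1 != (M + U_(e1))%MM /\ weight d M1 = weight d (M + U_(e1))%MM
    & M2 != (M + U_(e2))%MM /\ weight d M2 = weight d (M + U_(e2))%MM].
Proof.
move=> q0 lI IE np; have [r [g [hg gE kg]]] := linres_of_linear_resolution q0 lI.
have fg := linres_const_free kg.
have gI c : monomial_map d (g c 0) = 0.
  apply/IE/gE; exists (delta_mx 0 c); rewrite -rowE.
  by apply/matrixP=> i j; rewrite !ord1 !mxE eqxx.
have [a [R [hR KR _]]] := linresP kg.
have [i [j Rij]] : exists i j, R i j != 0.
  apply: NNPP => none; apply: np.
  have R0 : R = 0.
    by apply/matrixP=> i j; rewrite mxE; apply/eqP/negPn/negP => ne; case: none; exists i, j.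
  have k0 (v : 'rV[S]_r) : v *m g = 0 -> v = 0 by move=> /KR[w ->]; rewrite R0 mulmx0.
  case: r g {hg fg gI a R KR hR R0 none kg} gE k0 => [|[|r]] g gE k0.
  - exists 0 => f; rewrite gE; split=> [[w /matrixP/(_ 0 0)]|[h ->]].
      by rewrite !mxE eqxx big_ord0 mulr1n => ->; exists 0; rewrite mulr0.
    by exists 0; rewrite mul0mx mulr0 raddf0.
  - exists (g 0 0) => f; rewrite gE; split=> [[w /matrixP/(_ 0 0)]|[h ->]].
      by rewrite !mxE eqxx big_ord1 mulr1n => ->; exists (w 0 0).
    exists h%:M; apply/matrixP=> x y; rewrite !ord1 !mxE eqxx big_ord1 mxE eqxx.
    by rewrite !mulr1n.
  pose i0 : 'I_r.+2 := ord0; pose i1 : 'I_r.+2 := lift ord0 ord0.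
  pose v : 'rV[S]_r.+2 := g i1 0 *: delta_mx 0 i0 - g i0 0 *: delta_mx 0 i1.
  have v0 : v = 0.
    apply: k0; rewrite mulmxBl -!scalemxAl -!rowE; apply/matrixP=> x y.
    by rewrite !ord1 !mxE mulrC subrr.
  have g0 : g i0 0 = 0.
    have /rowP/(_ i1) := v0; rewrite !mxE !eqxx /= mulr0 sub0r mulr1 => /eqP.
    by rewrite oppr_eq0 => /eqP.
  have /rowP/(_ i0) : (delta_mx 0 i0 : 'rV[S]_r.+2) = 0.
    apply: k0; rewrite -rowE; apply/matrixP=> x y.
    by rewrite !ord1 !mxE g0.
  by rewrite !mxE !eqxx => /eqP; rewrite oner_eq0.
(* The i-th syzygy is the sum of 'X_e * h e over e. *)
pose h e : S := \sum_c (R i c)@_U_(e) *: g c 0.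
have hI e : monomial_map d (h e) = 0.
  by rewrite rmorph_sum big1 // => c _ /=; rewrite monomial_mapZ gI scaler0.
have hq e : h e \is q.-homog by apply: rpred_sum => c _; rewrite rpredZ.
have h_sum : \sum_e 'X_e * h e = 0.
  have /KR/matrixP/(_ 0 0) : exists w, row i R = w *m R by exists (delta_mx 0 i); rewrite rowE.
  rewrite !mxE => e0; rewrite -[RHS]e0.
  rewrite (eq_bigr (fun e => \sum_c ((R i c)@_U_(e) *: 'X_e) * g c 0)); last first.
    move=> e _; rewrite mulr_sumr; apply: eq_bigr => c _.
    by rewrite -scalerAr -scalerAl.
  rewrite exchange_big; apply: eq_bigr => c _ /=.
  by rewrite -mulr_suml -linear_formE // mxE.
have [e1 h1] : exists e, h e != 0.
  apply: NNPP => none; case/eqP: Rij; rewrite (linear_formE (hR i j)) big1 // => e _.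
  suff /rowP/(_ j) : \row_c ((R i c)@_U_(e))%:MP = 0 :> 'rV[S]_r.
    by rewrite !mxE => /eqP; rewrite mpolyC_eq0 => /eqP->; rewrite scale0r.
  apply: fg => [x y|]; first by rewrite mxE homog_const.
  apply/matrixP=> x y; rewrite !ord1 !mxE.
  have -> : \sum_c (\row_c ((R i c)@_U_(e))%:MP) 0 c * g c 0 = h e.
    by apply: eq_bigr => c _; rewrite mxE mul_mpolyC.
  by apply/eqP/negPn/negP => he; case: none; exists e.
have [M2 M2h] : exists m, m \in msupp (h e1) by exists (mlead (h e1)); exact: mlead_supp.
have [e2 ne M1h] : exists2 e, e != e1 & (U_(e1) + M2)%MM \in msupp ('X_e * h e).
  apply: NNPP => none; have /mpolyP/(_ (U_(e1) + M2)%MM) := h_sum.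
  rewrite mcoeff0 raddf_sum (bigD1 e1) //= mulrC mcoeffMX big1 ?addr0.
    by move/eqP; rewrite mcoeff_eq0 M2h.
  move=> e ne; apply/eqP; rewrite mcoeff_eq0; apply/negP => he.
  by case: none; exists e.
have /allpairsP[[x M1] /= [+ M1h' E]] := msuppM_le M1h.
rewrite msuppX inE => /eqP xE; subst x.
have M2e2 : (0 < M2 e2)%N.
  have /mnmP/(_ e2) := E; rewrite !mnmDE !mnm1E eqxx eq_sym (negPf ne) add0n => ->.
  by rewrite addnC addn1.
pose M := (M2 - U_(e2))%MM.
have M2E : M2 = (M + U_(e2))%MM by rewrite submK // lep1mP -lt0n.
have M1E : M1 = (M + U_(e1))%MM.
  by apply: (@addmI _ U_(e2)%MM); rewrite -E {1}M2E; clear; apply/mnmP=> v; rewrite !mnmDE; lia.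
have [N1 [_ n1 w1]] := monomial_ker_partner (hI e2) M1h'.
have [N2 [_ n2 w2]] := monomial_ker_partner (hI e1) M2h.
exists e1, e2, M, N1, N2; split; rewrite -?M1E -?M2E // 1?eq_sym //.
have : mdeg M2 = q by exact: dhomog_mf (hq e1) _ M2h.
by rewrite M2E mdegD mdeg1 => <-; rewrite addn1.
Qed.

End LinearSyzygies.

(** * Linear resolutions with q at least 3 *)

Section LargeGirth.
Variables (k : fieldType) (G : sgraph) (side : G -> bool) (q : nat).
Hypothesis bip : forall x y : G, adj x y -> side x != side y.
Hypothesis lin : has_linear_resolution k G q.
Hypothesis q3 : (3 <= q)%N.

Let q0 : (0 < q)%N. Proof. exact: leq_trans q3. Qed.

(** The matchings of a cycle give a binomial of half its length. *)
Lemma girth (c : seq G) : ucycle (@adj G) c -> (2 < size c)%N -> (2 * q <= size c)%N.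
Proof.
move=> uc c2; have [|x [s [uxs cE sx _]]] := cycle_on_side bip uc; first exact: ltnW.
have s1 : (1 < size s)%N by move: c2; rewrite cE.
have [t' [ot ot' f nf]] := cycle_same_fibre bip uxs s1 sx.
have := fibre_min bip q0 lin ot ot' f nf; rewrite size_pairs -/(size (x :: s)) => qs.
rewrite cE; apply: leq_trans (_ : 2 * (size (x :: s))./2 <= _)%N; first by rewrite leq_mul2l.
by rewrite mul2n -[leqRHS]odd_double_half leq_addl.
Qed.

Lemma no_square (a b c e : G) : uniq [:: a; b; c; e] ->
  adj a b -> adj b c -> adj c e -> adj e a -> False.
Proof.
move=> u ab bc ce ea; have : (2 * q <= 4)%N.
  apply: (@girth [:: a; b; c; e]) => //; apply/andP; split=> //.
  by rewrite /= ab bc ce ea.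
by move: q3; clear; lia.
Qed.

(** A common edge could be removed, leaving a binomial of degree below q. *)
Lemma fibre_disjoint (t u : seq (G * G)) p : oriented side t -> oriented side u ->
  same_fibre t u -> ~~ perm_eq t u -> size t = q -> p \in t -> p \in u -> False.
Proof.
move=> ot ou ftu ntu st pt pu.
have pt' := perm_to_rem pt; have pu' := perm_to_rem pu.
have sub (v : seq (G * G)) : oriented side v -> oriented side (rem p v).
  by move=> ov; apply/allP => x /mem_rem; apply: (allP ov).
have : (q <= size (rem p t))%N.
  apply: (@fibre_min _ _ bip k q _ (rem p u)) => //; try exact: sub.
    case/andP: ftu => p1 p2; apply/andP; split.
      rewrite -(perm_cons p.1) -!(map_cons fst).
      by rewrite -(permPl (perm_map fst pt')) perm_sym -(permPl (perm_map fst pu')) perm_sym.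
    rewrite -(perm_cons p.2) -!(map_cons snd).
    by rewrite -(permPl (perm_map snd pt')) perm_sym -(permPl (perm_map snd pu')) perm_sym.
  apply: contra ntu => r; rewrite (permPl pt') perm_sym (permPl pu') perm_cons perm_sym.
  exact: r.
by rewrite size_rem // st; move: q0; clear; lia.
Qed.

(** Walking alternately along edges of t and of u runs into a cycle; by the
    girth bound it exhausts t. *)
Lemma fibre_cycle (t u : seq (G * G)) : oriented side t -> oriented side u ->
  same_fibre t u -> ~~ perm_eq t u -> size t = q ->
  exists x s, [/\ ucycle (@adj G) (x :: s), side x & perm_eq (pairs (x :: s)) t].
Proof.
move=> ot ou ftu ntu st.
(* f leaves one side along an edge of t and the other side along an edge of u.
   *)
pose f (v : G) : G := if side v then (nth (v, v) t (index v (unzip1 t))).2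
  else (nth (v, v) u (index v (unzip2 u))).1.
have f1 v : side v -> v \in unzip1 t -> (v, f v) \in t.
  move=> sv vt; rewrite /f sv; have it : (index v (unzip1 t) < size t)%N.
    by rewrite -(size_map fst) index_mem.
  have := mem_nth (v, v) it; have := nth_index v vt.
  rewrite (nth_map (v, v)) //; case: (nth _ _ _) => [a b] /= ->; done.
have f2 v : ~~ side v -> v \in unzip2 u -> (f v, v) \in u.
  move=> /negPf sv vt; rewrite /f sv; have it : (index v (unzip2 u) < size u)%N.
    by rewrite -(size_map snd) index_mem.
  have := mem_nth (v, v) it; have := nth_index v vt.
  rewrite (nth_map (v, v)) //; case: (nth _ _ _) => [a b] /= ->; done.
have [p1 p2] := andP ftu.
pose inV v := if side v then v \in unzip1 t else v \in unzip2 u.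
have step v : inV v -> inV (f v) /\ adj v (f v).
  rewrite /inV; case: ifP => [sv vt|/negbT sv vu].
    have ft := f1 _ sv vt; have /andP[/= vf _] := allP ot _ ft.
    rewrite vf (adj_side bip vf) sv /=; split=> //.
    by rewrite -(perm_mem p2); apply/mapP; exists (v, f v).
  have fu := f2 _ sv vu; have /andP[/= vf sf] := allP ou _ fu.
  rewrite adj_sym vf sf; split=> //.
  by rewrite (perm_mem p1); apply/mapP; exists (f v, v).
have ff v : inV v -> f (f v) != v.
  move=> vV; have [fV vf] := step _ vV; apply/negP => /eqP e.
  have [sv|sv] := boolP (side v).
    have h1 : (v, f v) \in t by apply: f1 => //; move: vV; rewrite /inV sv.
    have sf : ~~ side (f v) by rewrite (adj_side bip vf) sv.
    have h2 : (f (f v), f v) \in u by apply: f2 => //; move: fV; rewrite /inV (negPf sf).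
    by rewrite e in h2; apply: (fibre_disjoint ot ou ftu ntu st h1 h2).
  have h2 : (f v, v) \in u by apply: f2 => //; move: vV; rewrite /inV (negPf sv).
  have sf : side (f v) by rewrite (adj_side bip vf) sv.
  have h1 : (f v, f (f v)) \in t by apply: f1 => //; move: fV; rewrite /inV sf.
  by rewrite e in h1; apply: (fibre_disjoint ot ou ftu ntu st h1 h2).
have [pr prt] : exists pr, pr \in t.
  by case: (t) st q0 => [<- //|p t' _ _]; exists p; rewrite mem_head.
have [x0 x0V] : exists x, inV x.
  exists pr.1; rewrite /inV; have /andP[_ ->] := allP ot _ prt.
  exact: map_f.
have iterV i : inV (iter i f x0) by elim: i => //= i /step[].
have loop := looping_order f x0; set o := order f x0 in loop.
have [i io iE] := trajectP loop.
pose y := iter i f x0; pose c := traject f y (o - i).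
have oi : (0 < o - i)%N by rewrite subn_gt0.
have yE : iter (o - i) f y = y by rewrite -iterD subnK ?(ltnW io) // iE.
have uc : uniq c.
  have := orbit_uniq f x0; rewrite /orbit -/o -{1}(subnKC (ltnW io)) trajectD.
  by rewrite cat_uniq => /and3P[].
have cV : {in c, forall v, inV v}.
  by move=> v /trajectP[j _ ->]; rewrite -iterD.
have fc : fcycle f c.
  rewrite /c; case: (o - i)%N oi yE => // m _ yE /=.
  rewrite rcons_path fpath_traject /= last_traject; apply/eqP.
  by rewrite -iterS yE.
have sc : size c = (o - i)%N by rewrite size_traject.
(* If the cycle starts on the wrong side, rotate it by one. *)
have [x [s [fx sx xV sE]]] : exists x s, [/\ fcycle f (x :: s), side x,
    {in x :: s, forall v, inV v} & uniq (x :: s) /\ size (x :: s) = size c].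
  move: sc uc cV fc; case: (c) => [|x [|x' s]] sc uc cV fc.
  - by rewrite -sc in oi.
  - have [xV xf] := step x (cV x (mem_head _ _)).
    by move: fc => /= /andP[/eqP fx _]; rewrite fx adj_irrefl in xf.
  have [sx|sx] := boolP (side x); first by exists x, (x' :: s).
  exists x', (rcons s x); split.
  - by rewrite -rcons_cons -rot1_cons rot_cycle.
  - move: fc => /= /andP[/eqP fx _]; have [_ xf] := step x (cV x (mem_head _ _)).
    by rewrite -fx (adj_side bip xf).
  - by move=> v; rewrite -rcons_cons mem_rcons => /cV.
  by rewrite -rcons_cons rcons_uniq size_rcons.
case: sE => ux sE.
have ac : cycle (@adj G) (x :: s).
  apply: (sub_in_cycle (P := inV) (e := frel f)) fx; last by apply/allP.
  by move=> v w vV _ /eqP<-; have [] := step _ vV.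
have ucx : ucycle (@adj G) (x :: s) by apply/andP.
have s2 : (2 < size (x :: s))%N.
  case: s fx xV ac {ux sE ucx} => [|w [|]] //= fx xV.
    by rewrite adj_irrefl.
  move: fx => /and3P[/eqP fx /eqP fw _] _.
  by have := ff x (xV x (mem_head _ _)); rewrite fx fw eqxx.
have qs := girth ucx s2.
exists x, s; split=> //.
have sub : {subset pairs (x :: s) <= t}.
  have px : path (frel f) x s by move: fx; rewrite /= rcons_path => /andP[].
  clear fx ux sE ac ucx s2 qs sc.
  elim/seq2_ind: s x px sx xV => [|w|w w' s IH] x px sx xV p //.
    rewrite inE => /eqP->; move: px => /= /andP[/eqP<- _].
    by apply: f1 => //; have := xV x (mem_head _ _); rewrite /inV sx.
  move: px => /= /and3P[/eqP fx /eqP fw px]; rewrite inE => /orP[/eqP->|].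
    rewrite -fx; apply: f1 => //.
    by have := xV x (mem_head _ _); rewrite /inV sx.
  apply: IH => //; last by move=> v vs; apply: xV; rewrite !inE -in_cons vs !orbT.
  have [wV xw] := step _ (xV x (mem_head _ _)); rewrite fx in wV xw.
  have [_ ww'] := step _ wV; rewrite fw in ww'.
  by rewrite (adj_side bip ww') (adj_side bip xw) sx.
have up := uniq_pairs ux.
have ts : (size t <= size (pairs (x :: s)))%N.
  rewrite st size_pairs; apply: leq_trans (half_leq qs).
  by rewrite mul2n doubleK.
have [_ eqm] := uniq_min_size up sub ts.
by apply: uniq_perm => //; apply: leq_size_uniq up sub ts.
Qed.

(** Rotating the cycle by an even number of steps preserves its first matching.
    *)
Lemma rot_pair (x : G) s p : ucycle (@adj G) (x :: s) -> p \in pairs (x :: s) ->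
  exists z, ucycle (@adj G) (p.1 :: p.2 :: z) /\
    perm_eq (pairs (p.1 :: p.2 :: z)) (pairs (x :: s)).
Proof.
move=> uc pc; have /andP[cc _] := uc; have ev := cycle_even bip cc.
have [s1 [s2 [cE os1]]] := mem_pairs pc; exists (s2 ++ s1).
have es2 : ~~ odd (size s2).
  move: ev; rewrite cE size_cat /= !oddD /= negbK (negbTE os1) /=.
  by case: (odd _).
split.
  by rewrite -[_ :: _]/((p.1 :: p.2 :: s2) ++ s1) -rot_size_cat rot_ucycle -cE.
rewrite cE pairs_cat //= pairs_cat // perm_sym -cat1s perm_catCA /=.
by rewrite perm_cons perm_catC.
Qed.

Lemma mem_pairs_even (z : seq G) v : ~~ odd (size z) ->
  (v \in z) = (v \in unzip1 (pairs z)) || (v \in unzip2 (pairs z)).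
Proof.
elim/seq2_ind: z => [|x|x y z IH] //=; rewrite negbK => os.
rewrite !inE IH //; by case: (v == x); case: (v == y); rewrite ?orbT.
Qed.

(** If the first vertex p of one path came later on the other, its predecessor
    there would be joined to p by a chord of the first path. *)
Lemma head_unique p (z z' : seq G) h : ~~ odd (size (p :: z)) -> ~~ odd (size (h :: z')) ->
  uniq (p :: z) -> uniq (h :: z') ->
  path (@adj G) p z -> path (@adj G) h z' -> (size (p :: z) < 2 * q)%N ->
  perm_eq (pairs (p :: z)) (pairs (h :: z')) -> p = h.
Proof.
move=> ez ez' uz uz' pz pz' sz pe; apply/eqP/negPn/negP => ph.
case: z ez uz pz sz pe => // z1 z ez uz pz sz pe.
have pp : (p, z1) \in pairs (h :: z') by rewrite -(perm_mem pe) mem_head.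
have [s1 [s2 [zE os1]]] := mem_pairs pp; rewrite /= in zE.
case/lastP: s1 os1 zE => [|s1 y] os1 zE; first by case: zE ph => ->; rewrite eqxx.
have yp : adj y p.
  case: s1 zE {os1} => [|h' s1] [hE zE']; move: pz'; rewrite zE'.
    by rewrite /= => /andP[]; rewrite hE.
  by rewrite cat_path /= last_rcons => /and3P[].
have memE v : (v \in p :: z1 :: z) = (v \in h :: z').
  rewrite (mem_pairs_even v ez) (mem_pairs_even v ez').
  by rewrite (perm_mem (perm_map fst pe)) (perm_mem (perm_map snd pe)).
have yz : y \in p :: z1 :: z.
  by rewrite memE zE mem_cat mem_rcons mem_head.
have ny1 : y != z1.
  apply: contraTneq uz' => yz1; rewrite zE yz1 cat_uniq; apply/negP => /and3P[_ /hasPn/(_ z1)].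
  by rewrite !inE eqxx orbT mem_rcons mem_head => /(_ isT).
have nyp : y != p by apply: adj_neq.
move: yz; rewrite !inE (negPf nyp) (negPf ny1) /= => /splitPr yz.
case: yz pz uz sz {pe pp memE ez} => w1 w2 pz uz sz.
have uc : ucycle (@adj G) (p :: z1 :: rcons w1 y).
  apply/andP; split.
    rewrite /= !rcons_path last_rcons yp andbT.
    by move: pz; rewrite /= cat_path /= => /and3P[-> -> /andP[-> _]].
  move: uz; rewrite -cat_rcons -[_ :: _ :: _ ++ _]/((p :: z1 :: rcons w1 y) ++ w2).
  by rewrite cat_uniq => /andP[].
have := girth uc; rewrite /= size_rcons => /(_ isT).
by move: sz; rewrite /= size_cat /=; clear; move: (size w1) (size w2) => n1 n2; lia.
Qed.

Lemma pairs_rev (z : seq G) : ~~ odd (size z) ->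
  pairs (rev z) = rev [seq (p.2, p.1) | p <- pairs z].
Proof.
elim/seq2_ind: z => [|x|x y z IH] //=; rewrite negbK => os.
rewrite !rev_cons -cats1 -cats1 -catA pairs_cat ?size_rev // IH //=.
by rewrite cats1.
Qed.

(** What remains of a generating monomial after removing one edge is the
    matching of a path of length 2 q - 3. *)
Lemma overlap_cycle (t : seq (G * G)) p (e : 'I_#|edges G|) (N : 'X_{1..#|edges G|}) :
  oriented side (p :: t) -> size (p :: t) = q -> enum_val e = [set p.1; p.2] ->
  N != (list_mnm t + U_(e))%MM ->
  weight (@ends G) N = weight (@ends G) (list_mnm t + U_(e))%MM ->
  exists z, ucycle (@adj G) (p.1 :: p.2 :: z) /\ perm_eq (pairs z) t.
Proof.
move=> opt spt ep; have [u ou [-> _]] := list_mnm_ex bip N.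
have -> : (list_mnm t + U_(e))%MM = list_mnm (p :: t).
  by rewrite addmC -(edge_mnmU ep) [RHS]/list_mnm big_cons.
move=> ne /(same_fibreP bip ou opt); rewrite /same_fibre perm_sym [X in _ && X]perm_sym => f.
have [|x [s [uc _ ps]]] := fibre_cycle opt ou f _ spt.
  by apply: contra ne => /list_mnm_perm ->.
have [|z [uz pz]] := @rot_pair x s p uc; first by rewrite (perm_mem ps) mem_head.
by exists z; split=> //; rewrite -(perm_cons p) [X in X :: pairs _]surjective_pairing; apply: perm_trans ps.
Qed.

Lemma oriented_edge (e : 'I_#|edges G|) :
  exists2 p : G * G, adj p.1 p.2 && side p.1 & enum_val e = [set p.1; p.2].
Proof.
have [x [y [xy e']]] := edgeP e; have [sx|sx] := boolP (side x).
  by exists (x, y); rewrite //= xy.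
exists (y, x); last by rewrite /= setUC.
by have := bip xy; rewrite /= adj_sym xy (negPf sx); case: (side y).
Qed.

(** Otherwise there are two cycles of length 2 q whose matchings differ in one
    edge only, (a, b) against (c, d). Removing that edge from each leaves two
    paths with the same matching, hence with the same first vertex p and last
    vertex l by head_unique, applied also to the reversed paths. If a = c or b
    = d this closes a cycle of length 4, and otherwise the hexagon p d c l a b,
    so that q = 3. The graph then contains three paths of length 3 from p to l,
    with no other edges by the girth bound. *)
Theorem linear_resolution_hypersurface : is_hypersurface k G.
Proof.
apply: NNPP => np; have [e1 [e2 [M [M1 [M2 [ne dM [n1 w1] [n2 w2]]]]]]] :=
  nonprincipal_overlap q0 lin (@toric_edge_idealE G k) np.
have [t ot [ME st]] := list_mnm_ex bip M; rewrite {}ME in dM n1 w1 n2 w2 st.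
have [[a b] /andP[/= ab sa] E1] := oriented_edge e1.
have [[c d] /andP[/= cd sc] E2] := oriented_edge e2.
have stq p : size (p :: t : seq (G * G)) = q by rewrite /= st dM prednK.
have [|z' [uz' pz']] := @overlap_cycle t (a, b) e1 M1 _ (stq _) E1 n1 w1.
  by rewrite /= ab sa.
have [|z [uz pz]] := @overlap_cycle t (c, d) e2 M2 _ (stq _) E2 n2 w2.
  by rewrite /= cd sc.
have ne' : (a, b) <> (c, d).
  move=> [ac bd]; case/negP: ne; apply/eqP/enum_val_inj.
  by rewrite E1 E2 /= ac bd.
have sz (a0 b0 : G) w : ucycle (@adj G) (a0 :: b0 :: w) -> perm_eq (pairs w) t ->
    size w = (q.-1).*2.
  move=> /andP[/(cycle_even bip) /= + _] /perm_size; rewrite negbK size_pairs st dM => ow <-.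
  by rewrite -[LHS]odd_double_half (negbTE ow).
have szz := sz _ _ _ uz pz; have szz' := sz _ _ _ uz' pz'.
have zq : (size z < 2 * q)%N by rewrite szz; move: q3; clear; lia.
have zq' : (size z' < 2 * q)%N by rewrite szz' -szz.
have ez : ~~ odd (size z) by rewrite szz odd_double.
have ez' : ~~ odd (size z') by rewrite szz' odd_double.
have pzz : perm_eq (pairs z) (pairs z') by apply: perm_trans pz _; rewrite perm_sym.
have z3 : (3 < size z)%N by rewrite szz; move: q3; clear; lia.
have z3' : (3 < size z')%N by rewrite szz' -szz.
have mzz v : (v \in z) = (v \in z').
  rewrite (mem_pairs_even v ez) (mem_pairs_even v ez').
  by rewrite (perm_mem (perm_map fst pzz)) (perm_mem (perm_map snd pzz)).
have prev : perm_eq (pairs (rev z)) (pairs (rev z')).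
  by rewrite !pairs_rev // perm_rev perm_sym perm_rev perm_sym perm_map.
have walk (a0 b0 : G) w : ucycle (@adj G) (a0 :: b0 :: w) -> uniq w /\ sorted (@adj G) w.
  case/andP=> /= /andP[_ pw] /and3P[_ _ ->]; split=> //.
  by move: pw; rewrite rcons_path => /andP[/path_sorted].
have [uq so] := walk _ _ _ uz; have [uq' so'] := walk _ _ _ uz'.
have hd (w w' : seq G) x0 : ~~ odd (size w) -> ~~ odd (size w') -> uniq w -> uniq w' ->
    sorted (@adj G) w -> sorted (@adj G) w' -> (size w < 2 * q)%N -> (0 < size w)%N ->
    (0 < size w')%N -> perm_eq (pairs w) (pairs w') -> head x0 w = head x0 w'.
  case: w => // x w; case: w' => // x' w' ow ow' u1 u2 o1 o2 s1 _ _.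
  exact: head_unique.
have rs (w : seq G) : sorted (@adj G) w -> sorted (@adj G) (rev w).
  rewrite rev_sorted; apply: sub_sorted => x y; by rewrite adj_sym.
have hz x0 : head x0 z = head x0 z' by apply: hd => //; [case: (z) z3 | case: (z') z3'].
have hrz x0 : head x0 (rev z) = head x0 (rev z').
  by apply: hd; rewrite ?size_rev ?rev_uniq ?rs //; [case: (z) z3 | case: (z') z3'].
move: (hz a) (hrz a); clear hd prev rs walk sz pzz pz pz' ez ez' uq uq' so so' hz hrz.
case: z z' uz uz' szz szz' zq zq' z3 z3' mzz => [|p z] [|p' z'] // uz uz' szz szz' zq zq' z3 z3' mzz.
case/lastP: z uz szz zq z3 mzz => // z l uz szz zq z3 mzz.
case/lastP: z' uz' szz' zq' z3' mzz => // z' l' uz' szz' zq' z3' mzz.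
rewrite !rev_cons !rev_rcons /= => pp' ll'; subst l' p'.
have aE : a \notin p :: rcons z l by rewrite mzz; case/andP: uz' => _ /= /andP[]; rewrite inE negb_or => /andP[].
have bE : b \notin p :: rcons z l by rewrite mzz; case/andP: uz' => _ /= /and3P[].
have [cE dE uE] : [/\ c \notin p :: rcons z l, d \notin p :: rcons z l & uniq (p :: rcons z l)].
  by case/andP: uz => _ /= /and3P[]; rewrite inE negb_or => /andP[].
have [dp pz lc] : [/\ adj d p, path (@adj G) p (rcons z l) & adj l c].
  by case/andP: uz => /= + _; rewrite rcons_path last_rcons => /and3P[_ -> /andP[]].
have [bp la] : adj b p /\ adj l a.
  by case/andP: uz' => /= + _; rewrite rcons_path last_rcons => /and3P[_ -> /andP[]].
clear uz uz' mzz szz' zq zq' z3' z' E1 E2 n1 w1 n2 w2 ne st stq dM ot.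
have mp w : w \notin p :: rcons z l -> w != p by apply: contraNneq => ->; rewrite mem_head.
have ml w : w \notin p :: rcons z l -> w != l.
  by apply: contraNneq => ->; rewrite inE mem_rcons mem_head orbT.
have [ap al] := (mp _ aE, ml _ aE); have [bp' bl] := (mp _ bE, ml _ bE).
have [cp cl] := (mp _ cE, ml _ cE); have [dp' dl] := (mp _ dE, ml _ dE).
have ns (v w : G) : side v != side w -> v != w by apply: contraNneq => ->.
have ad : a != d by apply: ns; rewrite sa -sc (bip cd).
have cb : c != b by apply: ns; rewrite sc -sa (bip ab).
have [abn cdn] := (adj_neq ab, adj_neq cd).
have [ac|ac] := eqVneq a c.
  have bd : b != d by apply/eqP => bd; apply: ne'; rewrite ac bd.
  apply: (@no_square a b p d) => //; [|by rewrite adj_sym|by rewrite adj_sym ac].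
  by rewrite /= !inE !negb_or abn ap ad bp' bd /= eq_sym dp'.
have [bde|bde] := eqVneq b d.
  apply: (@no_square d a l c) => //; [|by rewrite -bde adj_sym|by rewrite adj_sym].
  rewrite -bde.
  by rewrite /= !inE !negb_or [b == a]eq_sym abn bl [b == c]eq_sym cb al ac /= eq_sym cl.
have [sp sl] : side p /\ side l = false.
  move: (bip cd) (bip dp) (bip lc); rewrite sc.
  by case: (side d) (side p) (side l) => [] [] [].
have lp : l != p by apply: ns; rewrite sp sl.
have db : d != b by rewrite eq_sym.
have q6 : q = 3%N.
  have := @girth [:: p; d; c; l; a; b]; rewrite /= mulnC => /(_ _ isT) h.
  apply/eqP; rewrite eqn_leq q3 andbT -(leq_pmul2r (isT : 0 < 2)%N); apply: h.
  apply/andP; split; first by rewrite /= adj_sym dp adj_sym cd adj_sym lc la ab bp.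
  rewrite /= !inE !negb_or ![p == _]eq_sym dp' cp lp ap bp' [d == c]eq_sym cdn dl.
  by rewrite [d == a]eq_sym ad db cl [c == a]eq_sym ac cb [l == a]eq_sym al [l == b]eq_sym bl abn.
have [z1 [z2 zE]] : exists z1 z2, z = [:: z1; z2].
  move: szz; rewrite q6 /= size_rcons; case: (z) => [|z1 [|z2 [|]]] // _.
  by exists z1, z2.
subst z; move: (pz) => /= /and4P[pz1 z12 z2l _].
have un : uniq [:: c; d; p; z1; z2; l; a; b].
  have pe : perm_eq [:: c; d; p; z1; z2; l; a; b] [:: a, b, c, d & p :: rcons [:: z1; z2] l].
    by clear; apply/permP=> P /=; lia.
  rewrite (perm_uniq pe); clear pe.
  move: (p :: rcons _ l) aE bE cE dE uE => W aW bW cW dW uW.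
  rewrite !cons_uniq uW !inE !negb_or aW bW cW dW abn ac ad cdn.
  by rewrite [b == c]eq_sym cb bde.
have sqf (v w x y : G) : uniq [:: v; w; x; y] -> adj v w -> adj w x -> adj x y -> adj v y = false.
  by move=> u vw wx xy; apply/negP => vy; apply: (no_square u vw wx xy); rewrite adj_sym.
have um m : uniq (mask m [:: c; d; p; z1; z2; l; a; b]) by apply: mask_uniq.
have lin3 : has_linear_resolution k G 3 by rewrite -q6.
apply: (no_theta bip lin3 un) => //.
- by apply: (@sqf c d p z1) => //; apply: (um (nseq 4 true)).
- by apply: (@sqf c d p b) => //; [apply: (um [:: true; true; true; false; false; false; false; true])|rewrite adj_sym].
- by apply: (@sqf d p z1 z2) => //; apply: (um (false :: nseq 4 true)).
- apply: (@sqf d p b a) => //; [|by rewrite adj_sym|by rewrite adj_sym].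
  have pe : perm_eq [:: d; p; b; a] [:: d; p; a; b] by clear; apply/permP=> P /=; lia.
  rewrite (perm_uniq pe); exact: (um [:: false; true; true; false; false; false; true; true]).
- by apply: (@sqf p z1 z2 l) => //; apply: (um (ncons 2 false (nseq 4 true))).
- by apply: (@sqf z1 z2 l a) => //; apply: (um (ncons 3 false (nseq 4 true))).
- by apply: (@sqf z2 l a b) => //; apply: (um (ncons 4 false (nseq 4 true))).
Qed.

End LargeGirth.

(** * Fibres of the generic 2 x m matrix *)

Section ScrollFibres.
Variables (n : nat) (x y : nat -> 'I_n) (m : nat).
Hypothesis xI : forall i j, (i < m)%N -> (j < m)%N -> x i = x j -> i = j.
Hypothesis yI : forall i j, (i < m)%N -> (j < m)%N -> y i = y j -> i = j.
Hypothesis xy : forall i j, (i < m)%N -> (j < m)%N -> x i != y j.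

Definition scroll_vars := map x (iota 0 m) ++ map y (iota 0 m).

(** The relation of lying in the same fibre, expressed by exponents: the matrix
    has fixed column sums and row sums, and other variables do not move. *)
Definition scroll_equiv (e e' : 'X_{1..n}) := [/\
  forall i, i \notin scroll_vars -> e i = e' i,
  forall j, (j < m)%N -> (e (x j) + e (y j) = e' (x j) + e' (y j))%N
  & (\sum_(0 <= j < m) e (x j) = \sum_(0 <= j < m) e' (x j))%N].

Lemma scroll_vars_uniq : uniq scroll_vars.
Proof.
rewrite cat_uniq !map_inj_in_uniq ?iota_uniq ?andbT /=.
- apply/hasPn => i /mapP[j]; rewrite mem_iota add0n => jm ->.
  apply/negP => /mapP[j']; rewrite mem_iota add0n => j'm e.
  by have := xy j'm jm; rewrite e eqxx.
- by move=> i j; rewrite !mem_iota !add0n; apply: yI.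
by move=> i j; rewrite !mem_iota !add0n; apply: xI.
Qed.

Lemma scroll_varsP i : reflect (exists2 j, (j < m)%N & i = x j \/ i = y j)
  (i \in scroll_vars).
Proof.
apply: (iffP idP) => [|[j jm]].
  rewrite mem_cat => /orP[] /mapP[j]; rewrite mem_iota add0n => jm ->;
  by exists j; auto.
by rewrite mem_cat => -[] ->; rewrite map_f ?orbT // mem_iota.
Qed.

Section Shape.
Variables (N : nat) (d : 'I_n -> 'X_{1..N}) (p : nat -> 'X_{1..N}) (s t : 'X_{1..N}).
Hypothesis dx : forall j, (j < m)%N -> d (x j) = (p j + s)%MM.
Hypothesis dy : forall j, (j < m)%N -> d (y j) = (p j + t)%MM.

Lemma scroll_weight_split (e : 'X_{1..n}) v : weight d e v =
  (\sum_(i | i \notin scroll_vars) d i v * e i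
   + \sum_(0 <= j < m) p j v * (e (x j) + e (y j))
   + s v * (\sum_(0 <= j < m) e (x j)) + t v * (\sum_(0 <= j < m) e (y j)))%N.
Proof.
rewrite weightE (bigID (mem scroll_vars)) /= addnC -!addnA; congr (_ + _)%N.
rewrite -big_uniq ?scroll_vars_uniq // big_cat !big_map /= !big_distrr /=.
have -> : iota 0 m = index_iota 0 m by rewrite /index_iota subn0.
rewrite -!big_split /=; apply: eq_big_nat => j /andP[_ jm].
by rewrite dx // dy // !mnmDE !mulnDl mulnDr addnACA.
Qed.

(** The weights of the x j and y j may be those of the parametrization of the
    minors or those of a complete bipartite graph: a common part p j for each
    column and parts s, t for the rows. *)
Lemma scroll_equiv_weight e e' : scroll_equiv e e' -> weight d e = weight d e'.
Proof.
move=> [off pr sx]; apply/mnmP=> v; rewrite !scroll_weight_split sx.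
congr (_ + _ + _ + _ * _)%N.
- by apply: eq_bigr => i /off ->.
- by apply: eq_big_nat => j /andP[_ /pr ->].
apply: (@addnI (\sum_(0 <= j < m) e' (x j))%N); rewrite -{1}sx -!big_split /=.
by apply: eq_big_nat => j /andP[_ /pr ->].
Qed.

Variables (pc : nat -> 'I_N) (sc : 'I_N).
Hypothesis ppc : forall i j, (i < m)%N -> (j < m)%N -> p i (pc j) = (i == j).
Hypothesis spc : forall j, (j < m)%N -> s (pc j) = 0%N.
Hypothesis tpc : forall j, (j < m)%N -> t (pc j) = 0%N.
Hypothesis psc : forall j, (j < m)%N -> p j sc = 0%N.
Hypothesis ssc : s sc = 1%N.
Hypothesis tsc : t sc = 0%N.

(** The column and row sums are recovered from coordinates pc j and sc that
    single out the column j and the first row. *)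
Lemma weight_scroll_equiv (e e' : 'X_{1..n}) :
  (forall i, i \notin scroll_vars -> e i = e' i) ->
  weight d e = weight d e' -> scroll_equiv e e'.
Proof.
move=> off w; have offv v : (\sum_(i | i \notin scroll_vars) d i v * e i =
    \sum_(i | i \notin scroll_vars) d i v * e' i)%N.
  by apply: eq_bigr => i /off ->.
split=> // [j jm|].
  have := congr1 (fun g : 'X_{1..N} => g (pc j)) w.
  rewrite !scroll_weight_split offv !spc // !tpc // !mul0n !addn0 => /addnI.
  rewrite !(bigD1_seq j) ?mem_index_iota ?iota_uniq //= ppc // eqxx !mul1n.
  by rewrite !big1_seq ?addn0 // => i /andP[ij]; rewrite mem_index_iota => /andP[_ im];
    rewrite ppc // (negPf ij).
have := congr1 (fun g : 'X_{1..N} => g sc) w.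
rewrite !scroll_weight_split offv ssc tsc !mul0n !mul1n !addn0.
have p0 (a : 'X_{1..n}) : (\sum_(0 <= j < m) p j sc * (a (x j) + a (y j)) = 0)%N.
  by apply: big1_seq => j /andP[_]; rewrite mem_index_iota => /andP[_ jm]; rewrite psc.
by rewrite !p0 !addn0 => /addnI.
Qed.

End Shape.

Lemma scroll_weightP e e' :
  weight (scroll_weight x y m) e = weight (scroll_weight x y m) e' <-> scroll_equiv e e'.
Proof.
pose p j : 'X_{1..n + 2} := U_(lshift 2 (x j))%MM.
have dx j : (j < m)%N -> scroll_weight x y m (x j) = (p j + U_(rshift n ord0))%MM.
  by move=> jm; rewrite (scroll_weight_x _ xI).
have dy j : (j < m)%N -> scroll_weight x y m (y j) = (p j + U_(rshift n ord_max))%MM.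
  by move=> jm; rewrite (scroll_weight_y yI xy).
have wE := scroll_weight_split dx dy.
split=> [w|]; last exact: scroll_equiv_weight dx dy _ _.
apply: (weight_scroll_equiv dx dy (pc := fun j => lshift 2 (x j)) (sc := rshift n ord0)) => //.
- move=> i j im jm; rewrite mnm1E eq_shift; congr nat_of_bool.
  by apply/eqP/eqP => [/(xI im jm)|->].
- by move=> j _; rewrite mnm1E eq_shift.
- by move=> j _; rewrite mnm1E eq_shift.
- by move=> j _; rewrite mnm1E eq_shift.
- by rewrite mnm1E eqxx.
- by rewrite mnm1E eq_shift.
suff H (a : 'X_{1..n}) i : i \notin scroll_vars -> weight (scroll_weight x y m) a (lshift 2 i) = a i.
  by move=> i ic; rewrite -!H // w.
move=> ic; have pi j : (j < m)%N -> p j (lshift 2 i) = 0%N.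
  move=> jm; rewrite mnm1E eq_shift; case: eqP => // xi.
  by case/negP: ic; apply/scroll_varsP; exists j => //; left.
rewrite wE !mnm1E !eq_shift !mul0n !addn0.
rewrite [X in (_ + X)%N]big1_seq ?addn0; last first.
  by move=> j /andP[_]; rewrite mem_index_iota => /andP[_ jm]; rewrite pi.
rewrite (bigD1 i) //= big1 ?addn0 => [|i' /andP[ic' ii']];
  rewrite /scroll_weight.
  by move: ic; rewrite mem_cat negb_or => /andP[/negPf-> /negPf->]; rewrite mnm1E eqxx mul1n.
by move: ic'; rewrite mem_cat negb_or => /andP[/negPf-> /negPf->]; rewrite mnm1E eq_shift (negPf ii').
Qed.
End ScrollFibres.

Lemma monomial_ker_eq (k : fieldType) n N N' (d : 'I_n -> 'X_{1..N}) (d' : 'I_n -> 'X_{1..N'})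
    (f : {mpoly k[n]}) :
  (forall e e' : 'X_{1..n}, weight d e = weight d e' -> weight d' e = weight d' e') ->
  monomial_map d f = 0 -> monomial_map d' f = 0.
Proof.
move=> w; apply: (monomial_ker_ind (P := fun f => monomial_map d' f = 0)).
- exact: raddf0.
- by move=> p q p0 q0; rewrite raddfD /= p0 q0 addr0.
by move=> c e e' /w we; rewrite monomial_mapZ raddfB /= !monomial_mapX we subrr scaler0.
Qed.

(** * Exponents of tree edges are constant on fibres *)

Section Cuts.
Variables (G : sgraph) (side : G -> bool).
Hypothesis bip : forall x y : G, adj x y -> side x != side y.

Lemma edge_set_eq (x y a b : G) : [set x; y] = [set a; b] -> x != y ->
  (x = a /\ y = b) \/ (x = b /\ y = a).
Proof.
move=> e xy; have := set21 x y; have := set22 x y; rewrite e !in_set2.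
case/orP=> /eqP yE /orP[] /eqP xE; [|by right|by left|];
  by move: xy; rewrite xE yE eqxx.
Qed.

(** With the two sides weighted 1 and -1, the degrees of a monomial over X add up
    to the exponents of the edges leaving X: the others contribute 1 - 1 or 0. *)
Lemma cut_exponent (i : 'I_#|edges G|) (x0 y0 : G) (X : {set G}) :
  enum_val i = [set x0; y0] -> x0 \in X -> y0 \notin X ->
  (forall x y : G, adj x y -> x \in X -> y \notin X -> x = x0 /\ y = y0) ->
  forall e e' : 'X_{1..#|edges G|},
  weight (@ends G) e = weight (@ends G) e' -> e i = e' i.
Proof.
move=> iE x0X y0X cut e e' w.
pose sg (v : G) : int := if side v then 1 else -1.
suff H (a : 'X_{1..#|edges G|}) :
    \sum_(v in X) sg v * (weight (@ends G) a (enum_rank v))%:Z = sg x0 * (a i)%:Z.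
  have := H e; rewrite w H /sg; case: ifP => _ /eqP; rewrite ?mul1r ?mulN1r ?eqr_opp eqz_nat;
  by move/eqP.
have -> : \sum_(v in X) sg v * (weight (@ends G) a (enum_rank v))%:Z =
    \sum_(j < #|edges G|) (\sum_(v in X | v \in enum_val j) sg v) * (a j)%:Z.
  transitivity (\sum_(v in X) \sum_(j < #|edges G| | v \in enum_val j) sg v * (a j)%:Z).
    apply: eq_bigr => v _; rewrite weight_ends -mulr_sumr; congr (_ * _).
    exact: (big_morph Posz PoszD (erefl _)).
  rewrite (exchange_big_dep xpredT) //=; apply: eq_bigr => j _.
  by rewrite mulr_suml.
have sum2 (j : 'I_#|edges G|) (x y : G) : enum_val j = [set x; y] -> adj x y ->
    \sum_(v in X | v \in enum_val j) sg v =
    (if x \in X then sg x else 0) + (if y \in X then sg y else 0).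
  move=> jE /adj_neq xy; rewrite big_mkcondl jE /= big_setU1 ?inE //=.
  by rewrite big_set1.
rewrite (bigD1 i) //= [X in _ + X]big1 ?addr0.
  by rewrite (sum2 i x0 y0) ?x0X ?(negPf y0X) ?addr0 //; apply: adj_edge iE.
move=> j ji; have [x [y [xy jE]]] := edgeP j; rewrite (sum2 _ _ _ jE xy).
have ne (x' y' : G) : [set x'; y'] = enum_val j -> ~ (x' = x0 /\ y' = y0).
  move=> e1 [x'0 y'0]; case/negP: ji; apply/eqP/enum_val_inj.
  by rewrite -e1 iE x'0 y'0.
have := bip xy; case: ifP => xX; case: ifP => yX.
- by rewrite /sg; case: (side x) (side y) => [] [] //=; rewrite ?subrr ?addNr mul0r.
- by case: (ne x y); rewrite ?jE //; apply: cut; rewrite ?yX.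
- by case: (ne y x); rewrite ?jE 1?setUC //; apply: cut; rewrite ?xX // adj_sym.
by rewrite addr0 mul0r.
Qed.

End Cuts.

Section TreeCut.
Variable T : sgraph.
Hypothesis acT : acyclic T.

Definition without (s t : T) : rel T := fun a b => adj a b && ([set a; b] != [set s; t]).

Lemma without_sym s t : ssrbool.symmetric (without s t).
Proof. by move=> a b; rewrite /without adj_sym setUC. Qed.

(** Otherwise a simple path in the rest of the tree would close up with the
    edge to a cycle. *)
Lemma bridge (s t : T) : adj s t -> ~~ connect (without s t) s t.
Proof.
move=> st; apply/negP => /connectP[p pp tl]; case/shortenP: pp tl => p' pp' up' _ tl.
have pa : path (@adj T) s p'.
  by apply: sub_path pp' => a b /andP[].
have := acT (c := s :: p'); rewrite /ucycle up' andbT /cycle rcons_path pa -tl adj_sym st.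
move=> /(_ isT); case: p' pp' pa tl {up'} => [|a [|]] //= pp' pa tl _.
  by move: st; rewrite tl adj_irrefl.
by move: pp'; rewrite /without -tl eqxx andbF.
Qed.

End TreeCut.

Section AttachedTrees.
Variables (k : fieldType) (B : sgraph) (side : B -> bool) (m : nat).
Hypothesis bip : forall x y : B, adj x y -> side x != side y.
Local Notation K := (complete_bipartite 2 m).
Variables (T : K -> sgraph) (r : forall v, T v).
Hypothesis treeT : forall v, is_tree (T v).
Variables (f : B -> append_graphs r) (g : append_graphs r -> B).
Hypothesis fK : cancel f g.
Hypothesis gK : cancel g f.
Hypothesis fadj : forall x y : B, adj (f x) (f y) = adj x y.
Local Notation nE := #|edges B|.
Local Notation at_tree a := (Tagged T a : append_graphs r).

(** Removing the edge from its tree separates one of its ends from the root.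
    The part with this end meets the rest of the graph along this edge only. *)
Lemma tree_exponent v (s t : T v) (i : 'I_nE) : adj s t ->
  enum_val i = [set g (at_tree s); g (at_tree t)] ->
  forall e e' : 'X_{1..nE}, weight (@ends B) e = weight (@ends B) e' -> e i = e' i.
Proof.
wlog nr : s t / ~~ connect (without s t) s (r v).
  move=> W st iE; have [cr|nr] := boolP (connect (without s t) s (r v)); last exact: (W s t).
  apply: (W t s); rewrite 1?adj_sym // 1?setUC //.
  apply: contra (bridge (treeT v).2 st) => rt; apply: connect_trans cr _.
  rewrite (sym_connect_sym (@without_sym _ s t)); move: rt; apply: connect_sub => a b.
  by rewrite /without [[set t; s]]setUC => ab; apply: connect1.
move=> st iE; have nst := bridge (treeT v).2 st.
pose X := [set x : B | [exists a : T v, (f x == at_tree a) && connect (without s t) s a]].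
apply: (cut_exponent bip (X := X) iE).
- by rewrite inE gK; apply/existsP; exists s; rewrite eqxx connect0.
- rewrite inE gK; apply/negP => /existsP[a /andP[/eqP e]].
  have := congr1 (fun u : {x : K & T x} => tagged_as (Tagged T t) u) e.
  by rewrite !(tagged_asE (u := Tagged T t)) => <-; apply/negP.
move=> x y; rewrite -fadj !inE => xy /existsP[a /andP[/eqP fx sa]] ny.
move: xy; rewrite fx; case fy : (f y) => [w b] /orP[/= /andP[/eqP vw]|/and3P[/= /eqP ar _ _]]; last first.
  by move: nr; rewrite -ar sa.
subst w; rewrite /= tagged_asE => ab.
have e : [set a; b] = [set s; t].
  apply/eqP/negPn/negP => ne; case/negP: ny; apply/existsP; exists b.
  rewrite fy eqxx; apply: connect_trans sa _; apply: connect1.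
  by rewrite /without ab ne.
have [[aE bE]|[aE bE]] := edge_set_eq e (adj_neq ab).
  by rewrite -(fK x) -(fK y) fx fy aE bE.
by rewrite aE in sa; rewrite sa in nst.
Qed.

Definition root_vertex (v : K) : B := g (at_tree (r v)).

Lemma root_vertex_inj : injective root_vertex.
Proof. by move=> u v /(can_inj gK) /(congr1 (@tag _ _)). Qed.

Lemma root_vertex_adj (u v : K) : adj u v -> adj (root_vertex u) (root_vertex v).
Proof. by move=> uv; rewrite -fadj !gK; apply/orP; right; rewrite /= !eqxx. Qed.

Lemma ends2 (i : 'I_nE) (x y : B) : enum_val i = [set x; y] ->
  ends i = (U_(enum_rank y) + U_(enum_rank x))%MM.
Proof.
move=> iE; have xy := adj_neq (adj_edge iE).
apply/mnmP=> v; rewrite mnmE mnmDE !mnm1E iE in_set2 -(enum_valK v) !(inj_eq enum_rank_inj).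
rewrite enum_rankK ![enum_val v == _]eq_sym.
by case: eqP => [<-|_]; [rewrite eq_sym (negPf xy) | rewrite addn0].
Qed.

Hypothesis m2 : (2 <= m)%N.

(* Only the values at j < m matter; insubd gives a default beyond. *)
Let b (j : nat) : B := root_vertex (inr (insubd (Ordinal (ltnW m2)) j)).
Let a1 := root_vertex (inl ord0).
Let a2 := root_vertex (inl ord_max).

Let a1b j : adj a1 (b j). Proof. exact: root_vertex_adj. Qed.
Let a2b j : adj a2 (b j). Proof. exact: root_vertex_adj. Qed.

Let edge_of (v w : B) := enum_rank_in (mem_edges (a1b 0)) [set v; w].
Let x j := edge_of a1 (b j).
Let y j := edge_of a2 (b j).

Let xE j : enum_val (x j) = [set a1; b j]. Proof. by rewrite enum_rankK_in // mem_edges. Qed.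
Let yE j : enum_val (y j) = [set a2; b j]. Proof. by rewrite enum_rankK_in // mem_edges. Qed.

Let b_inj i j : (i < m)%N -> (j < m)%N -> b i = b j -> i = j.
Proof.
by move=> im jm /root_vertex_inj [] /(congr1 val); rewrite !val_insubd im jm.
Qed.

Let a12 : a1 != a2.
Proof. by apply/eqP => /root_vertex_inj. Qed.
Let ab1 j : a1 != b j. Proof. exact: adj_neq. Qed.
Let ab2 j : a2 != b j. Proof. exact: adj_neq. Qed.

Let xI i j : (i < m)%N -> (j < m)%N -> x i = x j -> i = j.
Proof.
move=> im jm /(congr1 enum_val); rewrite !xE => e; apply: b_inj => //.
by case: (edge_set_eq e (ab1 i)) => -[e1 //]; move: (ab1 j); rewrite -e1 eqxx.
Qed.

Let yI i j : (i < m)%N -> (j < m)%N -> y i = y j -> i = j.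
Proof.
move=> im jm /(congr1 enum_val); rewrite !yE => e; apply: b_inj => //.
by case: (edge_set_eq e (ab2 i)) => -[e1 //]; move: (ab2 j); rewrite -e1 eqxx.
Qed.

Let xy i j : (i < m)%N -> (j < m)%N -> x i != y j.
Proof.
move=> im jm; apply/eqP => /(congr1 enum_val); rewrite xE yE => e.
case: (edge_set_eq e (ab1 i)) => -[/eqP]; first by rewrite (negPf a12).
by rewrite (negPf (ab1 j)).
Qed.

Lemma off_core_exponent (i : 'I_nE) : i \notin scroll_vars x y m ->
  forall e e' : 'X_{1..nE}, weight (@ends B) e = weight (@ends B) e' -> e i = e' i.
Proof.
have [u [v [uv iE]]] := edgeP i => ic.
case fu : (f u) => [p s]; case fv : (f v) => [q t].
have uE : u = g (at_tree s) by apply: (can_inj fK); rewrite gK fu.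
have vE : v = g (at_tree t) by apply: (can_inj fK); rewrite gK fv.
have := uv; rewrite -fadj fu fv => /orP[/= /andP[/eqP pq]|/and3P[/= /eqP sr /eqP tr pq]].
  subst q; rewrite tagged_asE => st; apply: tree_exponent st _.
  by rewrite iE uE vE.
case/negP: ic; apply/scroll_varsP => //.
have {}uE : u = root_vertex p by rewrite uE sr.
have {}vE : v = root_vertex q by rewrite vE tr.
have bE (j : 'I_m) : root_vertex (inr j) = b j by rewrite /b valKd.
have aE (z : 'I_2) : root_vertex (inl z) = a1 \/ root_vertex (inl z) = a2.
  by case: (unliftP ord0 z) => [z' ->|->]; [right; rewrite ord1; congr (root_vertex (inl _)); apply: val_inj|left].
have H (z : 'I_2) (j : 'I_m) : enum_val i = [set root_vertex (inl z); b j] -> i = x j \/ i = y j.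
  by case: (aE z) => -> e; [left|right]; apply: enum_val_inj; rewrite ?xE ?yE.
case: p q pq {s t fu fv sr tr} uE vE => [z|j] [z'|j'] //= _ uE vE; rewrite uE vE bE in iE.
  by exists j' => //; apply: (H z).
by exists j => //; apply: (H z'); rewrite iE setUC.
Qed.

(** By off_core_exponent, lying in the same fibre is governed by the row and
    column sums of the matrix of the edges of the complete bipartite graph, so
    the toric ideal is the ideal of the 2-minors of a generic matrix with two
    rows, in a polynomial ring with the tree edges as further variables. *)
Theorem trees_linear_resolution : has_linear_resolution k B 2.
Proof.
pose p j : 'X_{1..#|B|} := U_(enum_rank (b j))%MM.
have dx j : (j < m)%N -> ends (x j) = (p j + U_(enum_rank a1))%MM by rewrite (ends2 (xE j)).
have dy j : (j < m)%N -> ends (y j) = (p j + U_(enum_rank a2))%MM by rewrite (ends2 (yE j)).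
apply: (minors_linear_resolution xI yI xy m2) => h; rewrite toric_edge_idealE.
have eqv e e' : weight (@ends B) e = weight (@ends B) e' <->
    weight (scroll_weight x y m) e = weight (scroll_weight x y m) e'.
  rewrite scroll_weightP //; split; last exact: scroll_equiv_weight dx dy _ _.
  move=> w; have w' := w; apply: (weight_scroll_equiv xI yI xy dx dy
    (pc := fun j => enum_rank (b j)) (sc := enum_rank a1)) w' => //.
  - move=> i j im jm; rewrite mnm1E (inj_eq enum_rank_inj); congr nat_of_bool.
    by apply/eqP/eqP => [/(b_inj im jm)|->].
  - by move=> j _; rewrite mnm1E (inj_eq enum_rank_inj) (negPf (ab1 j)).
  - by move=> j _; rewrite mnm1E (inj_eq enum_rank_inj) (negPf (ab2 j)).
  - by move=> j _; rewrite mnm1E (inj_eq enum_rank_inj) eq_sym (negPf (ab1 j)).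
  - by rewrite mnm1E eqxx.
  - by rewrite mnm1E (inj_eq enum_rank_inj) eq_sym (negPf a12).
  by move=> i ic; apply: off_core_exponent ic _ _ w.
by split; apply: monomial_ker_eq => e e' /eqv.
Qed.

End AttachedTrees.

Theorem theoremE (k : fieldType) (B : sgraph)
    (connB : connected B) (bipB : bipartite B) :
  (has_linear_resolution k B 2 <->
     exists m : nat, (2 <= m)%N /\
       obtained_by_appending_trees (complete_bipartite 2 m) B) /\
  (forall q : nat, (3 <= q)%N ->
     has_linear_resolution k B q -> is_hypersurface k B).
Proof.
have [side bip] := bipB; split; last first.
  by move=> q q3 lin; apply: linear_resolution_hypersurface bip lin q3.
split=> [|[m [m2 [T [r [treeT [f [[g fK gK] fadj]]]]]]]].
  exact: linear_resolution_decomposition.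
exact: (trees_linear_resolution k bip treeT fK gK fadj m2).
Qed.
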